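(* Let $k\in\mathbb N$. There exists $c>0$ such that, as $n\to\infty$ (with $r=r(n)$), $$\mathrm{Var}[S_{n,k}]=\mathbb E[S_{n,k}]\big(1+O(e^{-cnr^d})\big).$$
   Context: Setting. Let $d\in\mathbb N$; $\mathrm{Vol}$ is Lebesgue measure, $\theta$ is the volume of the unit-radius ball in $\mathbb R^d$. Let $A\subset\mathbb R^d$ be compact with $\mathrm{Vol}(A)>0$. If $d\ge2$, $A$ has a $C^{1,1}$ boundary: for each $x\in\partial A$ there are a neighbourhood $U$ of $x$ and a real-valued function $\phi$, defined on an open set in $\mathbb R^{d-1}$ and differentiable with Lipschitz continuous partial derivatives, such that $\partial A\cap U$, after a rotation, is the graph of $\phi$. If $d=1$, $A$ is an interval. Let $X_1,X_2,\ldots$ be i.i.d. random vectors in $\mathbb R^d$ with distribution $\nu$ having density $f$ and support $A$, with $f$ continuous on $A$. Put $f_0=\inf_Af$, $f_1=\inf_{\partial A}f$, and assume $f_0>0$. For $n\in\mathbb N$ let $\mathcal X_n=\{X_1,\ldots,X_n\}$. For finite $\mathcal X\subset\mathbb R^d$ and $r>0$, $G(\mathcal X,r)$ is the graph on $\mathcal X$ with an edge between each pair of distinct points at Euclidean distance at most $r$, and $K_{k,r}(\mathcal X)$ is the number of connected components of $G(\mathcal X,r)$ with exactly $k$ vertices. Put $S_{n,k}=K_{k,r(n)}(\mathcal X_n)$. The sequence $r=r(n)>0$ satisfies $\lim_{n\to\infty}nr(n)^d=\infty$ and $\limsup_{n\to\infty}\frac{\theta nr(n)^d}{\log n}<\frac1{\max(f_0,\,d(f_0-f_1/2))}$.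 *)

(* Defs.v *)
From HB Require Import structures.
From mathcomp Require Import all_boot all_order all_algebra.
From mathcomp Require Import finmap.
From mathcomp Require Import all_classical all_reals all_analysis.

Set Implicit Arguments.
Unset Strict Implicit.
Unset Printing Implicit Defensive.

Import Order.TTheory GRing.Theory Num.Theory.
Import numFieldNormedType.Exports.

Local Open Scope classical_set_scope.
Local Open Scope ring_scope.

Definition rV_display : measure_display.
Proof. exact: default_measure_display. Qed.

Section measurable_rV.
Context {R : realType} (d : nat).

Let coor (i : 'I_d) (x : 'rV[R]_d) : measurableTypeR R := x ord0 i.

(* The sigma-algebra generated by the coordinates, i.e. the Borel one. *)
Definition rV_measurable : set (set 'rV[R]_d) := g_sigma_preimage coor.

Let rV_set0 : rV_measurable set0.
Proof. exact: sigma_algebra0. Qed.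

Let rV_setC A : rV_measurable A -> rV_measurable (~` A).
Proof. exact: sigma_algebraC. Qed.

Let rV_bigcup (F : (set 'rV[R]_d)^nat) :
  (forall i, rV_measurable (F i)) -> rV_measurable (\bigcup_i (F i)).
Proof. exact: sigma_algebra_bigcup. Qed.

HB.instance Definition _ := @isMeasurable.Build rV_display 'rV[R]_d
  rV_measurable rV_set0 rV_setC rV_bigcup.

Lemma measurable_coor (i : 'I_d) :
  measurable_fun [set: 'rV[R]_d] (fun x : 'rV[R]_d => x ord0 i).
Proof.
move=> _ Y mY; rewrite setTI; apply: sub_sigma_algebra => /=.
rewrite -bigcup_seq/=; exists i => /=; first by rewrite mem_index_enum.
by exists Y => //; rewrite setTI.
Qed.

Lemma measurable_fun_rV d0 (T : measurableType d0) (f : T -> 'rV[R]_d) :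
  (forall i, measurable_fun [set: T] (fun t => f t ord0 i)) ->
  measurable_fun [set: T] f.
Proof.
move=> mf _ Y mY; rewrite setTI.
have -> : measurable (f @^-1` Y) = (image_set_system setT f measurable) Y.
  by rewrite /image_set_system/= setTI.
apply: mY; split; first exact/sigma_algebra_image/sigma_algebra_measurable.
move=> A; rewrite -bigcup_seq/= => -[i _ [B mB <-]].
by rewrite /image_set_system/= setTI setTI; have := mf i measurableT B mB; rewrite setTI.
Qed.

End measurable_rV.

Section lebesgue_rV.
Context {R : realType}.

Definition rV_cons d (p : measurableTypeR R * 'rV[R]_d) : 'rV[R]_d.+1 :=
  \row_i oapp (p.2 ord0) p.1 (unlift ord0 i).

Definition rV_uncons d (x : 'rV[R]_d.+1) : measurableTypeR R * 'rV[R]_d :=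
  (x ord0 ord0, \row_j x ord0 (lift ord0 j)).

Lemma rV_consK d : cancel (@rV_cons d) (@rV_uncons d).
Proof.
move=> [a v]; rewrite /rV_uncons !mxE unlift_none; congr pair.
by apply/rowP => j; rewrite !mxE liftK.
Qed.

Lemma measurable_rV_cons d :
  measurable_fun [set: measurableTypeR R * 'rV[R]_d] (@rV_cons d).
Proof.
apply: measurable_fun_rV => i; have [j ->|->] := unliftP ord0 i.
  under eq_fun do rewrite mxE liftK /=.
  by apply: (measurableT_comp (measurable_coor j)); exact: measurable_snd.
by under eq_fun do rewrite mxE unlift_none /=; exact: measurable_fst.
Qed.

Lemma measurable_rV_uncons d :
  measurable_fun [set: 'rV[R]_d.+1] (@rV_uncons d).
Proof.
apply/measurable_fun_pairP; split; first exact: measurable_coor.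
apply: measurable_fun_rV => j.
by under eq_fun do rewrite mxE; exact: measurable_coor.
Qed.

Section lebesgue_rVS.
Context (d : nat) (mu : {sigma_finite_measure set 'rV[R]_d -> \bar R}).

Definition lebesgue_rVS : set 'rV[R]_d.+1 -> \bar R :=
  pushforward (lebesgue_measure \x mu)%E (@rV_cons d).

HB.instance Definition _ := Measure.copy lebesgue_rVS
  (measure_function_pushforward__canonical__measure_function_Measure
    (lebesgue_measure \x mu)%E (@measurable_rV_cons d)).

Let lebesgue_rVS_sigma_finite : sigma_finite setT lebesgue_rVS.
Proof.
have /sigma_finiteP[F [UF ndF Foo]] := sigma_finiteT (@lebesgue_measure R).
have /sigma_finiteP[G [UG ndG Goo]] := sigma_finiteT mu.
have preFG k : @rV_cons d @^-1` (@rV_uncons d @^-1` (F k `*` G k)) =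
    F k `*` G k.
  rewrite -comp_preimage (_ : _ \o _ = id)//.
  by apply/funext => p; exact: rV_consK.
exists (fun k => @rV_uncons d @^-1` (F k `*` G k)).
  apply/esym; rewrite -subTset => x _.
  have [i _ Fi] : (\bigcup_i F i) (rV_uncons x).1 by rewrite -UF.
  have [j _ Gj] : (\bigcup_j G j) (rV_uncons x).2 by rewrite -UG.
  exists (maxn i j) => //; split.
  - by move: Fi; exact/subsetPset/ndF/leq_maxl.
  - by move: Gj; exact/subsetPset/ndG/leq_maxr.
move=> k; have [mF Fkoo] := Foo k; have [mG Gkoo] := Goo k; split.
  rewrite -[X in measurable X]setTI; apply: measurable_rV_uncons => //.
  exact: measurableX.
rewrite /lebesgue_rVS /pushforward preFG product_measure1E//.
by rewrite lte_mul_pinfty// ge0_fin_numE.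
Qed.

HB.instance Definition _ :=
  Measure_isSigmaFinite.Build _ _ _ lebesgue_rVS lebesgue_rVS_sigma_finite.

End lebesgue_rVS.

Fixpoint lebesgue_rV (d : nat) : {sigma_finite_measure set 'rV[R]_d -> \bar R} :=
  match d with
  | 0 => \d_(0 : 'rV[R]_0)
  | d'.+1 => lebesgue_rVS (lebesgue_rV d')
  end.

Lemma lebesgue_rV_box d (B : 'I_d -> set (measurableTypeR R)) :
  (forall i, measurable (B i)) ->
  lebesgue_rV d [set x : 'rV[R]_d | forall i, B i (x ord0 i)] =
  (\prod_(i < d) lebesgue_measure (B i))%E.
Proof.
elim: d B => [|d IH] B mB.
  by rewrite big_ord0 /= diracE mem_set// => -[].
rewrite big_ord_recl -IH; last by move=> i; exact: mB.
rewrite -product_measure1E; first last.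
- rewrite (_ : [set x | _] = \bigcap_(i in [set: 'I_d])
      ((fun x : 'rV[R]_d => x ord0 i) @^-1` B (lift ord0 i))); last first.
    by apply/seteqP; split=> x /= h i //; [move=> _; exact: h|exact: h].
  apply: fin_bigcap_measurable => // i _.
  by rewrite -[X in measurable X]setTI; apply: measurable_coor => //; exact: mB.
- exact: mB.
congr (product_measure1 _ _ _); apply/seteqP; split=> -[a v] /=.
  move=> h; split; first by have := h ord0; rewrite mxE unlift_none.
  by move=> i; have := h (lift ord0 i); rewrite mxE liftK.
move=> [aB vB] i; rewrite mxE.
by have [j ->|->] := unliftP ord0 i; rewrite ?liftK ?unlift_none.
Qed.

End lebesgue_rV.

Section geometry.
Context {R : realType}.

(* The library norm `|x| on 'rV[R]_d is the sup norm; its topology is the usual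
   one, but distances in the geometric graph are Euclidean. *)
Definition enorm d (x : 'rV[R]_d) : R := Num.sqrt (\sum_i x ord0 i ^+ 2).

Definition unit_ball_volume d : R :=
  fine (lebesgue_rV d [set x : 'rV[R]_d | enorm x <= 1]).

Definition boundary (T : topologicalType) (A : set T) : set T :=
  closure A `\` interior A.

Definition rotation d (Q : 'M[R]_d) : Prop := Q *m Q^T = 1%:M /\ \det Q = 1.

(* For the sup norm or the Euclidean norm on the domain, the Lipschitz
   condition is the same, up to the constant. *)
Definition C11_function m (D : set 'rV[R]_m) (phi : 'rV[R]_m -> R) : Prop :=
  [/\ open D,
      forall y, D y -> differentiable phi y &
      forall j : 'I_m, [lipschitz 'D_(delta_mx ord0 j) phi y | y in D]].

Definition rV_front d (z : 'rV[R]_d) : 'rV[R]_d.-1 :=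
  \row_(j < d.-1) z ord0 (widen_ord (leq_pred d) j).

(* The points (y, phi y) with y in D, for d > 0. *)
Definition graph_of d (D : set 'rV[R]_d.-1) (phi : 'rV[R]_d.-1 -> R) :
    set 'rV[R]_d :=
  [set z | D (rV_front z) /\
           forall i : 'I_d, i = d.-1 :> nat -> z ord0 i = phi (rV_front z)].

Definition C11_boundary d (A : set 'rV[R]_d) : Prop :=
  forall x, boundary A x ->
  exists (U : set 'rV[R]_d) (D : set 'rV[R]_d.-1) (phi : 'rV[R]_d.-1 -> R)
         (Q : 'M[R]_d),
    [/\ nbhs x U, C11_function D phi, rotation Q &
        [set z *m Q | z in boundary A `&` U] = graph_of D phi].

Definition geometric_graph d (X : {fset 'rV[R]_d}) (r : R) : rel X :=
  fun x y => (x != y) && (enorm (val x - val y) <= r).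

Definition num_components d (k : nat) (r : R) (X : {fset 'rV[R]_d}) : nat :=
  #|[set C in equivalence_partition (connect (@geometric_graph d X r)) [set: X]
      | #|C| == k]%SET|.

End geometry.

Section random_points.
Context {disp disp' : measure_display} {Omega : measurableType disp}
  {T : measurableType disp'} {R : realType} (P : probability Omega R).

Definition mutually_independent (X : nat -> {RV P >-> T}) : Prop :=
  forall (J : {fset nat}) (B : nat -> set T),
    (forall j, measurable (B j)) ->
    P (\bigcap_(j in [set` J]) (X j @^-1` B j)) =
    (\prod_(j <- J) P (X j @^-1` B j))%E.

Definition iid (X : nat -> {RV P >-> T}) (nu : probability T R) : Prop :=
  mutually_independent X /\
  forall i B, measurable B -> distribution P (X i) B = nu B.

End random_points.

Section sample.
Context {R : realType} (d : nat).

Definition has_density (nu : probability 'rV[R]_d R) (f : 'rV[R]_d -> R) : Prop :=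
  [/\ measurable_fun [set: 'rV[R]_d] f,
      forall x, 0 <= f x &
      forall B, measurable B -> nu B = (\int[lebesgue_rV d]_(x in B) (f x)%:E)%E].

Definition support_of (nu : probability 'rV[R]_d R) : set 'rV[R]_d :=
  [set x | forall U, open U -> U x -> (0 < nu U)%E].

Context {disp : measure_display} {Omega : measurableType disp}
  {P : probability Omega R}.

(* The points X_1, ..., X_n are X 0, ..., X n.-1. *)
Definition sample (X : nat -> {RV P >-> 'rV[R]_d}) (n : nat) (w : Omega) :
    {fset 'rV[R]_d} :=
  [fset X (val i) w | i : 'I_n]%fset.

Definition component_count (X : nat -> {RV P >-> 'rV[R]_d}) (r : nat -> R)
    (k n : nat) (w : Omega) : R :=
  (num_components k (r n) (sample X n w))%:R.

End sample.

(* Main.v *)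
Require Import Defs.
From HB Require Import structures.
From mathcomp Require Import all_boot all_order all_algebra.
From mathcomp Require Import finmap.
From mathcomp Require Import all_classical all_reals all_analysis.
From mathcomp Require Import measurable_realfun.
From mathcomp Require Import ring lra zify.

(* Write X_I for the points with indices in a set I of k indices, and xi_I for
   the indicator of X_I spanning a component, so that S is almost surely the sum
   of the xi_I.  Since xi_I xi_J = 0 for intersecting I and J with I <> J,
   Var S - E S is the sum of E[xi_I xi_J] - E xi_I E xi_J over disjoint I and J,
   minus the sum of E xi_I E xi_J over intersecting I and J, the case I = J
   included.  Given X_I, the remaining points avoid the union B(X_I) of the
   r-balls about X_I with probability (1 - nu(B(X_I)))^(n-k).  If X_I and X_J are
   more than 2r apart, then nu(B(X_I) u B(X_J)) = nu(B(X_I)) + nu(B(X_J)) and the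
   covariance costs a relative error O(r^d + n r^(2d)).  If they are closer than
   2r but more than r apart, which has probability O(r^(dk)), then
   nu(B(X_I) u B(X_J)) exceeds nu(B(X_I)) or nu(B(X_J)) by at least a constant
   times r^d, which yields a factor exp(-c n r^d).  Summing over J gives
   |Var S - E S| <= E S * C (1 + n r^d)^(k+1) exp(-c n r^d).

   All lower bounds on the mass of balls rest on a uniform interior cone
   condition for A.  Near a boundary point A is a union of sides of the graph of
   a Lipschitz function, and at least one side since the graph has nu-measure
   zero while every neighbourhood of a point of A has positive measure. *)

Set Implicit Arguments.
Unset Strict Implicit.
Unset Printing Implicit Defensive.

Import Order.TTheory GRing.Theory Num.Theory.
Import numFieldNormedType.Exports.

Local Open Scope classical_set_scope.
Local Open Scope ring_scope.

(** * Euclidean norm and balls *)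

(** The error has to be relative to E S, which may be small. Every error term is therefore kept as a
    multiple of some p_I = E xi_I: for disjoint I and J the covariance is bounded by a p_I p_J + b
    (p_I + p_J). Summation then leaves E S as a factor, and no lower bound on E S enters.

    To this end p_I p_J and E[xi_I xi_J] are both written as means of explicit functions of X_I and
    X_J, indicators times powers of 1 - mass, and these functions are compared pointwise. The
    exponents differ, n - k for one block and n - 2k for two; the k missing factors cost little,
    since k times a mass is at most 1/4 once r^d is small.

    Close pairs are the obstacle. There are up to n^k sets J for each I, each close with probability
    O(r^(dk)), together (n r^d)^k, which is unbounded; only an exponential gain makes them
    negligible, and this is where the shape of A matters. Afterwards everything is a power of s = n
    r^d, at most s^(k+1), times an exponential of -s; half of the exponent pays for the power. *)

Section enorm.
Context {R : realType} {d : nat}.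
Implicit Types x y z : 'rV[R]_d.

Definition dotv x y : R := \sum_i x ord0 i * y ord0 i.

Lemma dotvC x y : dotv x y = dotv y x.
Proof. by apply: eq_bigr => i _; rewrite mulrC. Qed.

Lemma dotvDl x y z : dotv (x + y) z = dotv x z + dotv y z.
Proof. by rewrite -big_split; apply: eq_bigr => i _; rewrite mxE mulrDl. Qed.

Lemma dotvDr x y z : dotv z (x + y) = dotv z x + dotv z y.
Proof. by rewrite dotvC dotvDl !(dotvC z). Qed.

Lemma dotvZl a x y : dotv (a *: x) y = a * dotv x y.
Proof. by rewrite mulr_sumr; apply: eq_bigr => i _; rewrite mxE mulrA. Qed.

Lemma dotvZr a x y : dotv x (a *: y) = a * dotv x y.
Proof. by rewrite dotvC dotvZl dotvC. Qed.

Lemma dotvNl x y : dotv (- x) y = - dotv x y.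
Proof. by rewrite -scaleN1r dotvZl mulN1r. Qed.

Lemma dotvNr x y : dotv x (- y) = - dotv x y.
Proof. by rewrite -scaleN1r dotvZr mulN1r. Qed.

Lemma dotv_ge0 x : 0 <= dotv x x.
Proof. by apply: sumr_ge0 => i _; rewrite -expr2 sqr_ge0. Qed.

Lemma enormE x : enorm x = Num.sqrt (dotv x x).
Proof. by congr Num.sqrt; apply: eq_bigr => i _; rewrite expr2. Qed.

Lemma sqr_enorm x : enorm x ^+ 2 = dotv x x.
Proof. by rewrite enormE sqr_sqrtr// dotv_ge0. Qed.

Lemma enorm_ge0 x : 0 <= enorm x.
Proof. exact: sqrtr_ge0. Qed.

Lemma enorm_le x (a : R) : 0 <= a -> (enorm x <= a) = (dotv x x <= a ^+ 2).
Proof. by move=> a0; rewrite -sqr_enorm ler_pXn2r// nnegrE// enorm_ge0. Qed.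

Lemma enormN x : enorm (- x) = enorm x.
Proof. by rewrite !enormE dotvNl dotvNr opprK. Qed.

Lemma enormB x y : enorm (x - y) = enorm (y - x).
Proof. by rewrite -enormN opprB. Qed.

Lemma enorm0 : enorm (0 : 'rV[R]_d) = 0.
Proof. by rewrite enormE /dotv big1 ?sqrtr0// => i _; rewrite mxE mul0r. Qed.

Lemma enormZ a x : enorm (a *: x) = `|a| * enorm x.
Proof.
by rewrite !enormE dotvZl dotvZr mulrA -expr2 sqrtrM ?sqr_ge0// sqrtr_sqr.
Qed.

Lemma cauchy_schwarz x y : dotv x y <= enorm x * enorm y.
Proof.
have [n0|n0] := eqVneq (enorm x * enorm y) 0.
  have h (u v : 'rV[R]_d) : enorm u = 0 -> dotv u v = 0.
    move=> /(congr1 (fun a => a ^+ 2)); rewrite sqr_enorm expr0n /= => /eqP.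
    rewrite psumr_eq0; last by move=> i _; rewrite -expr2 sqr_ge0.
    move=> /allP u0; apply: big1 => i _.
    by move: (u0 i); rewrite mem_index_enum -expr2 sqrf_eq0 => /(_ isT) /eqP->; rewrite mul0r.
  rewrite n0; move/eqP: n0; rewrite mulf_eq0 => /orP[] /eqP /h h0.
    by rewrite h0.
  by rewrite dotvC h0.
have np : 0 < enorm x * enorm y by rewrite lt_neqAle eq_sym n0 mulr_ge0// enorm_ge0.
have := dotv_ge0 (enorm y *: x - enorm x *: y).
rewrite !(dotvDl, dotvDr, dotvNl, dotvNr, dotvZl, dotvZr) (dotvC y x) -!sqr_enorm => h.
rewrite -(ler_pM2l np).
nra.
Qed.

Lemma enormD x y : enorm (x + y) <= enorm x + enorm y.
Proof.
rewrite enorm_le ?addr_ge0 ?enorm_ge0//.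
rewrite !(dotvDl, dotvDr) (dotvC y x) -!sqr_enorm.
have := cauchy_schwarz x y; nra.
Qed.

Lemma enorm_triangle y x z : enorm (x - z) <= enorm (x - y) + enorm (y - z).
Proof. by apply: le_trans (enormD _ _); rewrite addrA subrK. Qed.

Lemma coord_le_enorm x i : `|x ord0 i| <= enorm x.
Proof.
rewrite -(ler_pXn2r (n := 2))// ?nnegrE ?enorm_ge0// sqr_enorm real_normK ?num_real//.
rewrite /dotv (bigD1 i)//= -expr2 lerDl; apply: sumr_ge0 => j _.
by rewrite -expr2 sqr_ge0.
Qed.

Lemma mx_norm_le x (a : R) : 0 <= a ->
  (`|x| <= a) <-> (forall i, `|x ord0 i| <= a).
Proof.
move=> a0; have -> : `|x| = \big[Num.max/0]_ij `|x ij.1 ij.2| := mx_normrE x.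
split.
  by move=> /bigmax_leP[_ h] i; exact: (h (ord0, i)).
by move=> h; apply/bigmax_leP; split => // -[i j] _ /=; rewrite (ord1 i); exact: h.
Qed.

Lemma norm_le_enorm x : `|x| <= enorm x.
Proof. by apply: (iffRL (mx_norm_le _ (enorm_ge0 x))) => i; exact: coord_le_enorm. Qed.

Lemma coord_le_norm x i : `|x ord0 i| <= `|x|.
Proof. by apply: (mx_norm_le x (normr_ge0 x)).1. Qed.

(** The factor [d] instead of its square root is harmless: only orders of magnitude in the radius
    matter below. *)
Lemma enorm_le_norm x : enorm x <= d%:R * `|x|.
Proof.
rewrite enorm_le ?mulr_ge0//.
apply: (@le_trans _ _ (\sum_(i < d) `|x| ^+ 2)).
  apply: ler_sum => i _; rewrite -expr2 -real_normK ?num_real//.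
  by rewrite ler_pXn2r ?nnegrE// coord_le_norm.
rewrite sumr_const card_ord -[_ *+ d]mulr_natl exprMn ler_wpM2r ?sqr_ge0//.
by rewrite -natrX ler_nat; case: d => // n; rewrite expnS expn1 leq_pmulr.
Qed.

End enorm.

(** * Borel sets, and volumes of cubes and balls *)

Section measurability.
Context {R : realType} {d : nat}.
Implicit Types x y z : 'rV[R]_d.

Lemma measurable_rV_box (B : 'I_d -> set (measurableTypeR R)) :
  (forall i, measurable (B i)) ->
  measurable [set x : 'rV[R]_d | forall i, B i (x ord0 i)].
Proof.
move=> mB; rewrite (_ : [set x | _] = \bigcap_(i in [set: 'I_d])
    ((fun x : 'rV[R]_d => x ord0 i) @^-1` B i)); last first.
  by apply/seteqP; split=> x /= h i //; [move=> _; exact: h|exact: h].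
apply: fin_bigcap_measurable => // i _.
by rewrite -[X in measurable X]setTI; apply: measurable_coor => //; exact: mB.
Qed.

(** A base of the topology indexed by a countable type. The sigma-algebra is generated by the
    coordinates, so measurability of open sets has to be derived; in the sup norm these balls are
    boxes. *)
Definition rat_ball (p : 'rV[rat]_d * nat) : set 'rV[R]_d :=
  ball (map_mx ratr p.1 : 'rV[R]_d) p.2.+1%:R^-1.

Lemma rat_ball_box p : rat_ball p = [set x : 'rV[R]_d |
  forall i, ball (ratr (p.1 ord0 i) : R) p.2.+1%:R^-1 (x ord0 i)].
Proof.
apply/seteqP; split => x /=.
  by move=> [_ h] i; have := h ord0 i; rewrite mxE.
move=> h; split; first by rewrite invr_gt0.
by move=> i j; rewrite (ord1 i) mxE.
Qed.

Lemma measurable_rat_ball p : measurable (rat_ball p).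
Proof.
rewrite rat_ball_box.
apply: (measurable_rV_box (B := fun i => ball (ratr (p.1 ord0 i) : R) _)) => i.
by rewrite ball_itv; exact: measurable_itv.
Qed.

Lemma open_rat_balls (O : set 'rV[R]_d) : open O ->
  exists G : nat -> 'rV[rat]_d * nat, exists D : set nat,
    O = \bigcup_(n in D) rat_ball (G n).
Proof.
(* Integers that code no pair are sent to an arbitrary ball; the index set keeps only balls inside
   [O], so the default does no harm. *)
move=> oO; pose G (n : nat) := odflt (0, 0%N) (choice.unpickle n : option ('rV[rat]_d * nat)).
exists G, [set n | rat_ball (G n) `<=` O].
apply/seteqP; split => [x Ox|x [n /= h] /h//].
have /nbhs_ballP[e /= e0 eO] := open_nbhs_nbhs (conj oO Ox).
have e20 : 0 < e / 2 by rewrite divr_gt0.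
(* With radius below [e / 2], a ball whose centre is within its radius of [x] contains [x] and stays
   within [e] of it. *)
pose m := Num.truncn (e / 2)^-1.
have me : m.+1%:R^-1 < e / 2.
  by rewrite invf_plt ?posrE ?truncnS_gt.
pose P i := [set q : rat | `|x ord0 i - ratr q| < m.+1%:R^-1].
have Pex i : exists q, P i q.
  have : x ord0 i - m.+1%:R^-1 < x ord0 i + m.+1%:R^-1.
    by rewrite ltrBlDr -addrA ltrDl addr_gt0// invr_gt0.
  by move=> /rat_in_itvoo[q]; rewrite in_itv/= => /andP[q1 q2]; exists q;
    rewrite /P /= ltr_norml; move: q1 q2; set h := _^-1 => q1 q2; apply/andP; split; lra.
pose q : 'rV[rat]_d := \row_i xget 0 (P i).
have qP i : P i (q ord0 i) by rewrite mxE; have [q' q'P] := Pex i; exact: (xgetPex 0 (Pex i)).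
have GE : G (choice.pickle (q, m)) = (q, m) by rewrite /G choice.pickleK.
exists (choice.pickle (q, m)) => /=; rewrite GE rat_ball_box.
  move=> y /= hy; apply: eO; rewrite mx_norm_ball /ball_ /=.
  apply: le_lt_trans (_ : m.+1%:R^-1 + m.+1%:R^-1 < e); last first.
    by rewrite [ltRHS](splitr e) ltrD.
  apply: (iffRL (mx_norm_le _ _)); first by rewrite addr_ge0.
  move=> i; rewrite !mxE -(subrKA (ratr (q ord0 i))).
  apply: le_trans (ler_normD _ _) _; apply: lerD; apply: ltW; first exact: qP.
  by have := hy i.
by move=> i /=; rewrite /ball/= distrC; exact: qP.
Qed.

Lemma open_rV_measurable (O : set 'rV[R]_d) : open O -> measurable O.
Proof.
move=> /open_rat_balls[G [D ->]]; apply: bigcup_measurable => n _.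
exact: measurable_rat_ball.
Qed.

Lemma closed_rV_measurable (C : set 'rV[R]_d) : closed C -> measurable C.
Proof.
move=> cC; rewrite -(setCK C); apply: measurableC; apply: open_rV_measurable.
exact: closed_openC.
Qed.

Lemma measurable_fun_enorm : measurable_fun [set: 'rV[R]_d] (@enorm R d).
Proof.
apply: (@measurableT_comp _ _ _ _ _ _ (@Num.sqrt R)).
  apply: continuous_measurable_fun; exact: sqrt_continuous.
apply: measurable_sum => i; apply: measurable_funX; exact: measurable_coor.
Qed.

Definition eball x (s : R) : set 'rV[R]_d := [set y | enorm (y - x) <= s].

Lemma measurable_eball x (s : R) : measurable (eball x s).
Proof.
have h : measurable_fun [set: 'rV[R]_d] (fun y : 'rV[R]_d => enorm (y - x)).
  apply: (measurableT_comp measurable_fun_enorm).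
  apply: measurable_fun_rV => i; under eq_fun do rewrite !mxE.
  apply: measurable_funD; [exact: measurable_coor|exact: measurable_cst].
have := h measurableT `]-oo, s]%classic (measurable_itv _).
by rewrite setTI; congr measurable; apply/seteqP; split => y /=; rewrite in_itv.
Qed.

Lemma cube_box x (s : R) :
  [set y : 'rV[R]_d | forall i, `|y ord0 i - x ord0 i| <= s] =
  [set y | forall i, `[x ord0 i - s, x ord0 i + s]%classic (y ord0 i)].
Proof.
by apply/seteqP; split => y /= h i; have := h i; rewrite in_itv/= ler_distl.
Qed.

Lemma lebesgue_rV_cube x (s : R) : 0 <= s ->
  lebesgue_rV d [set y | forall i, `|y ord0 i - x ord0 i| <= s] =
  ((2 * s) ^+ d)%:E.
Proof.
move=> s0.
rewrite [X in lebesgue_rV d X]cube_box.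
rewrite (lebesgue_rV_box (B := fun i => `[x ord0 i - s, x ord0 i + s]%classic)); last first.
  by move=> i; exact: measurable_itv.
rewrite (eq_bigr (fun=> (2 * s)%:E)).
  by rewrite prodEFin prodr_const card_ord.
move=> i _; rewrite lebesgue_measure_itv /= lte_fin.
case: ltP => h; first by rewrite -EFinB; congr EFin; ring.
by rewrite (_ : s = 0) ?mulr0//; lra.
Qed.

Lemma measurable_cube x (s : R) :
  measurable [set y : 'rV[R]_d | forall i, `|y ord0 i - x ord0 i| <= s].
Proof.
rewrite cube_box.
apply: (measurable_rV_box (B := fun i => `[x ord0 i - s, x ord0 i + s]%classic)) => i.
exact: measurable_itv.
Qed.

Lemma lebesgue_rV_ball_le x (s : R) : 0 <= s ->
  (lebesgue_rV d (eball x s) <= ((2 * s) ^+ d)%:E)%E.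
Proof.
move=> s0; rewrite -(lebesgue_rV_cube x s0).
apply: le_measure; rewrite ?inE; [exact: measurable_eball|exact: measurable_cube|].
move=> y /= h i; have := coord_le_enorm (y - x) i; rewrite !mxE => h'.
exact: le_trans h' h.
Qed.

(** By [enorm_le_norm] the ball contains the cube of half-side [s / d]. *)
Lemma lebesgue_rV_ball_ge x (s : R) : (0 < d)%N -> 0 <= s ->
  (((2 * (s / d%:R)) ^+ d)%:E <= lebesgue_rV d (eball x s))%E.
Proof.
move=> d0 s0; have sd : 0 <= s / d%:R by rewrite divr_ge0.
rewrite -(lebesgue_rV_cube x sd).
apply: le_measure; rewrite ?inE; [exact: measurable_cube|exact: measurable_eball|].
move=> y /= h; apply: le_trans (enorm_le_norm _) _.
rewrite mulrC -ler_pdivlMr ?ltr0n//; apply: (iffRL (mx_norm_le _ sd)) => i.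
by have := h i; rewrite !mxE.
Qed.

End measurability.

(** * Independent blocks of variables *)

Section pi_system.
Context {disp d0 : measure_display} {Omega : measurableType disp}
  {T : measurableType d0} {R : realType} (P : probability Omega R).

(** Both sides are finite measures in [A] that agree on a generating pi-system, hence coincide. The
    second is the law of [Y] scaled by the number [P C]. *)
Lemma pi_system_independent (Y : Omega -> T) (C : set Omega) (G : set (set T)) :
  measurable_fun setT Y -> measurable C ->
  measurable = <<s G >> -> setI_closed G -> G setT ->
  (forall A, G A -> P (Y @^-1` A `&` C) = (P (Y @^-1` A) * P C)%E) ->
  forall A, measurable A -> P (Y @^-1` A `&` C) = (P (Y @^-1` A) * P C)%E.
Proof.
move=> mY mC GE GI GT PG A mA.
pose Y' : {RV P >-> T} := HB.pack Y (isMeasurableFun.Build _ _ _ _ _ mY).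
have C0 : (0 <= fine (P C))%R by rewrite fine_ge0.
pose m2 : {measure set T -> \bar R} := mscale (NngNum C0) (distribution P Y').
pose m1 : {measure set T -> \bar R} := pushforward (mrestr P mC) Y'.
have m2E B : m2 B = (P (Y @^-1` B) * P C)%E.
  by rewrite /m2 /mscale /= /mscale /= fineK ?fin_num_measure// muleC.
rewrite -m2E -[LHS]/(m1 mY A).
apply: (measure_unique G (fun=> setT) _ _ _ _ (m1 mY) m2) => //.
- by rewrite bigcup_const.
- by move=> B GB; rewrite m2E -PG.
- move=> _; rewrite /m1/= /pushforward /mrestr /=.
  rewrite preimage_setT setTI.
  by apply: (le_lt_trans (probability_le1 _ _)); rewrite ?ltry.
Qed.

End pi_system.

Section independence.
Context {disp d1 d2 : measure_display} {Omega : measurableType disp}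
  {T1 : measurableType d1} {T2 : measurableType d2} {R : realType}
  (P : probability Omega R).
Implicit Types (Y : Omega -> T1) (Z : Omega -> T2).

Definition independent_pair Y Z := forall A B, measurable A -> measurable B ->
  P (Y @^-1` A `&` Z @^-1` B) = (P (Y @^-1` A) * P (Z @^-1` B))%E.

(** Independence makes the law of the pair the product of the laws, and Tonelli's theorem integrates
    one variable with the other held fixed. This stands in for conditional expectations
    throughout. *)
Lemma freezing Y Z (F : T1 * T2 -> \bar R) :
  measurable_fun setT Y -> measurable_fun setT Z -> independent_pair Y Z ->
  measurable_fun setT F -> (forall z, (0 <= F z)%E) ->
  (\int[P]_w F (Y w, Z w) = \int[P]_w \int[P]_w' F (Y w, Z w'))%E.
Proof.
move=> mY mZ YZ mF F0.
pose Y' : {RV P >-> T1} := HB.pack Y (isMeasurableFun.Build _ _ _ _ _ mY).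
pose Z' : {RV P >-> T2} := HB.pack Z (isMeasurableFun.Build _ _ _ _ _ mZ).
have mW : measurable_fun setT (fun w => (Y w, Z w)).
  exact/measurable_fun_pairP.
pose W' : {RV P >-> (T1 * T2)%type} :=
  HB.pack (fun w => (Y w, Z w)) (isMeasurableFun.Build _ _ _ _ _ mW).
have WE X : measurable X ->
    (distribution P Y' \x distribution P Z')%E X = distribution P W' X.
  by apply: product_measure_unique => A B mA mB; exact: YZ.
rewrite -[LHS](ge0_integral_distribution W')//.
transitivity (\int[(distribution P Y' \x distribution P Z')%E]_z F z)%E.
  by apply: eq_measure_integral => A mA _; exact/esym/WE.
rewrite fubini_tonelli1// (ge0_integral_distribution Y')//; first last.
- by move=> y; apply: integral_ge0.
- exact: measurable_fun_fubini_tonelli_F.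
apply: eq_integral => w _ /=.
rewrite /fubini_F (ge0_integral_distribution Z')//.
by apply: measurableT_comp => //; exact: pair1_measurable.
Qed.

Lemma measurable_freezing Z (F : T1 * T2 -> \bar R) :
  measurable_fun setT Z -> measurable_fun setT F -> (forall z, (0 <= F z)%E) ->
  measurable_fun setT (fun y => \int[P]_w F (y, Z w))%E.
Proof.
move=> mZ mF F0.
pose Z' : {RV P >-> T2} := HB.pack Z (isMeasurableFun.Build _ _ _ _ _ mZ).
have := measurable_fun_fubini_tonelli_F (m2 := distribution P Z') F mF F0.
apply: eq_measurable_fun => y _; rewrite /fubini_F (ge0_integral_distribution Z')//.
by apply: measurableT_comp => //; exact: pair1_measurable.
Qed.

(** One variable at a time: with the event of [Y] fixed, the sets for [Z] reduce to generators, and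
    then so do the sets for [Y]. *)
Lemma independent_pair_pi Y Z (G1 : set (set T1)) (G2 : set (set T2)) :
  measurable_fun setT Y -> measurable_fun setT Z ->
  measurable = <<s G1 >> -> setI_closed G1 -> G1 setT ->
  measurable = <<s G2 >> -> setI_closed G2 -> G2 setT ->
  (forall A B, G1 A -> G2 B ->
    P (Y @^-1` A `&` Z @^-1` B) = (P (Y @^-1` A) * P (Z @^-1` B))%E) ->
  independent_pair Y Z.
Proof.
move=> mY mZ G1E G1I G1T G2E G2I G2T YZ A B mA mB.
have mYA : measurable (Y @^-1` A) by rewrite -[X in measurable X]setTI; exact: mY.
rewrite setIC muleC.
apply: (pi_system_independent mZ mYA G2E G2I G2T) => // {mB}B GB.
have mB : measurable B by rewrite G2E; exact: sub_sigma_algebra.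
have mZB : measurable (Z @^-1` B) by rewrite -[X in measurable X]setTI; exact: mZ.
rewrite setIC muleC.
by apply: (pi_system_independent mY mZB G1E G1I G1T) => // A' GA'; exact: YZ.
Qed.

End independence.

Section blocks.
Context {disp : measure_display} {Omega : measurableType disp} {R : realType}
  {P : probability Omega R} {d : nat} {n : nat}
  (X : nat -> {RV P >-> 'rV[R]_d}).
Local Notation T := 'rV[R]_d.

(* The coordinates outside of I are set to 0, so that blocks of different index
   sets take values in the same measurable space. *)
Definition block (I : {set 'I_n}) (w : Omega) : n.-tuple T :=
  [tuple if i \in I then X i w else 0 | i < n].

Lemma measurable_block I : measurable_fun setT (block I).
Proof.
apply/measurable_fun_tnthP => i.
rewrite (_ : _ \o _ = fun w => if i \in I then X i w else 0); last first.
  by apply/funext => w /=; rewrite tnth_mktuple.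
by case: (i \in I); [exact: measurable_funPT|exact: measurable_cst].
Qed.

Definition tuple_box (B : 'I_n -> set T) : set (n.-tuple T) :=
  [set t | forall i, B i (tnth t i)].

Definition tuple_boxes : set (set (n.-tuple T)) :=
  [set tuple_box B | B in [set B | forall i, measurable (B i)]].

Lemma tuple_boxes_generate : measurable = <<s tuple_boxes >>.
Proof.
apply/seteqP; split.
  apply: smallest_sub; first exact: smallest_sigma_algebra.
  rewrite -bigcup_seq => S [i _ [B mB <-]].
  apply: sub_sigma_algebra; exists (fun j => if j == i then B else setT) => /=.
    by move=> j; case: ifP.
  rewrite setTI; apply/seteqP; split => t /=.
    by move=> /(_ i); rewrite eqxx.
  by move=> Bt j; case: eqP => // ->.
apply: smallest_sub; first exact: sigma_algebra_measurable.
move=> _ [B mB <-].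
rewrite (_ : tuple_box B = \bigcap_(i in [set: 'I_n])
    ((fun t : n.-tuple T => tnth t i) @^-1` B i)); last first.
  by apply/seteqP; split=> x /= h i //; [move=> _; exact: h|exact: h].
apply: fin_bigcap_measurable => // i _.
rewrite -[X in measurable X]setTI; apply: measurable_tnth => //; exact: mB.
Qed.

Lemma tuple_boxes_setI : setI_closed tuple_boxes.
Proof.
move=> _ _ [B mB <-] [C mC <-]; exists (fun i => B i `&` C i) => /=.
  by move=> i; apply: measurableI; [exact: mB|exact: mC].
apply/seteqP; split => t /=; first by move=> h; split => i; have [] := h i.
by move=> [h1 h2] i; split.
Qed.

Lemma tuple_boxes_setT : tuple_boxes setT.
Proof.
by exists (fun=> setT) => //; apply/seteqP; split.
Qed.

Definition cylinder (I : {set 'I_n}) (B : 'I_n -> set T) : set Omega :=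
  [set w | forall i, i \in I -> B i (X i w)].

Hypothesis X_indep : mutually_independent X.

Lemma cylinder_prob I B : (forall i, measurable (B i)) ->
  P (cylinder I B) = (\prod_(i in I) P (X i @^-1` B i))%E.
Proof.
(* Mutual independence is stated for families indexed by all naturals; from [n] on the imposed
   condition is void. *)
move=> mB; pose B' (j : nat) := oapp B setT (insub j).
have B'E (i : 'I_n) : B' i = B i by rewrite /B' valK.
have mB' j : measurable (B' j).
  by rewrite /B'; case: insub => [i|] /=; [exact: mB|exact: measurableT].
pose J := [fset val i | i in I]%fset.
transitivity (P (\bigcap_(j in [set` J]) (X j @^-1` B' j))).
  congr (P _); apply/seteqP; split => w /=.
    move=> h j /= /imfsetP[i /= iI ->]; rewrite B'E; exact: h.
  move=> h i iI; have := h (val i); rewrite /= B'E; apply.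
  by apply/imfsetP; exists i.
rewrite X_indep// /J big_imfset/=; last by move=> i j _ _; exact: val_inj.
by rewrite big_enum; apply: eq_bigr => i _; rewrite B'E.
Qed.

(** Outside [I] the block is constantly 0, so there a box either imposes nothing or excludes
    everything, according to whether its sides contain 0. *)
Lemma preimage_block I B : block I @^-1` tuple_box B =
  if [forall i, (i \in I) || `[< B i 0 >]] then cylinder I B else set0.
Proof.
case: ifPn => [/forallP h|/forallPn/= [i /norP[iI /asboolPn Bi]]].
  apply/seteqP; split => w /= hw i.
    by move=> iI; have := hw i; rewrite tnth_mktuple iI.
  rewrite tnth_mktuple; case: ifPn => iI; first exact: hw.
  by have := h i; rewrite (negbTE iI) /= => /asboolP.
apply/seteqP; split => w //= /(_ i).
by rewrite tnth_mktuple (negbTE iI).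
Qed.

(** On boxes the preimages are cylinders or empty, and cylinders over disjoint index sets meet in a
    cylinder over the union, whose product formula splits. *)
Lemma block_independent (I J : {set 'I_n}) :
  [disjoint I & J]%B ->
  independent_pair P (block I) (block J).
Proof.
move=> IJ; apply: (independent_pair_pi (G1 := tuple_boxes) (G2 := tuple_boxes)).
- exact: measurable_block.
- exact: measurable_block.
- exact: tuple_boxes_generate.
- exact: tuple_boxes_setI.
- exact: tuple_boxes_setT.
- exact: tuple_boxes_generate.
- exact: tuple_boxes_setI.
- exact: tuple_boxes_setT.
move=> _ _ [B mB <-] [C mC <-]; rewrite !preimage_block.
case: ifPn => _; last by rewrite set0I measure0 mul0e.
case: ifPn => _; last by rewrite setI0 measure0 mule0.
rewrite (_ : cylinder I B `&` cylinder J C =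
  cylinder (I :|: J) (fun i => if i \in I then B i else C i)); last first.
  apply/seteqP; split => w /=.
    move=> [hB hC] i; rewrite inE; case: ifPn => iI; first by move=> _; exact: hB.
    by move=> /= iJ; exact: hC.
  move=> h; split => i iI; have := h i; rewrite inE iI ?orbT /=.
    by apply.
  by rewrite (disjointFl IJ iI); apply.
rewrite !cylinder_prob//; last by move=> i; case: ifP.
rewrite (eq_bigl (mem [predU I & J])); last by move=> i; rewrite !inE.
rewrite bigU//=; congr (_ * _)%E; apply: eq_bigr => i iI.
  by rewrite iI.
by rewrite (disjointFl IJ iI).
Qed.

End blocks.

(** * Connected components of the geometric graph *)

Section components.
Context {T : finType}.
Implicit Types (e : rel T) (I : {set T}).

Definition components e : {set {set T}} :=
  equivalence_partition (connect e) [set: T]%SET.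

Definition inner e I : rel T := fun i j => [&& i \in I, j \in I & e i j].

Definition clustered e I :=
  [forall i in I, [forall j in I, connect (inner e I) i j]].

Definition detached e I := [forall i in I, [forall j in ~: I, ~~ e i j]]%SET.

(** This splits the component event into a condition on the points of [I] alone and one that
    involves the others. Paths are confined to [I] by [inner] precisely so that the first condition
    is a function of the block of [I]. *)
Lemma componentsP e I : symmetric e -> I != finset.set0 ->
  (I \in components e) = clustered e I && detached e I.
Proof.
move=> se I0.
have si : symmetric (inner e I).
  by move=> i j; rewrite /inner se; case: (i \in I); case: (j \in I).
apply/imsetP/andP => [[x _ IE]|[cI iI]].
  have mI i : (i \in I) = connect e x i by rewrite IE !inE.
  have isoI i j : i \in I -> e i j -> j \in I.
    by rewrite !mI => xi ij; apply: connect_trans xi (connect1 ij).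
  have cx i : i \in I -> connect (inner e I) x i.
    rewrite mI => /connectP[p]; elim/last_ind: p i => [|p y IH] i.
      by move=> _ ->; exact: connect0.
    rewrite rcons_path last_rcons => /andP[pp ly] ->.
    apply: connect_trans (IH _ pp erefl) (connect1 _).
    have lI : last x p \in I by rewrite mI; apply/connectP; exists p.
    by rewrite /inner lI (isoI _ _ lI ly).
  split.
    apply/forall_inP => i iI; apply/forall_inP => j jI.
    apply: connect_trans (cx _ jI).
    by rewrite (sym_connect_sym si); exact: cx.
  apply/forall_inP => i iI; apply/forall_inP => j; rewrite inE => jI.
  by apply: contra jI => /(isoI _ _ iI).
have /set0Pn[x xI] := I0; exists x => //; apply/setP => y; rewrite !inE.
apply/idP/idP => [yI|].
  move/forall_inP: cI => /(_ x xI) /forall_inP /(_ y yI).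
  by apply: connect_sub => i j /and3P[_ _ ij]; exact: connect1.
move=> /connectP[p]; elim/last_ind: p y => [|p z IH] y; first by move=> _ ->.
rewrite rcons_path last_rcons => /andP[pp lz] ->.
have lI := IH _ pp erefl.
move/forall_inP: iI => /(_ _ lI) /forall_inP /(_ z).
by rewrite inE lz; case: (z \in I) => //= /(_ isT).
Qed.

End components.

(** * Coinciding points of the sample *)

Section quotient_components.
Context {T1 T2 : finType} (phi : T1 -> T2) (e1 : rel T1) (e2 : rel T2).
Hypothesis phi_surj : forall y, exists x, phi x = y.
Hypothesis phi_edge : forall x y, e1 x y = (phi x == phi y) || e2 (phi x) (phi y).

(** [e1] also joins elements with the same image, so a path in the source may switch representatives
    freely, and every path in the target lifts. *)
Lemma connect_quotient x y : connect e1 x y = connect e2 (phi x) (phi y).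
Proof.
apply/idP/idP.
  move=> /connectP[p]; elim/last_ind: p y => [|p z IH] y; first by move=> _ ->.
  rewrite rcons_path last_rcons => /andP[pp lz] ->.
  apply: connect_trans (IH _ pp erefl) _.
  by move: lz; rewrite phi_edge => /orP[/eqP ->//|]; exact: connect1.
move=> /connectP[p]; elim: p x => [|z p IH] x /=.
  by move=> _ yx; apply: connect1; rewrite phi_edge yx eqxx.
have [z' <-] := phi_surj z => /andP[xz pp] lp.
by apply: connect_trans (IH _ pp lp); apply: connect1; rewrite phi_edge xz orbT.
Qed.

Lemma card_components_quotient k :
  #|[set C in components e2 | #|C| == k]%SET| =
  #|[set C in components e1 | #|(phi @: C)%SET| == k]%SET|.
Proof.
have imE x : (phi @: [set y in [set: T1] | connect e1 x y])%SET =
    [set y in [set: T2] | connect e2 (phi x) y]%SET.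
  apply/setP => y; rewrite !inE; apply/imsetP/idP => [[z]|xy].
    by rewrite !inE /= connect_quotient => ? ->.
  by have [z zy] := phi_surj y; exists z; rewrite // !inE connect_quotient zy.
rewrite -[RHS](card_in_imset (f := fun C : {set T1} => (phi @: C)%SET)).
  apply: eq_card => C; rewrite !inE; apply/andP/imsetP.
    move=> [/imsetP[y _ ->] Ck]; have [x xy] := phi_surj y.
    exists [set z in [set: T1] | connect e1 x z]%SET; last by rewrite imE xy.
    by rewrite inE imE xy Ck andbT; apply/imsetP; exists x.
  move=> [D]; rewrite inE => /andP[/imsetP[x _ ->] Dk] ->.
  by split=> //; rewrite imE; apply/imsetP; exists (phi x).
move=> C D; rewrite !inE => /andP[/imsetP[x _ ->] _] /andP[/imsetP[y _ ->] _].
rewrite !imE => /setP h; apply/setP => z; rewrite !inE !connect_quotient.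
by have := h (phi z); rewrite !inE.
Qed.

End quotient_components.

(** Each value is counted at its least index. In this form the number of distinct points depends on
    finitely many equality tests, which later gives measurability. *)
Lemma card_imset_first n (T : finType) (phi : 'I_n -> T) (C : {set 'I_n}) :
  #|(phi @: C)%SET| =
  #|[set i in C | [forall j in C, (phi j == phi i) ==> (i <= j)%N]]%SET|.
Proof.
rewrite -[RHS](card_in_imset (f := phi)).
  apply: eq_card => y; apply/imsetP/imsetP => -[i iC ->]; last first.
    by move: iC; rewrite inE => /andP[iC _]; exists i.
  have P0 : (i \in C) && (phi i == phi i) by rewrite iC /=.
  case: (arg_minnP (P := fun j => (j \in C) && (phi j == phi i)) val P0) => j.
  move=> /andP[jC /eqP ji] jmin; exists j => //; rewrite inE jC /=.
  apply/forall_inP => l lC; apply/implyP => lj; apply: jmin.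
  by rewrite lC -ji.
move=> i j; rewrite !inE => /andP[iC /forall_inP hi] /andP[jC /forall_inP hj] ij.
apply/val_inj/eqP; rewrite eqn_leq.
by have := hi j jC; have := hj i iC; rewrite ij eqxx /= => -> ->.
Qed.

Section sample_components.
Context {R : realType} {d n : nat}.
Implicit Types (z : n.-tuple 'rV[R]_d) (r : R).

Definition closer r z : rel 'I_n := fun i j => enorm (tnth z i - tnth z j) <= r.

Lemma closer_sym r z : symmetric (closer r z).
Proof. by move=> i j; rewrite /closer enormB. Qed.

Definition first_in z (C : {set 'I_n}) : {set 'I_n} :=
  [set i in C | [forall j in C, (tnth z j == tnth z i) ==> (i <= j)%N]]%SET.

Lemma num_components_tuple k r z : 0 <= r ->
  num_components k r [fset tnth z i | i : 'I_n]%fset =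
  #|[set C in components (closer r z) | #|first_in z C| == k]%SET|.
Proof.
move=> r0; set Z := [fset _ | _ : _]%fset.
have zZ i : tnth z i \in Z by apply/imfsetP; exists i.
pose phi i : Z := [` zZ i]%fset.
rewrite /num_components (@card_components_quotient _ _ phi (closer r z)).
- apply: eq_card => C; rewrite !inE card_imset_first; congr (_ && (_ == _)).
- by move=> [y yZ]; have /imfsetP[i /= _ yi] := yZ; exists i; exact: val_inj.
- move=> i j; rewrite /closer /geometric_graph /=.
  by case: eqVneq => // ij; move: (congr1 val ij) => /= ->; rewrite subrr enorm0 r0.
Qed.

(** Coincidences of points are thereby events of the same kind as edges. *)
Lemma closer0 z i j : closer 0 z i j = (tnth z i == tnth z j).
Proof.
rewrite /closer; apply/idP/eqP => [h|->]; last by rewrite subrr enorm0.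
apply/eqP; rewrite -subr_eq0 -normr_le0; exact: le_trans (norm_le_enorm _) h.
Qed.

Lemma num_components_inj k r z : (0 < k)%N -> 0 <= r -> injective (tnth z) ->
  num_components k r [fset tnth z i | i : 'I_n]%fset =
  (\sum_(I : {set 'I_n} | #|I| == k)
    (clustered (closer r z) I && detached (closer r z) I))%N.
Proof.
move=> k0 r0 zI; rewrite num_components_tuple// -sum1dep_card big_mkcond/=.
rewrite [RHS]big_mkcond/=; apply: eq_bigr => I _.
have -> : first_in z I = I.
  apply/setP => i; rewrite inE; case: (boolP (i \in I)) => //= iI.
  by apply/forall_inP => j jI; apply/implyP => /eqP/zI ->.
case: eqP => [Ik|]; rewrite ?andbF ?andbT//.
rewrite componentsP; last 2 first.
- exact: closer_sym.
- by rewrite -card_gt0 Ik.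
by case: (_ && _).
Qed.

End sample_components.

(** The vector of bits takes finitely many values, so the set is a finite union of finite
    intersections of measurable sets. Any combinatorial functional of the graph is measurable in
    this way. *)
Lemma measurable_finite_dependence {disp : measure_display}
    {T : measurableType disp} (F : finType) (b : F -> T -> bool) (U : Type)
    (phi : {ffun F -> bool} -> U) (S : set U) :
  (forall a, measurable [set t | b a t]) ->
  measurable [set t | S (phi [ffun a => b a t])].
Proof.
move=> mb.
rewrite (_ : [set t | _] = \bigcup_(m in [set m : {ffun F -> bool} | S (phi m)])
    \bigcap_(a in [set: F]) [set t | b a t = m a]); last first.
  apply/seteqP; split => t /=.
    by move=> h; exists [ffun a => b a t] => // a _ /=; rewrite ffunE.
  move=> [m /= Sm h]; suff <- : m = [ffun a => b a t] by [].
  by apply/ffunP => a; rewrite ffunE; exact/esym/h.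
apply: fin_bigcup_measurable => // m _.
apply: fin_bigcap_measurable => // a _.
case: (m a); first exact: mb.
rewrite (_ : [set t | _] = ~` [set t | b a t]); first exact: measurableC.
by apply/seteqP; split => t /=; case: (b a t).
Qed.

Section measurable_tuples.
Context {R : realType} {d n : nat}.
Local Notation T := (n.-tuple 'rV[R]_d).

Lemma measurable_closer (r : R) i j : measurable [set z : T | closer r z i j].
Proof.
have h : measurable_fun [set: T] (fun z : T => enorm (tnth z i - tnth z j)).
  apply: (measurableT_comp measurable_fun_enorm).
  apply: measurable_fun_rV => l; under eq_fun do rewrite !mxE.
  apply: measurable_funB; apply: (measurableT_comp (measurable_coor l));
    exact: measurable_tnth.
have := h measurableT `]-oo, r]%classic (measurable_itv _).
by rewrite setTI; congr measurable; apply/seteqP; split => y /=; rewrite in_itv.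
Qed.

Lemma measurable_closer_event (r : R) (Phi : rel 'I_n -> bool) :
  measurable [set z : T | Phi (closer r z)].
Proof.
have := @measurable_finite_dependence _ T _
  (fun (p : 'I_n * 'I_n) z => closer r z p.1 p.2) _
  (fun m => Phi (fun i j => m (i, j))) [set b | b = true]
  (fun p => measurable_closer r p.1 p.2).
congr measurable; apply/funext => z /=.
have -> // : (fun i j : 'I_n => [ffun p : 'I_n * 'I_n => closer r z p.1 p.2] (i, j)) = closer r z.
by apply/funext => i; apply/funext => j; rewrite ffunE.
Qed.

Lemma measurable_num_components k (r : R) : 0 <= r ->
  measurable_fun [set: T] (fun z : T =>
    (num_components k r [fset tnth z i | i : 'I_n]%fset)%:R : R).
Proof.
move=> r0 _ Y mY; rewrite setTI.
(* The flag [true] records edges at radius [r], the flag [false] coincidences, which are edges at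
   radius 0. *)
pose phi (m : {ffun bool * ('I_n * 'I_n) -> bool}) : R :=
  #|[set C in components (fun i j => m (true, (i, j))) |
    #|[set i in C | [forall j in C, m (false, (j, i)) ==> (i <= j)%N]]| == k]%SET|%:R.
have := @measurable_finite_dependence _ T _
  (fun (p : bool * ('I_n * 'I_n)) z =>
     closer (if p.1 then r else 0) z p.2.1 p.2.2) _ phi Y
  (fun p => measurable_closer _ p.2.1 p.2.2).
congr measurable; apply/funext => z /=; congr (Y _).
rewrite num_components_tuple// /phi; congr (_%:R).
have -> : closer r z = fun i j : 'I_n => [ffun p : bool * ('I_n * 'I_n) =>
    closer (if p.1 then r else 0) z p.2.1 p.2.2] (true, (i, j)).
  by apply/funext => i; apply/funext => j; rewrite ffunE.
apply: eq_card => C; rewrite !inE; congr (_ && (_ == _)).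
apply: eq_card => i; rewrite !inE; congr (_ && _).
by apply: eq_forallb => j; rewrite ffunE /= closer0.
Qed.

End measurable_tuples.

(** * Mass of balls *)

Section density.
Context {R : realType} {d : nat}.

(** A point outside the support has a null open neighbourhood, hence lies in a null rational ball,
    and there are only countably many of these. *)
Lemma support_negligible (nu : probability 'rV[R]_d R) :
  nu.-negligible (~` support_of nu).
Proof.
pose F (n : nat) : set 'rV[R]_d :=
  if (choice.unpickle n : option ('rV[rat]_d * nat)) is Some p then
    if nu (rat_ball p) == 0%E then rat_ball p else set0
  else set0.
apply: (@negligibleS _ _ _ _ (\bigcup_n F n)); last first.
  apply: negligible_bigcup => n; rewrite /F.
  case: choice.unpickle => [p|]; last exact: negligible_set0.
  case: eqP => [p0|_]; last exact: negligible_set0.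
  by apply/negligibleP => //; exact: measurable_rat_ball.
move=> x /= /existsNP[U /not_implyP[oU /not_implyP[Ux /negP]]].
rewrite -leNgt => U0; have [G [D UE]] := open_rat_balls oU.
move: Ux; rewrite UE => -[n Dn Gx].
exists (choice.pickle (G n)) => //; rewrite /F choice.pickleK.
case: eqP => // -[]; apply/eqP; rewrite eq_le measure_ge0 andbT.
apply: le_trans U0; apply: le_measure; rewrite ?inE.
- exact: measurable_rat_ball.
- exact: open_rV_measurable.
- by rewrite UE => y Gy; exists n.
Qed.

Context (A : set 'rV[R]_d) (nu : probability 'rV[R]_d R) (f : 'rV[R]_d -> R).
Hypotheses (A_compact : compact A) (nu_density : has_density nu f)
  (nu_support : support_of nu = A) (f_continuous : {within A, continuous f})
  (f_inf_gt0 : 0 < inf (f @` A)).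

Lemma measurable_compact_rV : measurable A.
Proof.
by apply: closed_rV_measurable; apply: compact_closed => //; exact: norm_hausdorff.
Qed.

Lemma density_setIA B : measurable B -> nu B = nu (B `&` A).
Proof.
move=> mB; have mA := measurable_compact_rV.
rewrite -[in LHS](setUIDK B A) measureU; first last.
- by apply/seteqP; split => x //= [[_ ?] []].
- exact: measurableD.
- exact: measurableI.
rewrite [X in (_ + X)%E](_ : _ = 0%E) ?adde0//.
apply: (subset_measure0 (B := ~` A)) => //.
- exact: measurableD.
- exact: measurableC.
have /negligibleP := support_negligible nu; rewrite nu_support; apply.
exact: measurableC.
Qed.

(** Compactness bounds [f] on [A] only; the part of a ball outside [A] carries no mass by
    [density_setIA]. *)
Lemma density_upper : exists2 M : R, 0 < M &
  forall x s, 0 <= s -> (nu (eball x s) <= (M * s ^+ d)%:E)%E.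
Proof.
have [fm f0 nuE] := nu_density; have mA := measurable_compact_rV.
have : bounded_set (f @` A).
  by apply: compact_bounded; apply: continuous_compact.
move=> /pinfty_ex_gt0[M M0 fM].
exists (M * 2 ^+ d) => [|x s s0]; first by rewrite mulr_gt0// exprn_gt0.
have mB := measurable_eball x s.
rewrite density_setIA// nuE; last exact: measurableI.
apply: (@le_trans _ _ (\int[lebesgue_rV d]_(x in eball x s `&` A) (cst M%:E) x)%E).
  apply: ge0_le_integral.
  - exact: measurableI.
  - by move=> y _; rewrite lee_fin.
  - by apply/measurable_EFinP; exact: measurable_funTS.
  - exact: measurable_cst.
  - move=> y [_ Ay]; rewrite lee_fin; apply: le_trans (ler_norm _) _.
    by apply: fM; exists y.
rewrite integral_cst; last exact: measurableI.
rewrite -mulrA -exprMn EFinM lee_pmul2l// ?lte_fin//.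
apply: le_trans (lebesgue_rV_ball_le x s0).
apply: le_measure; rewrite ?inE//; first exact: measurableI.
Qed.

Lemma density_lower x s : (0 < d)%N -> 0 <= s -> eball x s `<=` A ->
  ((inf (f @` A) * (2 * (s / d%:R)) ^+ d)%:E <= nu (eball x s))%E.
Proof.
move=> d0 s0 sA; have [fm f0 nuE] := nu_density.
have mB := measurable_eball x s; rewrite nuE//.
apply: (@le_trans _ _ (\int[lebesgue_rV d]_(x in eball x s) (cst (inf (f @` A))%:E) x)%E).
  rewrite integral_cst// EFinM lee_pmul2l// ?lte_fin//.
  exact: lebesgue_rV_ball_ge.
apply: ge0_le_integral => //.
- by move=> y _; rewrite lee_fin ltW.
- by apply/measurable_EFinP; exact: measurable_funTS.
- move=> y sy; rewrite lee_fin; apply: ge_inf; last by exists y => //; exact: sA.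
  by exists 0 => _ [z _ <-].
Qed.

End density.

(** * The cone condition *)

Section lipschitz.
Context {R : realType}.

Lemma norm_convex_le (V : normedModType R) (p q p0 : V) (s t : R) :
  `|p - p0| <= s -> `|q - p0| <= s -> 0 <= t <= 1 ->
  `|q + t *: (p - q) - p0| <= s.
Proof.
move=> ps qs /andP[t0 t1].
have -> : q + t *: (p - q) - p0 = (1 - t) *: (q - p0) + t *: (p - p0).
  rewrite addrAC (_ : p - q = (p - p0) - (q - p0)); last by rewrite opprB addrA subrK.
  by rewrite scalerBl scale1r scalerBr -[RHS]addrA [in RHS](addrC (- _)).
apply: le_trans (ler_normD _ _) _; rewrite !normrZ ger0_norm ?subr_ge0//.
rewrite ger0_norm//.
have -> : s = (1 - t) * s + t * s by ring.
by apply: lerD; apply: ler_wpM2l; rewrite ?subr_ge0.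
Qed.

Lemma derive_along_line m (phi : 'rV[R]_m -> R) (q v : 'rV[R]_m) (t : R) :
  differentiable phi (q + t *: v) ->
  is_derive t 1 (fun u : R => phi (q + u *: v)) ('D_v phi (q + t *: v)).
Proof.
move=> dphi.
have E : (fun h => h^-1 *: (((fun u : R => phi (q + u *: v)) \o shift t) (h *: (1 : R)) -
      phi (q + t *: v))) =
    (fun h => h^-1 *: ((phi \o shift (q + t *: v)) (h *: v) - phi (q + t *: v))).
  apply/funext => h /=; congr (_ *: (phi _ - _)).
  by rewrite scaler1 scalerDl addrCA.
apply: DeriveDef; last by rewrite /derive E.
by rewrite /derivable E; exact: diff_derivable.
Qed.

(** Lipschitz partial derivatives are bounded near [p0]. The differential is a combination of them,
    and the mean value theorem on the segment from [q] to [p] turns the sum of their bounds into a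
    Lipschitz constant. *)
Lemma C11_lipschitz m (D : set 'rV[R]_m) (phi : 'rV[R]_m -> R) (p0 : 'rV[R]_m) :
  C11_function D phi -> D p0 ->
  exists s L : R, [/\ 0 < s, 0 <= L,
    forall p, `|p - p0| <= s -> D p &
    forall p q, `|p - p0| <= s -> `|q - p0| <= s ->
      `|phi p - phi q| <= L * `|p - q|].
Proof.
move=> [oD dphi lphi] Dp0.
have /nbhs_ballP[e /= e0 eD] := open_nbhs_nbhs (conj oD Dp0).
have Ds p : `|p - p0| <= e / 2 -> D p.
  move=> pe; apply: eD; rewrite mx_norm_ball /ball_ /= distrC.
  by apply: le_lt_trans pe _; rewrite ltr_pdivrMr// ltr_pMr// ltr1n.
pose pd j p := 'D_(delta_mx ord0 j) phi p.
have pdB j : exists B, 0 <= B /\ forall p, `|p - p0| <= e / 2 -> `|pd j p| <= B.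
  (* [lipschitz_on] offers every constant above some [M0] of unknown sign; [|M0| + 1] is a positive
     one. *)
  have := lphi j; rewrite /lipschitz_on => -[M0 [_ /(_ (`|M0| + 1)) hM]].
  have M1 : M0 < `|M0| + 1 by rewrite ltr_pwDr// ler_norm.
  exists (`|pd j p0| + (`|M0| + 1) * (e / 2)); split.
    by rewrite addr_ge0// mulr_ge0 ?addr_ge0// ltW// divr_gt0.
  move=> p ps; rewrite -(subrK (pd j p0) (pd j p)) addrC.
  apply: le_trans (ler_normD _ _) _; rewrite lerD2l.
  have := hM M1 (p, p0) (conj (Ds _ ps) Dp0) => /= /le_trans; apply.
  by rewrite ler_wpM2l// addr_ge0.
have [B hB] := choice pdB.
have B0 j : 0 <= B j by have [] := hB j.
exists (e / 2), (\sum_j B j); split => //; rewrite ?divr_gt0//; first exact: sumr_ge0.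
have key (a v : 'rV[R]_m) : `|a - p0| <= e / 2 -> differentiable phi a ->
    `|'D_v phi a| <= (\sum_j B j) * `|v|.
  move=> cs dc; rewrite deriveE// {1}[v]row_sum_delta linear_sum /= mulr_suml.
  apply: le_trans (ler_norm_sum _ _ _) _; apply: ler_sum => j _.
  rewrite linearZ /= normrM mulrC; apply: ler_pM => //.
    by have [_ /(_ _ cs)] := hB j; rewrite /pd deriveE.
  exact: coord_le_norm.
move=> p q ps qs; pose g u := phi (q + u *: (p - q)).
have dg (t : R) : 0 <= t <= 1 -> is_derive t 1 g ('D_(p - q) phi (q + t *: (p - q))).
  by move=> t01; apply: derive_along_line; apply: dphi; apply: Ds; exact: norm_convex_le.
have [c c01 gE] : exists2 c, c \in `[0, 1]%R & g 1 - g 0 =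
    'D_(p - q) phi (q + c *: (p - q)) * (1 - 0).
  apply: (@MVT_segment _ g (fun t => 'D_(p - q) phi (q + t *: (p - q)))) => //.
    by move=> t; rewrite in_itv /= => /andP[t0 t1]; apply: dg; rewrite !ltW.
  apply: derivable_within_continuous => t; rewrite in_itv /= => t01.
  by have [] := dg _ t01.
have -> : phi p - phi q = g 1 - g 0.
  by rewrite /g scale1r scale0r addr0 (addrC q) subrK.
rewrite gE subr0 mulr1.
move: c01; rewrite in_itv /= => c01; have cs := norm_convex_le ps qs c01.
have dc : differentiable phi (q + c *: (p - q)) by apply: dphi; exact: Ds.
exact: key.
Qed.

End lipschitz.

(** Off the boundary, lying in [A] and lying in its interior are the same, so the part of the
    segment inside [A] is both open and closed in it; the segment is connected. *)
Lemma segment_off_boundary {R : realType} (V : normedModType R) (A : set V) (p q : V) :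
  closed A -> (forall t : R, 0 <= t <= 1 -> ~ boundary A (p + t *: (q - p))) ->
  A p -> A q.
Proof.
move=> cA nb Ap; pose g (t : R) := p + t *: (q - p).
have cg : continuous g.
  move=> t; apply: cvgD; first exact: cvg_cst.
  exact: scalel_continuous.
have c01 : connected `[0 : R, 1]%classic by exact: segment_connected.
have E : `[0 : R, 1]%classic `&` g @^-1` A = `[0 : R, 1]%classic.
  apply: c01.
  - exists 0; split; first by rewrite /= in_itv /= lexx ler01.
    by rewrite /g /= scale0r addr0.
  - exists (g @^-1` A^°).
      by apply: open_comp; [move=> t _; exact: cg|exact: open_interior].
    apply/seteqP; split => t /= [t01 At]; split => //; last exact: interior_subset At.
    apply: contrapT => nAt; move: t01; rewrite in_itv /= => /nb; apply.
    by split => //; exact: subset_closure.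
  - exists (g @^-1` A) => //; apply: closed_comp => // t _; exact: cg.
have : `[0 : R, 1]%classic 1 by rewrite /= in_itv /= lexx ler01.
by rewrite -E => -[_]; rewrite /g /= scale1r addrC subrK.
Qed.

Lemma segment_off_boundary_iff {R : realType} (V : normedModType R) (A : set V) (p q : V) :
  closed A -> (forall t : R, 0 <= t <= 1 -> ~ boundary A (p + t *: (q - p))) ->
  A p <-> A q.
Proof.
move=> cA nb; split; first exact: segment_off_boundary.
apply: segment_off_boundary => // t /andP[t0 t1].
have -> : q + t *: (p - q) = p + (1 - t) *: (q - p).
  rewrite scalerBl scale1r [RHS]addrA [p + (q - p)]addrC subrK -(opprB q p).
  by rewrite scalerN.
by apply: nb; rewrite subr_ge0 t1 lerBlDr lerDl.
Qed.

Section front_last.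
Context {R : realType} {m : nat}.
Implicit Types z y : 'rV[R]_m.+1.

Definition rV_last z : R := z ord0 ord_max.
Definition rV_up : 'rV[R]_m.+1 := delta_mx ord0 ord_max.
Definition rV_rcons (q : 'rV[R]_m) (a : R) : 'rV[R]_m.+1 :=
  \row_i oapp (q ord0) a (insub (val i) : option 'I_m).

Let wid (j : 'I_m) : 'I_m.+1 := widen_ord (leq_pred m.+1) j.

Let frontE z j : rV_front z ord0 j = z ord0 (wid j).
Proof. by rewrite mxE. Qed.

Lemma rV_frontD z y : rV_front (z + y) = rV_front z + rV_front y.
Proof. by apply/rowP => j; rewrite !mxE. Qed.

Lemma rV_frontZ a z : rV_front (a *: z) = a *: rV_front z.
Proof. by apply/rowP => j; rewrite !mxE. Qed.

Lemma rV_frontB z y : rV_front (z - y) = rV_front z - rV_front y.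
Proof. by apply/rowP => j; rewrite !mxE. Qed.

Lemma rV_front_up : rV_front rV_up = 0.
Proof.
apply/rowP => j; rewrite !mxE eqxx /=.
by rewrite (_ : _ == _ = false)//; apply/negbTE; rewrite neq_ltn /= ltn_ord.
Qed.

Lemma rV_last_up : rV_last rV_up = 1.
Proof. by rewrite /rV_last mxE !eqxx. Qed.

Lemma rV_lastD z y : rV_last (z + y) = rV_last z + rV_last y.
Proof. by rewrite /rV_last mxE. Qed.

Lemma rV_lastZ a z : rV_last (a *: z) = a * rV_last z.
Proof. by rewrite /rV_last mxE. Qed.

Lemma rV_lastB z y : rV_last (z - y) = rV_last z - rV_last y.
Proof. by rewrite /rV_last !mxE. Qed.

Lemma rV_front_rcons q a : rV_front (rV_rcons q a) = q.
Proof. by apply/rowP => j; rewrite !mxE /= valK. Qed.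

Lemma rV_last_rcons q a : rV_last (rV_rcons q a) = a.
Proof. by rewrite /rV_last mxE insubF//= ltnn. Qed.

Lemma norm_front z : `|rV_front z| <= `|z|.
Proof.
by apply: (iffRL (mx_norm_le _ _)) => // i; rewrite frontE coord_le_norm.
Qed.

Lemma norm_last z : `|rV_last z| <= `|z|.
Proof. exact: coord_le_norm. Qed.

Lemma norm_le_front_last z (a : R) :
  `|rV_front z| <= a -> `|rV_last z| <= a -> `|z| <= a.
Proof.
move=> fa la; have a0 : 0 <= a by exact: le_trans fa.
apply: (iffRL (mx_norm_le _ _)) => // i.
have [im|im] := ltnP i m.
  have -> : i = wid (Ordinal im) by exact: val_inj.
  by rewrite -frontE; apply: le_trans (coord_le_norm _ _) fa.
have -> // : i = ord_max.
by apply/val_inj/eqP; rewrite eqn_leq im -ltnS ltn_ord.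
Qed.

End front_last.

Section one_sided.
Context {R : realType} {m : nat} (B : set 'rV[R]_m.+1) (phi : 'rV[R]_m -> R)
  (x : 'rV[R]_m.+1) (s L : R).
Local Notation height z := (rV_last z - phi (rV_front z)).
Hypotheses (s_gt0 : 0 < s) (L_ge0 : 0 <= L) (x_graph : height x = 0)
  (phi_lip : forall p q, `|p - rV_front x| <= s -> `|q - rV_front x| <= s ->
     `|phi p - phi q| <= L * `|p - q|)
  (B_segment : forall p q : 'rV[R]_m.+1,
     (forall t : R, 0 <= t <= 1 -> let z := p + t *: (q - p) in
        `|z - x| <= s /\ height z != 0) ->
     B p <-> B q).

(** A slope larger than [L]: over a base of radius [rho] the graph moves by at most [L * rho], less
    than the half-height [2 * k * rho = s] of the box [W], and so misses its top and bottom
    faces. *)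
Let k := L + 1.
Let rho := s / (2 * k).
Let W z := `|rV_front z - rV_front x| <= rho /\ `|rV_last z - rV_last x| <= 2 * k * rho.
Let top (a : R) := x + (a * (2 * k * rho)) *: rV_up.

Let k_ge1 : 1 <= k. Proof. by rewrite /k lerDr. Qed.
Let k_gt0 : 0 < k. Proof. exact: lt_le_trans k_ge1. Qed.
Let rho_gt0 : 0 < rho. Proof. by rewrite /rho divr_gt0// mulr_gt0. Qed.
Let rhoE : 2 * k * rho = s.
Proof. by rewrite /rho; field; rewrite gt_eqF. Qed.
Let rho_le : rho <= s.
Proof. by rewrite -rhoE ler_peMl ?(ltW rho_gt0)//; move: k_ge1; lra. Qed.

(** The sign [a] names a side of the graph. A path from [z] to the centre of the face on that side
    avoids the graph: first vertically, where [a * height] interpolates between positive values,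
    then within the face. *)
Let one_side (a : R) z : a * a = 1 -> W z -> 0 < a * height z -> B z <-> B (top a).
Proof.
move=> aa [Wf Wl] az.
have a1 : `|a| = 1.
  by apply/eqP; rewrite -(eqrXn2 (n := 2))// ?expr1n ?real_normK ?num_real// expr2 aa.
have Lr : L * rho < s.
  rewrite -rhoE ltr_pM2r//; rewrite /k; move: L_ge0; lra.
have top_pos p : `|p - rV_front x| <= rho -> 0 < a * (rV_last x + a * s - phi p).
  move=> pr; have ps := le_trans pr rho_le.
  have := phi_lip ps (_ : `|rV_front x - rV_front x| <= s).
  rewrite subrr normr0 => /(_ (ltW s_gt0)) h.
  have h1 : `|a * (phi p - phi (rV_front x))| < s.
    rewrite normrM a1 mul1r; apply: le_lt_trans h (le_lt_trans _ Lr).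
    exact: ler_wpM2l.
  move: x_graph => /eqP; rewrite subr_eq0 => /eqP ->.
  have -> : a * (phi (rV_front x) + a * s - phi p) =
    (a * a) * s - a * (phi p - phi (rV_front x)) by ring.
  rewrite aa mul1r subr_gt0; exact: le_lt_trans (ler_norm _) h1.
pose z1 := rV_rcons (rV_front z) (rV_last x + a * s).
transitivity (B z1); apply: B_segment => t t01 /=; set y := (_ + t *: _).
  have yf : rV_front y = rV_front z.
    by rewrite rV_frontD rV_frontZ rV_frontB rV_front_rcons subrr scaler0 addr0.
  have yl : rV_last y = rV_last z + t * (rV_last x + a * s - rV_last z).
    by rewrite rV_lastD rV_lastZ rV_lastB rV_last_rcons.
  split.
    apply: norm_le_front_last; first by rewrite rV_frontB yf; exact: le_trans rho_le.
    rewrite rV_lastB yl; have := @norm_convex_le _ R^o (rV_last x + a * s) (rV_last z) (rV_last x) s t.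
    apply => //; last by rewrite -rhoE.
    by rewrite addrAC subrr add0r normrM a1 mul1r ger0_norm// ltW.
  apply: contraTneq az => yh; rewrite -leNgt.
  have := top_pos _ Wf; move: yh; rewrite yf yl => yh tp.
  have {}yh : (1 - t) * (a * (rV_last z - phi (rV_front z))) +
      t * (a * (rV_last x + a * s - phi (rV_front z))) = 0.
    by rewrite -[RHS](mulr0 a) -yh; ring.
  case/andP: t01 => t0 t1.
  have [t1'|t1'] := ltP t 1; last first.
    have t1E : t = 1 by apply/eqP; rewrite eq_le t1.
    move: yh tp; rewrite t1E subrr mul0r add0r mul1r => ->; by rewrite ltxx.
  have tn : 0 <= t * (a * (rV_last x + a * s - phi (rV_front z))).
    by rewrite mulr_ge0// ltW.
  by rewrite -(pmulr_rle0 (x := 1 - t)) ?subr_gt0//; move: yh tn; lra.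
have topf : rV_front (top a) = rV_front x.
  by rewrite rV_frontD rV_frontZ rV_front_up scaler0 addr0.
have topl : rV_last (top a) = rV_last x + a * s.
  by rewrite rV_lastD rV_lastZ rV_last_up mulr1 rhoE.
have yf : rV_front y = rV_front z + t *: (rV_front x - rV_front z).
  by rewrite rV_frontD rV_frontZ rV_frontB topf rV_front_rcons.
have yl : rV_last y = rV_last x + a * s.
  by rewrite rV_lastD rV_lastZ rV_lastB topl rV_last_rcons subrr mulr0 addr0.
have yr : `|rV_front y - rV_front x| <= rho.
  rewrite yf; apply: norm_convex_le => //.
  by rewrite subrr normr0 ltW.
split.
  apply: norm_le_front_last; first by rewrite rV_frontB; exact: le_trans rho_le.
  by rewrite rV_lastB yl addrAC subrr add0r normrM a1 mul1r ger0_norm// ltW.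
have := top_pos _ yr; rewrite -yl; apply: contraTneq => ->.
by rewrite mulr0 ltxx.
Qed.

(* The graph cuts a box around x into two pieces, on each of which membership in
   B is constant: both, neither or exactly one of them lies in B. *)
Lemma one_sided_cases :
  [\/ forall z, `|z - x| <= rho -> height z != 0 -> B z,
      forall z, `|z - x| <= rho -> B z -> height z = 0 |
      exists2 a : R, a * a = 1 & forall y z (t : R), B y ->
        `|y - x| <= rho / 3 -> 0 < t <= rho / 3 ->
        `|z - (y + (t * a) *: rV_up)| <= t / (2 * k) -> B z].
Proof.
have WB z : `|z - x| <= rho -> W z.
  move=> zr; split; first by rewrite -rV_frontB; exact: le_trans (norm_front _) _.
  rewrite -rV_lastB; apply: le_trans (norm_last _) (le_trans zr _).
  by rewrite rhoE.
have sgn z : height z != 0 -> exists2 a, a * a = 1 & 0 < a * height z.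
  rewrite neq_lt => /orP[h|h]; [exists (-1)|exists 1]; rewrite ?mulrNN ?mulr1//.
    by rewrite mulN1r oppr_gt0.
  by rewrite mul1r.
have aP (a : R) : a * a = 1 -> a = 1 \/ a = -1.
  move=> aa; have : (a - 1) * (a + 1) = 0.
    by rewrite mulrDr mulrBl mulr1 mul1r aa; ring.
  move/eqP; rewrite mulf_eq0 subr_eq0 addr_eq0 => /orP[] /eqP; by [left|right].
(* [y] lies on the side [a] or on the graph. The shift raises its signed height by [t], and the
   deviation [t / (2 * k)] lowers it by at most [(1 + L) * t / (2 * k) = t / 2]. Also
   [rho / 3 + t + t / 2 <= rho], so [z] is still in the box. *)
have main a : a * a = 1 -> B (top a) -> ~ B (top (- a)) ->
    forall y z (t : R), B y ->
        `|y - x| <= rho / 3 -> 0 < t <= rho / 3 ->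
        `|z - (y + (t * a) *: rV_up)| <= t / (2 * k) -> B z.
  move=> aa Ba nBa y z t By yx /andP[t0 t1] zy.
  have a1 : `|a| = 1.
    by apply/eqP; rewrite -(eqrXn2 (n := 2))// ?expr1n ?real_normK ?num_real// expr2 aa.
  have naa : - a * - a = 1 by rewrite mulrNN.
  have yr : `|y - x| <= rho by apply: le_trans yx _; move: rho_gt0; lra.
  have yup : 0 <= a * height y.
    rewrite leNgt; apply/negP => yn; apply: nBa.
    by apply/(one_side naa (WB _ yr)) => //; rewrite mulNr oppr_gt0.
  have tk : t / (2 * k) <= t / 2.
    rewrite ler_pM2l// lef_pV2 ?posrE//; move: k_ge1; lra.
  have up1 : `|rV_up : 'rV[R]_m.+1| <= 1.
    by apply: norm_le_front_last; rewrite ?rV_front_up ?rV_last_up ?normr0 ?normr1.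
  have zr : `|z - x| <= rho.
    have -> : z - x = (z - (y + (t * a) *: rV_up)) + ((y - x) + (t * a) *: rV_up).
      by rewrite [y - x + _]addrAC addrA subrK.
    apply: le_trans (ler_normD _ _) _.
    have h2 : `|y - x + (t * a) *: rV_up| <= rho / 3 + t.
      apply: le_trans (ler_normD _ _) _; apply: lerD => //.
      by rewrite normrZ normrM a1 mulr1 ger0_norm ?(ltW t0)// ler_piMr ?(ltW t0).
    by move: zy h2 tk t1 rho_gt0; lra.
  apply/(one_side aa (WB _ zr)) => //.
  set u := z - (y + (t * a) *: rV_up) in zy.
  have uf : rV_front z - rV_front y = rV_front u.
    by rewrite /u rV_frontB rV_frontD rV_frontZ rV_front_up scaler0 addr0.
  have ul : rV_last z = rV_last y + t * a + rV_last u.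
    by rewrite /u rV_lastB rV_lastD rV_lastZ rV_last_up mulr1; ring.
  have zfs : `|rV_front z - rV_front x| <= s.
    by have [h _] := WB _ zr; exact: le_trans h rho_le.
  have yfs : `|rV_front y - rV_front x| <= s.
    by have [h _] := WB _ yr; exact: le_trans h rho_le.
  have h1 : `|a * (rV_last u - (phi (rV_front z) - phi (rV_front y)))| <= t / 2.
    rewrite normrM a1 mul1r; apply: le_trans (ler_normB _ _) _.
    have := phi_lip zfs yfs; rewrite uf => hp.
    have hu : L * `|rV_front u| <= L * (t / (2 * k)).
      by apply: ler_wpM2l => //; exact: le_trans (norm_front _) zy.
    have hl := le_trans (norm_last u) zy.
    have -> : t / 2 = t / (2 * k) + L * (t / (2 * k)).
      by rewrite /k; field; move: k_gt0; rewrite /k; lra.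
    by apply: lerD => //; exact: le_trans hp hu.
  have -> : a * height z = a * height y + (a * a) * t +
     a * (rV_last u - (phi (rV_front z) - phi (rV_front y))) by rewrite ul; ring.
  rewrite aa mul1r; move: h1; rewrite ler_norml => /andP[h1 _].
  by move: yup t0 h1; lra.
have [B1|nB1] := pselect (B (top 1)); have [Bn1|nBn1] := pselect (B (top (-1))).
- apply: Or31 => z zr /sgn[a aa az]; apply/(one_side aa (WB _ zr) az).
  by case: (aP _ aa) => ->.
- apply: Or33; exists 1; first by rewrite mulr1.
  by apply: main => //; rewrite mulr1.
- apply: Or33; exists (-1); first by rewrite mulrNN mulr1.
  by apply: main; rewrite ?mulrNN ?mulr1 ?opprK.
- apply: Or32 => z zr Bz; apply/eqP; apply: contrapT => /negP /sgn[a aa az].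
  have := (one_side aa (WB _ zr) az).1 Bz.
  by case: (aP _ aa) => ->.
Qed.

End one_sided.

Section orthogonal.
Context {R : realType} {d : nat}.
Implicit Types (Q : 'M[R]_d) (z : 'rV[R]_d).

Lemma enorm_orthogonal Q z : Q *m Q^T = 1%:M -> enorm (z *m Q) = enorm z.
Proof.
have dE (u : 'rV[R]_d) : dotv u u = (u *m u^T) ord0 ord0.
  by rewrite mxE; apply: eq_bigr => i _; rewrite mxE.
by move=> QQ; rewrite !enormE !dE trmx_mul -mulmxA (mulmxA Q) QQ mul1mx.
Qed.

Lemma norm_orthogonal Q z : Q *m Q^T = 1%:M -> `|z *m Q| <= d%:R * `|z|.
Proof.
move=> QQ; apply: le_trans (norm_le_enorm _) _.
by rewrite enorm_orthogonal// enorm_le_norm.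
Qed.

Lemma orthogonal_trmx Q : Q *m Q^T = 1%:M -> Q^T *m (Q^T)^T = 1%:M.
Proof. by move=> QQ; rewrite trmxK; exact: mulmx1C. Qed.

End orthogonal.

Lemma measure_bigcup_fin_le {disp : measure_display} {T : measurableType disp}
    {R : realType} (mu : {measure set T -> \bar R}) (I : finType) (F : I -> set T) :
  (forall i, measurable (F i)) ->
  (mu (\bigcup_i F i) <= \sum_i mu (F i))%E.
Proof.
move=> mF; rewrite (_ : \bigcup_i F i = \big[setU/set0]_i F i); last first.
  apply/seteqP; split => x.
    by move=> [i _ Fi]; rewrite (bigD1 i)//=; left.
  by elim/big_ind : _ => // [A B hA hB [/hA|/hB]//|i _ Fi]; exists i.
suff [] : measurable (\big[setU/set0]_i F i) /\
    (mu (\big[setU/set0]_i F i) <= \sum_i mu (F i))%E by [].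
elim/big_rec2 : _ => [|i s A _ [mA As]]; first by rewrite measure0.
split; first exact: measurableU.
by apply: le_trans (measureU2 _ (mF i) mA) _; rewrite leeD2l.
Qed.

Section local_cone.
Context {R : realType} {d : nat}.

(** One direction [e] serves all points of [A] near [x]: the extremal choice in [separated_gap]
    needs a direction fixed beforehand. The same [eps] bounds neighbourhood, length and aperture, so
    that only one quantity has to be made uniform. *)
Definition cone_at (A : set 'rV[R]_d) x (eps : R) := exists2 e, enorm e = 1 &
  forall y z t, A y -> enorm (y - x) <= eps -> 0 <= t <= eps ->
    enorm (z - (y + t *: e)) <= eps * t -> A z.

Lemma cone_at_shrink A x x' eps eps' : cone_at A x eps -> eps' <= eps / 2 ->
  enorm (x' - x) <= eps / 2 -> 0 <= eps' -> cone_at A x' eps'.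
Proof.
move=> [e e1 h] ee xx ep; exists e => // y z t Ay yx /andP[t0 te] zy.
apply: (h y z t) => //.
- by apply: le_trans (enorm_triangle x' _ _) _; rewrite (splitr eps) lerD// (le_trans yx).
- by rewrite t0; lra.
- by apply: le_trans zy _; rewrite ler_wpM2r//; lra.
Qed.

(** By [cone_at_shrink] the property holds for all [x'] near [x] and all small [eps'] at once; the
    near-covering form of compactness then makes the bound on [eps'] independent of the point. *)
Lemma uniform_cone (A : set 'rV[R]_d) : compact A ->
  (forall x, A x -> exists2 eps, 0 < eps & cone_at A x eps) ->
  exists2 eps, 0 < eps & forall x, A x -> cone_at A x eps.
Proof.
move=> /compact_near_coveringP cA hA.
have := cA R (0^'+) (fun eps x => cone_at A x eps) _ _.
case=> //.
  move=> x /hA[eps e0 hx].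
  have dp : 0 < eps / 2 / d.+1%:R by rewrite !divr_gt0.
  near=> x' eps' => /=.
  apply: (cone_at_shrink hx).
  - near: eps'; apply: nbhs_right_le; exact: divr_gt0.
  - apply: le_trans (enorm_le_norm _) _.
    have h : `|x' - x| <= eps / 2 / d.+1%:R.
      near: x'; apply/nbhs_ballP; exists (eps / 2 / d.+1%:R) => //= y.
      by rewrite mx_norm_ball /ball_ /= distrC => /ltW.
    apply: (@le_trans _ _ (d.+1%:R * `|x' - x|)).
      by rewrite ler_wpM2r// ler_nat.
    by rewrite mulrC -ler_pdivlMr.
  - by near: eps'; exact: nbhs_right_ge.
move=> r /= r0 h; exists (r / 2); first exact: divr_gt0.
move=> x Ax; apply: (h (r / 2)) => //=; last by rewrite divr_gt0.
by rewrite sub0r normrN gtr0_norm ?divr_gt0// ltr_pdivrMr// ltr_pMr// ltr1n.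
Unshelve. all: by end_near.
Qed.

End local_cone.

Section graph_cover.
Context {R : realType} {m : nat} (phi : 'rV[R]_m -> R) (x0 : 'rV[R]_m)
  (rho s L : R) (Q : 'M[R]_m.+1).
Hypotheses (rho_gt0 : 0 < rho) (rho_le : rho <= s) (L_ge0 : 0 <= L)
  (QQ : Q *m Q^T = 1%:M)
  (phi_lip : forall p q, `|p - x0| <= s -> `|q - x0| <= s ->
     `|phi p - phi q| <= L * `|p - q|).

Definition grid (N : nat) (c : {ffun 'I_m -> 'I_N.+1}) : 'rV[R]_m :=
  \row_j (x0 ord0 j - rho + 2 * rho * (c j)%:R / N%:R).

Definition graph_center N (c : {ffun 'I_m -> 'I_N.+1}) : 'rV[R]_m.+1 :=
  rV_rcons (grid c) (phi (grid c)) *m Q^T.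

(** Rounding the base coordinates down to the grid moves the base point by at most [2 * rho / N] and
    the height by at most [L] times this; [m.+1] passes from the sup norm to the Euclidean one. *)
Lemma graph_cover N (w : 'rV[R]_m.+1) : (0 < N)%N ->
  `|rV_front (w *m Q) - x0| <= rho ->
  rV_last (w *m Q) = phi (rV_front (w *m Q)) ->
  exists c : {ffun 'I_m -> 'I_N.+1},
    enorm (w - graph_center c) <= m.+1%:R * (2 * rho * (L + 1)) / N%:R.
Proof.
move=> N0 wf wl; have N0' : 0 < N%:R :> R by rewrite ltr0n.
have [q qdef] : exists q, rV_front (w *m Q) = q by exists (rV_front (w *m Q)).
rewrite qdef in wf wl.
have hq j : - rho <= q ord0 j - x0 ord0 j <= rho.
  by rewrite -ler_norml; have := coord_le_norm (q - x0) j; rewrite !mxE => /le_trans; apply.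
pose a j := (q ord0 j - x0 ord0 j + rho) * N%:R / (2 * rho).
have a0 j : 0 <= a j.
  rewrite /a !mulr_ge0// ?invr_ge0 ?mulr_ge0// ?(ltW rho_gt0)//.
  by have /andP[h _] := hq j; lra.
have aN j : a j <= N%:R.
  rewrite /a ler_pdivrMr ?mulr_gt0// mulrC ler_wpM2l// ?ler0n//.
  by have /andP[_ h] := hq j; lra.
have cN j : (Num.truncn (a j) < N.+1)%N.
  by rewrite ltnS; apply: (leq_trans (le_truncn (aN j))); rewrite natrK.
pose c := [ffun j => Ordinal (cN j)].
exists c.
have gq : `|grid c - q| <= 2 * rho / N%:R.
  apply: (iffRL (mx_norm_le _ _)); first by rewrite !mulr_ge0// ?invr_ge0// ltW.
  move=> j; rewrite !mxE ffunE /=.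
  have qE : q ord0 j = x0 ord0 j - rho + 2 * rho / N%:R * a j.
    by rewrite /a; field; rewrite !gt_eqF// mulr_gt0.
  rewrite qE.
  have -> : x0 ord0 j - rho + 2 * rho * (Num.truncn (a j))%:R / N%:R -
     (x0 ord0 j - rho + 2 * rho / N%:R * a j) =
     - (2 * rho / N%:R * (a j - (Num.truncn (a j))%:R)) by ring.
  have rN : 0 <= 2 * rho / N%:R by rewrite !mulr_ge0// ?invr_ge0// ltW.
  have /andP[t1 t2] := truncn_itv (a0 j).
  rewrite normrN normrM ger0_norm// ler_piMr// ger0_norm ?subr_ge0//.
  by move: t2; rewrite -natr1; lra.
have gx : `|grid c - x0| <= rho.
  apply: (iffRL (mx_norm_le _ _)); first exact: ltW.
  move=> j; rewrite !mxE ffunE /=.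
  have -> : x0 ord0 j - rho + 2 * rho * (Num.truncn (a j))%:R / N%:R - x0 ord0 j =
     2 * rho * ((Num.truncn (a j))%:R / N%:R) - rho by ring.
  have h0 : 0 <= (Num.truncn (a j))%:R / N%:R :> R by rewrite divr_ge0.
  have h1 : (Num.truncn (a j))%:R / N%:R <= 1 :> R.
    by rewrite ler_pdivrMr// mul1r ler_nat -ltnS.
  by rewrite ler_norml; apply/andP; split; move: rho_gt0; nra.
have -> : w - graph_center c = (w *m Q - rV_rcons (grid c) (phi (grid c))) *m Q^T.
  by rewrite mulmxBl -mulmxA QQ mulmx1.
rewrite enorm_orthogonal; last exact: orthogonal_trmx.
apply: le_trans (enorm_le_norm _) _; rewrite -mulrA ler_wpM2l//.
have hb : 2 * rho / N%:R <= 2 * rho * (L + 1) / N%:R.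
  rewrite ler_wpM2r ?invr_ge0// ler_peMr ?mulr_ge0 ?(ltW rho_gt0)//.
  by rewrite lerDr.
apply: norm_le_front_last.
  by rewrite rV_frontB rV_front_rcons qdef distrC; exact: le_trans gq hb.
rewrite rV_lastB rV_last_rcons wl.
apply: le_trans (phi_lip _ _) _; [exact: le_trans rho_le|exact: le_trans rho_le|].
rewrite distrC.
apply: le_trans (ler_wpM2l L_ge0 gq) _.
have -> : 2 * rho * (L + 1) / N%:R = L * (2 * rho / N%:R) + 2 * rho / N%:R by ring.
by rewrite lerDl !mulr_ge0// ?invr_ge0// ltW.
Qed.

End graph_cover.

(* The graph is covered by O(N^m) balls of radius O(1/N), each of mass
   O(N^(-m-1)). *)
Lemma graph_null {R : realType} {m : nat} (nu : probability 'rV[R]_m.+1 R) (M : R)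
    (phi : 'rV[R]_m -> R) (x0 : 'rV[R]_m) (rho s L : R) (Q : 'M[R]_m.+1)
    (O : set 'rV[R]_m.+1) :
  0 <= M -> (forall x t, 0 <= t -> (nu (eball x t) <= (M * t ^+ m.+1)%:E)%E) ->
  0 < rho -> rho <= s -> 0 <= L -> Q *m Q^T = 1%:M ->
  (forall p q, `|p - x0| <= s -> `|q - x0| <= s ->
     `|phi p - phi q| <= L * `|p - q|) ->
  measurable O ->
  (forall w, O w -> `|rV_front (w *m Q) - x0| <= rho /\
     rV_last (w *m Q) = phi (rV_front (w *m Q))) ->
  nu O = 0%E.
Proof.
move=> M0 nuM rho0 rhos L0 QQ phil mO OG.
pose C := m.+1%:R * (2 * rho * (L + 1)).
have C0 : 0 <= C by rewrite /C !mulr_ge0 ?addr_ge0// ltW.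
pose K := 2 ^+ m * (M * C ^+ m.+1).
have K0 : 0 <= K by rewrite /K !mulr_ge0 ?exprn_ge0.
have nuN N : (0 < N)%N -> (nu O <= (K / N%:R)%:E)%E.
  move=> N0; have N0' : 0 < N%:R :> R by rewrite ltr0n.
  apply: (@le_trans _ _ (nu (\bigcup_c eball (@graph_center _ _ phi x0 rho Q N c) (C / N%:R)))).
    apply: le_measure; rewrite ?inE//.
      apply: fin_bigcup_measurable => // c _; exact: measurable_eball.
    move=> w /OG[w1 w2].
    have [c cP] := graph_cover rho0 rhos L0 QQ phil N0 w1 w2.
    by exists c.
  apply: le_trans (measure_bigcup_fin_le _ _) _.
    by move=> c; exact: measurable_eball.
  apply: (@le_trans _ _ (\sum_(c : {ffun 'I_m -> 'I_N.+1}) (M * (C / N%:R) ^+ m.+1)%:E)%E).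
    by apply: lee_sum => c _; apply: nuM; rewrite divr_ge0.
  rewrite sumEFin lee_fin sumr_const card_ffun !card_ord -[leLHS]mulr_natl natrX.
  have -> : K / N%:R = (2 * N%:R) ^+ m * (M * (C / N%:R) ^+ m.+1).
    have aux (b c n q : R) : n != 0 -> q != 0 ->
        b * (M * c) / n = b * q * (M * (c / (n * q))).
      by move=> n0 q0; field; rewrite n0 q0.
    by rewrite /K (exprMn m 2 N%:R) expr_div_n (exprS N%:R) -aux// ?expf_neq0// gt_eqF.
  apply: ler_wpM2r; first by rewrite mulr_ge0// exprn_ge0// divr_ge0.
  rewrite lerXn2r ?nnegrE ?mulr_ge0// -natrM ler_nat.
  by rewrite mul2n -addnn -addn1 leq_add2l.
apply/eqP; rewrite eq_le measure_ge0 andbT.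
apply/lee_addgt0Pr => e e0; rewrite add0e.
apply: le_trans (nuN (Num.truncn (K / e)).+1 _) _ => //.
by rewrite lee_fin ler_pdivrMr// mulrC -ler_pdivrMr// ltW// truncnS_gt.
Qed.

Section graph_cone.
Context {R : realType} {m : nat} (A : set 'rV[R]_m.+1)
  (nu : probability 'rV[R]_m.+1 R) (M : R).
Hypotheses (A_closed : closed A) (nu_support : support_of nu = A)
  (nuA : forall B, measurable B -> nu B = nu (B `&` A))
  (M_ge0 : 0 <= M)
  (nuM : forall x t, 0 <= t -> (nu (eball x t) <= (M * t ^+ m.+1)%:E)%E).

(** In rotated coordinates [one_sided_cases] applies to [A]. With both sides in [A] the point would
    be interior; with neither, a neighbourhood of it would be null, against the support condition.
    In the remaining case the vertical direction, rotated back, is the axis of the cone. *)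
Lemma graph_cone x : C11_boundary A -> boundary A x ->
  exists2 eps, 0 < eps & cone_at A x eps.
Proof.
move=> hA /[dup] bx /hA[U [D [phi [Q [Ux C11 [QQ _] UD]]]]].
have QtQ : Q^T *m Q = 1%:M by exact: mulmx1C.
have rotK (z : 'rV[R]_m.+1) : z *m Q^T *m Q = z by rewrite -mulmxA QtQ mulmx1.
have rotK' (z : 'rV[R]_m.+1) : z *m Q *m Q^T = z by rewrite -mulmxA QQ mulmx1.
have rotB (u v : 'rV[R]_m.+1) : (u *m Q) - (v *m Q) = (u - v) *m Q by rewrite mulmxBl.
have graphP z : boundary A z -> U z -> D (rV_front (z *m Q)) /\
    rV_last (z *m Q) = phi (rV_front (z *m Q)).
  move=> bz Uz; have : [set z *m Q | z in boundary A `&` U] (z *m Q) by exists z.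
  by rewrite UD => -[Dz /(_ ord_max erefl)].
have Ux0 := nbhs_singleton Ux.
have [Dx0 hx] := graphP _ bx Ux0.
have [s0 [L [s00 L0 _ lip0]]] := C11_lipschitz C11 Dx0.
have [e1 /= e10 e1U] := (nbhs_ballP _ _).1 Ux.
set x' := x *m Q in Dx0 hx lip0.
(* The second bound keeps the box, rotated back, inside [U]: a rotation may enlarge the sup norm by
   a factor [m.+1]. *)
pose s := Num.min s0 (e1 / 2 / m.+1%:R).
have s_gt0 : 0 < s by rewrite lt_min s00 !divr_gt0.
have lip p q : `|p - rV_front x'| <= s -> `|q - rV_front x'| <= s ->
    `|phi p - phi q| <= L * `|p - q|.
  by move=> ps qs; apply: lip0; [apply: le_trans ps _|apply: le_trans qs _];
    rewrite ge_min lexx.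
have sU z : `|z - x'| <= s -> U (z *m Q^T).
  move=> zs; apply: e1U; rewrite mx_norm_ball /ball_ /= -(rotK' x) -mulmxBl.
  apply: le_lt_trans (norm_orthogonal _ (orthogonal_trmx QQ)) _.
  rewrite distrC; apply: le_lt_trans (_ : m.+1%:R * (e1 / 2 / m.+1%:R) < _).
    by rewrite ler_wpM2l//; apply: le_trans zs _; rewrite ge_min lexx orbT.
  by rewrite mulrC divfK// ltr_pdivrMr// ltr_pMr// ltr1n.
pose B := [set z | A (z *m Q^T)].
have Bseg p q : (forall t : R, 0 <= t <= 1 -> let z := p + t *: (q - p) in
    `|z - x'| <= s /\ rV_last z - phi (rV_front z) != 0) -> B p <-> B q.
  move=> h; apply: (@segment_off_boundary_iff _ _ A (p *m Q^T) (q *m Q^T)) => // t t01.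
  rewrite -mulmxBl scalemxAl -mulmxDl => bz; have [zs zh] := h _ t01.
  have := graphP _ bz (sU _ zs); rewrite rotK => -[_ zE].
  by move: zh; rewrite zE subrr eqxx.
have x'h : rV_last x' - phi (rV_front x') = 0 by rewrite hx subrr.
have Ax : A x by move: bx => [clx _]; rewrite (closure_id A).1.
have k0 : 0 < 2 * (L + 1) by rewrite mulr_gt0// ltr_wpDl.
set rho := s / (2 * (L + 1)).
have rho0 : 0 < rho by rewrite divr_gt0.
have rhos : rho <= s.
  by rewrite ler_pdivrMr// ler_peMr ?(ltW s_gt0)//; lra.
pose e3 := rho / m.+1%:R.
have e30 : 0 < e3 by rewrite divr_gt0.
have e3P w : ball x e3 w -> `|w *m Q - x'| < rho.
  rewrite mx_norm_ball /ball_ /= distrC => we.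
  rewrite rotB; apply: le_lt_trans (norm_orthogonal _ QQ) _.
  by rewrite mulrC -ltr_pdivlMr.
have [Ball|Bnull|[a aa Bcone]] := one_sided_cases s_gt0 L0 x'h lip Bseg.
- exfalso; move: bx => [_]; apply; apply/nbhs_ballP; exists e3 => //= w we.
  have wr := e3P _ we.
  have [wh|wh] := eqVneq (rV_last (w *m Q) - phi (rV_front (w *m Q))) 0; last first.
    by have := Ball _ (ltW wr) wh; rewrite /B /= rotK'.
  (* Points [w] on the graph itself belong to [A] by closedness: a small upward shift leaves the
     graph, so it lands in [A], and it stays within [rho] of [x'] and in [V]. *)
  rewrite (closure_id A).1// => V /nbhs_ballP[e4 /= e40 e4V].
  pose t := Num.min (rho - `|w *m Q - x'|) (e4 / 2 / m.+1%:R).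
  have t0 : 0 < t by rewrite lt_min subr_gt0 wr !divr_gt0.
  have up1 : `|rV_up : 'rV[R]_m.+1| <= 1.
    by apply: norm_le_front_last; rewrite ?rV_front_up ?rV_last_up ?normr0 ?normr1.
  have tup : `|t *: rV_up : 'rV[R]_m.+1| <= t.
    by rewrite normrZ gtr0_norm// ler_piMr// ltW.
  exists ((w *m Q + t *: rV_up) *m Q^T); split.
    apply: Ball.
      rewrite addrAC; apply: le_trans (ler_normD _ _) _.
      by rewrite -lerBrDl; apply: le_trans tup _; rewrite ge_min lexx.
    rewrite rV_lastD rV_frontD rV_lastZ rV_frontZ rV_last_up rV_front_up scaler0 addr0.
    by rewrite addrAC wh add0r mulr1 gt_eqF.
  apply: e4V; rewrite mx_norm_ball /ball_ /= mulmxDl rotK' opprD addrA subrr add0r normrN.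
  apply: le_lt_trans (norm_orthogonal _ (orthogonal_trmx QQ)) _.
  apply: le_lt_trans (_ : m.+1%:R * (e4 / 2 / m.+1%:R) < _).
    by rewrite ler_wpM2l//; apply: le_trans tup _; rewrite ge_min lexx orbT.
  by rewrite mulrC divfK// ltr_pdivrMr// ltr_pMr// ltr1n.
- have oO : open (ball x e3) by exact: ball_open.
  have mO := open_rV_measurable oO.
  have : (0 < nu (ball x e3))%E.
    by move: Ax; rewrite -nu_support; apply => //; exact: ballxx.
  rewrite nuA// (graph_null (M := M) (phi := phi) (x0 := rV_front x') (rho := rho)
     (s := s) (L := L) (Q := Q)) ?ltxx//.
    by apply: measurableI => //; exact: closed_rV_measurable.
  move=> w [/e3P/ltW wr Aw]; split.
    by rewrite -rV_frontB; exact: le_trans (norm_front _) wr.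
  by apply/eqP; rewrite -subr_eq0; apply/eqP/Bnull => //; rewrite /B /= rotK'.
have a1 : `|a| = 1.
  by apply/eqP; rewrite -(eqrXn2 (n := 2))// ?expr1n ?real_normK ?num_real// expr2 aa.
pose eps := Num.min (rho / 3) (1 / (2 * (L + 1))).
have eps0 : 0 < eps by rewrite lt_min !divr_gt0.
have eps_rho : eps <= rho / 3 by rewrite ge_min lexx.
have eps_k : eps <= 1 / (2 * (L + 1)) by rewrite ge_min lexx orbT.
exists eps => //; exists (a *: (rV_up *m Q^T)).
  rewrite enormZ a1 mul1r enorm_orthogonal; last exact: orthogonal_trmx.
  rewrite enormE /dotv (bigD1 ord_max)//= big1 ?addr0.
    by rewrite mxE !eqxx mulr1 sqrtr1.
  by move=> i /negbTE im; rewrite mxE im andbF mul0r.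
move=> y z t Ay yx /andP[t0 te] zy.
(* [one_sided_cases] treats positive [t]; for [t = 0] the cone is just its apex. *)
move: t0; rewrite le_eqVlt => /orP[/eqP t0|t0].
  move: zy; rewrite -t0 mulr0 scale0r addr0 => zy.
  have -> // : z = y.
  apply/eqP; rewrite -subr_eq0 -normr_le0; exact: le_trans (norm_le_enorm _) zy.
have := Bcone (y *m Q) (z *m Q) t; rewrite /B /= !rotK'; apply => //.
- rewrite rotB; apply: le_trans (norm_le_enorm _) _; rewrite enorm_orthogonal//.
  exact: le_trans yx eps_rho.
- by rewrite t0 (le_trans te).
have -> : z *m Q - (y *m Q + (t * a) *: rV_up) = (z - (y + t *: (a *: (rV_up *m Q^T)))) *m Q.
  by rewrite mulmxBl mulmxDl -!scalemxAl rotK scalerA.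
apply: le_trans (norm_le_enorm _) _; rewrite enorm_orthogonal//.
apply: le_trans zy _; rewrite mulrC ler_wpM2l ?(ltW t0)//.
by rewrite -div1r.
Qed.

End graph_cone.

(** Any unit direction works: the distance from [z] to [x] is at most
    [eps + t + eps * t <= 3 * eps], below [rho]. *)
Lemma interior_cone {R : realType} {d : nat} (A : set 'rV[R]_d) x : (0 < d)%N ->
  A^° x -> exists2 eps, 0 < eps & cone_at A x eps.
Proof.
move=> d0 /nbhs_ballP[rho /= rho0 rhoA].
have i0 : 'I_d by case: d d0 {A x rhoA} => // d _; exact: ord0.
pose eps := Num.min 1 (rho / 4).
have eps0 : 0 < eps by rewrite lt_min ltr01 divr_gt0.
have eps1 : eps <= 1 by rewrite ge_min lexx.
have epsr : eps <= rho / 4 by rewrite ge_min lexx orbT.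
exists eps => //; exists (delta_mx ord0 i0).
  rewrite enormE /dotv (bigD1 i0)//= big1 ?addr0.
    by rewrite mxE !eqxx mulr1 sqrtr1.
  by move=> i /negbTE im; rewrite mxE im andbF mul0r.
set e := delta_mx _ _ => y z t Ay yx /andP[t0 te] zy; apply: rhoA.
have e1 : enorm e = 1.
  rewrite enormE /dotv (bigD1 i0)//= big1 ?addr0.
    by rewrite mxE !eqxx mulr1 sqrtr1.
  by move=> i /negbTE im; rewrite mxE im andbF mul0r.
rewrite mx_norm_ball /ball_ /= distrC; apply: le_lt_trans (norm_le_enorm _) _.
apply: le_lt_trans (enorm_triangle (y + t *: e) _ _) _.
have h1 : enorm (y + t *: e - x) <= eps + t.
  rewrite addrAC; apply: le_trans (enormD _ _) _; apply: lerD => //.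
  by rewrite enormZ e1 mulr1 ger0_norm.
have h2 : eps * t <= eps by rewrite ler_piMr ?(ltW eps0)// (le_trans te).
lra.
Qed.

(** Positive length yields a second point [p] of [A], and the axis points towards it. The bound
    [1 / 2] keeps [z] from falling behind [y], and a quarter of the distance to [p] keeps it from
    passing [p]. *)
Lemma interval_cone {R : realType} (A : set 'rV[R]_1) x :
  (0 < lebesgue_rV 1 A)%E -> measurable A ->
  is_interval [set x ord0 ord0 | x in A] -> A x ->
  exists2 eps, 0 < eps & cone_at A x eps.
Proof.
move=> A0 mA iA Ax.
have [p Ap px] : exists2 p, A p & p ord0 ord0 != x ord0 ord0.
  apply: contrapT => h; move: A0; rewrite ltNge => /negP; apply.
  apply/lee_addgt0Pr => e e0; rewrite add0e.
  have e20 : 0 <= e / 2 by rewrite ltW// divr_gt0.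
  have := lebesgue_rV_ball_le x e20; rewrite expr1 (mulrC 2) divfK// => hb.
  apply: le_trans hb; apply: le_measure; rewrite ?inE//; first exact: measurable_eball.
  move=> y Ay /=; have -> : y = x; last by rewrite /eball/= subrr enorm0.
  apply/rowP => i; rewrite (ord1 i); apply/eqP/negPn/negP => yx.
  by apply: h; exists y.
pose D := `|p ord0 ord0 - x ord0 ord0|.
have D0 : 0 < D by rewrite normr_gt0 subr_eq0.
pose eps := Num.min (D / 4) (1 / 2).
have eps0 : 0 < eps by rewrite lt_min !divr_gt0.
have epsD : eps <= D / 4 by rewrite ge_min lexx.
have eps2 : eps <= 1 / 2 by rewrite ge_min lexx orbT.
pose e : 'rV[R]_1 := const_mx (Num.sg (p ord0 ord0 - x ord0 ord0)).
exists eps => //; exists e.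
  rewrite enormE /dotv big_ord1 mxE -expr2 sqr_sg subr_eq0 px /=.
  by rewrite sqrtr1.
move=> y z t Ay yx /andP[t0 te] zy.
have := le_trans (coord_le_enorm _ ord0) yx.
have := le_trans (coord_le_enorm _ ord0) zy.
rewrite !mxE !ler_norml => /andP[z1 z2] /andP[y1 y2].
have et : eps * t <= t / 2 by rewrite mulrC ler_wpM2l// -div1r.
have inA a b : A a -> A b -> a ord0 ord0 <= z ord0 ord0 <= b ord0 ord0 -> A z.
  move=> Aa Ab azb.
  have [w Aw wz] : [set x ord0 ord0 | x in A] (z ord0 ord0).
    by apply: (iA (a ord0 ord0) (b ord0 ord0)) => //; [exists a|exists b].
  have <- // : w = z by apply/rowP => i; rewrite (ord1 i).
move: z1 z2; have [h|h|h] := ltrgtP (p ord0 ord0) (x ord0 ord0).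
- have DE : D = x ord0 ord0 - p ord0 ord0 by rewrite /D distrC gtr0_norm ?subr_gt0.
  rewrite ltr0_sg ?subr_lt0// mulrN1 => z1 z2.
  by apply: (inA p y) => //; apply/andP; split; lra.
- have DE : D = p ord0 ord0 - x ord0 ord0 by rewrite /D gtr0_norm ?subr_gt0.
  rewrite gtr0_sg ?subr_gt0// mulr1 => z1 z2.
  by apply: (inA y p) => //; apply/andP; split; lra.
- by move: px; rewrite h eqxx.
Qed.

Lemma cone_condition {R : realType} {d : nat} (A : set 'rV[R]_d)
    (nu : probability 'rV[R]_d R) (M : R) :
  (0 < d)%N -> compact A -> (0 < lebesgue_rV d A)%E ->
  ((2 <= d)%N -> C11_boundary A) ->
  (d = 1%N -> forall i : 'I_d, is_interval [set x ord0 i | x in A]) ->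
  support_of nu = A ->
  (forall B, measurable B -> nu B = nu (B `&` A)) ->
  0 <= M -> (forall x t, 0 <= t -> (nu (eball x t) <= (M * t ^+ d)%:E)%E) ->
  exists2 eps, 0 < eps & forall x, A x -> cone_at A x eps.
Proof.
move=> d0 cA A0 AC AI nuA nuI M0 nuM; apply: uniform_cone => // x Ax.
have clA : closed A by apply: compact_closed => //; exact: norm_hausdorff.
have [iA|niA] := pselect (A^° x); first exact: interior_cone.
case: d d0 A nu cA A0 AC AI nuA nuI nuM x Ax clA niA => // -[|m] _ A nu cA A0 AC AI nuA nuI nuM x Ax clA niA.
  apply: interval_cone => //; first exact: closed_rV_measurable.
  exact: AI.
apply: (graph_cone clA nuA nuI M0 nuM (AC _)) => //.
by split => //; exact: subset_closure.
Qed.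

(** * Mass of unions of balls *)

Section neighbourhoods.
Context {R : realType} {d n : nat}.
Local Notation T := 'rV[R]_d.
Implicit Types (z y : n.-tuple T) (I J K : {set 'I_n}) (r : R).

Definition ball_union r I z : set T :=
  [set t | exists2 i, i \in I & enorm (t - tnth z i) <= r].

Lemma ball_unionE r I z :
  ball_union r I z = \bigcup_(i in [set` I]) eball (tnth z i) r.
Proof. by apply/seteqP; split => t [i iI ti]; exists i. Qed.

Lemma measurable_ball_union r I z : measurable (ball_union r I z).
Proof.
rewrite ball_unionE; apply: fin_bigcup_measurable => // i _.
exact: measurable_eball.
Qed.

Lemma ball_unionU r I J z :
  ball_union r (I :|: J)%SET z = ball_union r I z `|` ball_union r J z.
Proof.
apply/seteqP; split => t /=.
  by move=> [i]; rewrite inE => /orP[iI|iJ] ti; [left|right]; exists i.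
by move=> [[i iI ti]|[i iJ ti]]; exists i => //; rewrite inE ?iI ?iJ ?orbT.
Qed.

Lemma eq_ball_union r I z y : {in I, tnth z =1 tnth y} ->
  ball_union r I z = ball_union r I y.
Proof.
by move=> zy; apply/seteqP; split => t [i iI ti]; exists i; rewrite // ?zy// -zy.
Qed.

(** A path without repetitions inside [I] has at most [#|I|] edges, each of length at most [r]. *)
Lemma cluster_diameter r I z i j : 0 <= r -> clustered (closer r z) I ->
  i \in I -> j \in I -> enorm (tnth z i - tnth z j) <= #|I|%:R * r.
Proof.
move=> r0 /forall_inP cI iI /[dup] jI; move/forall_inP: (cI i iI) => /[apply].
move=> /connectP[p0 pp0 jl]; case/shortenP: pp0 jl => p pp up _ jE.
have sz : (size p <= #|I|)%N.
  apply: (@leq_trans #|i :: p|); first by rewrite (card_uniqP up).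
  apply: subset_leq_card; apply/fintype.subsetP => x; rewrite inE => /orP[/eqP->//|].
  elim: p i {iI up jE} pp => //= a p IH i /andP[/and3P[iI aI _] pa].
  by rewrite inE => /orP[/eqP->//|]; exact: IH pa.
apply: (@le_trans _ _ ((size p)%:R * r)); last by rewrite ler_wpM2r// ler_nat.
rewrite jE => {sz up jE iI}; elim: p i pp => [|a p IH] i /=.
  by rewrite subrr enorm0 mul0r.
move=> /andP[/and3P[_ _ ia] pa].
apply: le_trans (enorm_triangle (tnth z a) _ _) _.
by rewrite -natr1 mulrDl mul1r addrC lerD//; exact: IH.
Qed.

(** There are two tuples because the blocks of [I] and [K] enter as separate independent variables.
    The inequality is strict, being the negation of an edge. *)
Definition apart r I K z y :=
  [forall i in I, [forall j in K, r < enorm (tnth z i - tnth y j)]].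

Lemma apartP r I K z y :
  reflect (forall i j, i \in I -> j \in K -> r < enorm (tnth z i - tnth y j))
          (apart r I K z y).
Proof.
apply: (iffP idP) => [/forall_inP h i j iI|h].
  by move/forall_inP: (h i iI); apply.
by apply/forall_inP => i iI; apply/forall_inP => j jK; exact: h.
Qed.

Lemma apart_ball_union r I K z y : apart r I K z y <->
  forall j, j \in K -> (~` ball_union r I z) (tnth y j).
Proof.
split.
  move=> /apartP h j jK [i iI ij]; have := h i j iI jK.
  by rewrite enormB ltNge ij.
move=> h; apply/apartP => i j iI jK; rewrite ltNge; apply/negP => ij.
by apply: (h j jK); exists i; rewrite // enormB.
Qed.

Lemma ball_union_disjoint r I J z : apart (2 * r) I J z z ->
  ball_union r I z `&` ball_union r J z = set0.
Proof.
move=> /apartP h; apply/seteqP; split => // t [[i iI ti] [j jJ tj]].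
have := h i j iI jJ; rewrite ltNge => /negP; apply.
by apply: le_trans (enorm_triangle t _ _) _; rewrite mulr_natl enormB lerD.
Qed.

(* Among all the points, one maximizing the scalar product with the inward
   direction e sees, at distance r/2 in the direction e, a small ball at
   distance more than r from every point at distance more than r from it. *)
Lemma separated_gap (A : set T) (x : T) (eps r : R) I J z (l0 : 'I_n) :
  cone_at A x eps -> 0 < eps -> eps <= 1 / 5 -> 0 < r -> r <= eps ->
  l0 \in (I :|: J)%SET ->
  (forall l, l \in (I :|: J)%SET -> A (tnth z l) /\ enorm (tnth z l - x) <= eps) ->
  apart r I J z z ->
  exists c, eball c (eps * (r / 2)) `<=` A /\
    (eball c (eps * (r / 2)) `<=` ball_union r I z `\` ball_union r J z \/
     eball c (eps * (r / 2)) `<=` ball_union r J z `\` ball_union r I z).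
Proof.
move=> [e e1 cone] eps0 eps5 r0 reps l0IJ zA /apartP sep.
case: (arg_maxP (fun l => dotv (tnth z l) e) l0IJ) => l lIJ lmax.
have [Al lx] := zA _ lIJ.
have t0 : 0 <= r / 2 <= eps by apply/andP; split; lra.
set c := tnth z l + (r / 2) *: e.
have cE t : t - tnth z l = (t - c) + (r / 2) *: e.
  by rewrite /c opprD addrA subrK.
have near t : eball c (eps * (r / 2)) t -> enorm (t - tnth z l) <= r.
  move=> tc; rewrite cE; apply: le_trans (enormD _ _) _.
  rewrite enormZ e1 mulr1 ger0_norm; last by lra.
  apply: le_trans (lerD tc (lexx _)) _.
  have : eps * (r / 2) <= r / 2 by apply: ler_piMl; lra.
  lra.
have far t j : eball c (eps * (r / 2)) t -> j \in (I :|: J)%SET ->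
    r < enorm (tnth z l - tnth z j) -> r < enorm (t - tnth z j).
  move=> tc jIJ lj; rewrite ltNge; apply/negP => tj.
  have dle : 0 <= dotv (tnth z l - tnth z j) e.
    by rewrite dotvDl dotvNl subr_ge0; exact: lmax.
  have h1 : enorm (c - tnth z j) <= eps * (r / 2) + r.
    apply: le_trans (enorm_triangle t _ _) _; apply: lerD => //.
    by rewrite enormB.
  (* Expanding the square shows why [eps <= 1 / 5] suffices: extremality makes the left side exceed
     [r ^+ 2 + (r / 2) ^+ 2], that is 1.25 times [r ^+ 2], while a point [t] within [r] would make
     it at most 1.21 times [r ^+ 2]. *)
  have h2 : enorm (c - tnth z j) ^+ 2 = enorm (tnth z l - tnth z j) ^+ 2 +
      r * dotv (tnth z l - tnth z j) e + (r / 2) ^+ 2.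
    rewrite /c addrAC !sqr_enorm !dotvDl !dotvDr !(dotvZl, dotvZr).
    have := sqr_enorm e; rewrite e1 expr1n => <-.
    by rewrite (dotvC e (tnth z l)) (dotvC e (- tnth z j)); field.
  have h3 : enorm (c - tnth z j) ^+ 2 <= (11 / 10 * r) ^+ 2.
    rewrite ler_pXn2r ?nnegrE ?enorm_ge0//; last by lra.
    apply: le_trans h1 _.
    have : eps * (r / 2) <= 1 / 5 * (r / 2) by apply: ler_wpM2r; lra.
    lra.
  have h4 : r ^+ 2 < enorm (tnth z l - tnth z j) ^+ 2.
    by rewrite ltr_pXn2r ?nnegrE ?enorm_ge0// ltW.
  have h5 : 0 <= r * dotv (tnth z l - tnth z j) e by rewrite mulr_ge0// ltW.
  have h6 : 0 < r ^+ 2 by rewrite exprn_gt0.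
  move: h3; rewrite h2 !exprMn; move: h4 h5 h6.
  rewrite exprVn; lra.
have cA : eball c (eps * (r / 2)) `<=` A.
  by move=> t tc; exact: (cone (tnth z l) t (r / 2)).
exists c; split => //.
have /finset.setUP[lI|lJ] : l \in (I :|: J)%SET := lIJ; [left|right] => t tc; split.
- by exists l => //; exact: near.
- move=> [j jJ tj]; have := far t j tc.
  by rewrite inE jJ orbT => /(_ isT (sep _ _ lI jJ)); rewrite ltNge tj.
- by exists l => //; exact: near.
- move=> [j jI tj]; have := far t j tc.
  by rewrite inE jI => /(_ isT); rewrite enormB => /(_ (sep _ _ jI lJ)); rewrite ltNge tj.
Qed.

End neighbourhoods.

Section ball_union_mass.
Context {R : realType} {d n : nat} (nu : probability 'rV[R]_d R).
Local Notation T := 'rV[R]_d.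
Implicit Types (z y : n.-tuple T) (I J K : {set 'I_n}).

Definition mass r I z : R := fine (nu (ball_union r I z)).

Lemma massE r I z : (mass r I z)%:E = nu (ball_union r I z).
Proof.
by rewrite /mass fineK// fin_num_measure//; exact: measurable_ball_union.
Qed.

Lemma mass_ge0 r I z : 0 <= mass r I z.
Proof. exact: fine_ge0. Qed.

Lemma mass_le1 r I z : mass r I z <= 1.
Proof. by rewrite -lee_fin massE; exact: probability_le1 (measurable_ball_union _ _ _). Qed.

Lemma mass_setC r I z : nu (~` ball_union r I z) = (1 - mass r I z)%:E.
Proof.
by rewrite probability_setC ?EFinB ?massE//; exact: measurable_ball_union.
Qed.

Lemma eq_mass r I z y : {in I, tnth z =1 tnth y} -> mass r I z = mass r I y.
Proof. by move=> /(eq_ball_union r) zy; rewrite /mass zy. Qed.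

Lemma mass_setU r I J z : apart (2 * r) I J z z ->
  mass r (I :|: J)%SET z = mass r I z + mass r J z.
Proof.
move=> /ball_union_disjoint IJ; apply: EFin_inj; rewrite EFinD !massE ball_unionU.
by rewrite measureU//; exact: measurable_ball_union.
Qed.

Lemma mass_upper M r I z : 0 <= r ->
  (forall x t, 0 <= t -> (nu (eball x t) <= (M * t ^+ d)%:E)%E) ->
  mass r I z <= #|I|%:R * (M * r ^+ d).
Proof.
move=> r0 nuM; rewrite -lee_fin massE.
pose F (i : 'I_n) := if i \in I then eball (tnth z i) r else set0.
have -> : ball_union r I z = \bigcup_i F i.
  apply/seteqP; split => t.
    by move=> [i iI ti]; exists i => //; rewrite /F iI.
  by move=> [i _]; rewrite /F; case: ifP => // iI ti; exists i.
apply: le_trans (measure_bigcup_fin_le _ _) _.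
  by move=> i; rewrite /F; case: ifP => _; [exact: measurable_eball|exact: measurable0].
apply: (@le_trans _ _ (\sum_(i in I) (M * r ^+ d)%:E)%E).
  rewrite [leRHS]big_mkcond/=; apply: lee_sum => i _; rewrite /F.
  by case: ifP => _; [exact: nuM|rewrite measure0].
by rewrite sumEFin lee_fin sumr_const -[leLHS]mulr_natl.
Qed.

Context (A : set T) (eps kappa r : R).
Hypotheses (eps_gt0 : 0 < eps) (eps_le : eps <= 1 / 5)
  (A_cone : forall x, A x -> cone_at A x eps)
  (nu_lower : forall x s, 0 <= s -> eball x s `<=` A ->
     ((kappa * s ^+ d)%:E <= nu (eball x s))%E)
  (r_gt0 : 0 < r) (r_le : r <= eps).

(** Guaranteed mass of the small ball of [separated_gap], of order [r ^+ d]. *)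
Definition gap : R := kappa * (eps * (r / 2)) ^+ d.

Let gap_le c (S : set T) : measurable S -> eball c (eps * (r / 2)) `<=` A ->
  eball c (eps * (r / 2)) `<=` S -> (gap%:E <= nu S)%E.
Proof.
move=> mS cA cS; apply: (@le_trans _ _ (nu (eball c (eps * (r / 2))))).
  by apply: nu_lower => //; rewrite mulr_ge0// ltW// divr_gt0.
by apply: le_measure; rewrite ?inE//; exact: measurable_eball.
Qed.

Lemma mass_lower I z i : i \in I -> A (tnth z i) -> gap <= mass r I z.
Proof.
move=> iI Ai; rewrite -lee_fin massE.
have [e e1 cone] := A_cone Ai.
apply: (gap_le (c := tnth z i + (r / 2) *: e)).
- exact: measurable_ball_union.
- move=> t tc; apply: (cone _ _ (r / 2) Ai) => //; first by rewrite subrr enorm0 ltW.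
  by apply/andP; split; move: r_gt0 r_le; lra.
- move=> t tc; exists i => //.
  have -> : t - tnth z i = t - (tnth z i + (r / 2) *: e) + (r / 2) *: e.
    by rewrite opprD addrA subrK.
  apply: le_trans (enormD _ _) _; rewrite enormZ e1 mulr1 ger0_norm; last by move: r_gt0; lra.
  apply: le_trans (lerD tc (lexx _)) _.
  have : eps * (r / 2) <= r / 2 by apply: ler_piMl; move: r_gt0 eps_le; lra.
  by move: r_gt0; lra.
Qed.

(** The ball of [separated_gap] lies in one of the two neighbourhoods and misses the other, so in
    the union it adds its full mass to the latter. *)
Lemma mass_gap I J z x i0 : A x -> i0 \in I ->
  (forall l, l \in (I :|: J)%SET -> A (tnth z l) /\ enorm (tnth z l - x) <= eps) ->
  apart r I J z z ->
  mass r I z + gap <= mass r (I :|: J)%SET z \/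
  mass r J z + gap <= mass r (I :|: J)%SET z.
Proof.
move=> Ax i0I zA sep.
have i0IJ : i0 \in (I :|: J)%SET by rewrite inE i0I.
have mU K := measurable_ball_union r K z.
have key K K' : ball_union r (I :|: J)%SET z = ball_union r K z `|` ball_union r K' z ->
    forall c, eball c (eps * (r / 2)) `<=` A ->
    eball c (eps * (r / 2)) `<=` ball_union r K' z `\` ball_union r K z ->
    mass r K z + gap <= mass r (I :|: J)%SET z.
  move=> UE c cA cS; rewrite -lee_fin EFinD !massE UE.
  have -> : ball_union r K z `|` ball_union r K' z =
      ball_union r K z `|` (ball_union r K' z `\` ball_union r K z).
    apply/seteqP; split => t; last by case; [left|case; right].
    case=> [Kt|Kt']; first by left.
    by have [Kt|Kt] := pselect (ball_union r K z t); [left|right].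
  rewrite measureU//; first last.
  - by apply/seteqP; split => t //= [? []].
  - exact: measurableD.
  by rewrite leeD2l//; apply: gap_le cA cS; exact: measurableD.
have [c [cA [cS|cS]]] := separated_gap (A_cone Ax) eps_gt0 eps_le r_gt0 r_le i0IJ zA sep.
  by right; apply: key cA cS; rewrite ball_unionU setUC.
by left; apply: key cA cS; rewrite ball_unionU.
Qed.

End ball_union_mass.

(** * Bounded random variables *)

Section bounded_expectation.
Context {disp : measure_display} {Omega : measurableType disp} {R : realType}
  (P : probability Omega R).
Implicit Types (f g : Omega -> R).

(** Nonnegativity is included so that means are finite integrals of nonnegative functions, additive
    and monotone without separate integrability conditions. *)
Definition bounded_mfun f :=
  measurable_fun setT f /\ exists b, forall w, 0 <= f w <= b.

Definition mean f : R := fine (\int[P]_w (f w)%:E)%E.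

Lemma bounded_mfunD f g : bounded_mfun f -> bounded_mfun g ->
  bounded_mfun (fun w => f w + g w).
Proof.
move=> [mf [a fa]] [mg [b gb]]; split; first exact: measurable_funD.
by exists (a + b) => w; have := fa w; have := gb w; lra.
Qed.

Lemma bounded_mfunM f g : bounded_mfun f -> bounded_mfun g ->
  bounded_mfun (fun w => f w * g w).
Proof.
move=> [mf [a fa]] [mg [b gb]]; split; first exact: measurable_funM.
exists (a * b) => w; have /andP[f0 fa'] := fa w; have /andP[g0 gb'] := gb w.
by rewrite mulr_ge0//= ler_pM.
Qed.

Lemma bounded_mfunZ c f : 0 <= c -> bounded_mfun f ->
  bounded_mfun (fun w => c * f w).
Proof.
move=> c0; apply: bounded_mfunM; split; first exact: measurable_cst.
by exists c => _; rewrite c0 lexx.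
Qed.

Lemma bounded_mfunX f k : bounded_mfun f -> bounded_mfun (fun w => f w ^+ k).
Proof.
move=> hf; elim: k => [|k IH].
  by split; [exact: measurable_cst|exists 1 => w; rewrite expr0 ler01 lexx].
rewrite (_ : (fun w => _) = fun w => f w * f w ^+ k); first exact: bounded_mfunM.
by apply/funext => w; rewrite exprS.
Qed.

Lemma bounded_mfun_bool (b : Omega -> bool) : measurable [set w | b w] ->
  bounded_mfun (fun w => (b w)%:R).
Proof.
move=> mb; split; last by exists 1 => w; case: (b w); rewrite /= ?lexx ?ler01.
rewrite (_ : (fun w => _) = \1_[set w | b w]); first exact: measurable_indic.
apply/funext => w; rewrite indicE; congr (_%:R); congr nat_of_bool.
by apply/idP/idP; rewrite inE.
Qed.

Lemma mean_ge0 f : (forall w, 0 <= f w) -> 0 <= mean f.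
Proof. by move=> f0; apply: fine_ge0; apply: integral_ge0 => w _; rewrite lee_fin. Qed.

Lemma meanE f : bounded_mfun f -> (mean f)%:E = (\int[P]_w (f w)%:E)%E.
Proof.
move=> [mf [b fb]]; rewrite /mean fineK// ge0_fin_numE; last first.
  by apply: integral_ge0 => w _; rewrite lee_fin; have /andP[] := fb w.
apply: (@le_lt_trans _ _ (\int[P]_w (cst b w)%:E)%E).
  apply: ge0_le_integral => //.
  - by move=> w _; rewrite lee_fin; have /andP[] := fb w.
  - exact/measurable_EFinP.
  - exact/measurable_EFinP/measurable_cst.
  - by move=> w _; rewrite lee_fin; have /andP[] := fb w.
by have := expectation_cst P b; rewrite unlock => ->; rewrite ltry.
Qed.

Lemma mean_le f g : bounded_mfun f -> bounded_mfun g ->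
  {ae P, forall w, f w <= g w} -> mean f <= mean g.
Proof.
move=> hf hg fg; rewrite -lee_fin !meanE//.
have [mf [a fa]] := hf; have [mg [b gb]] := hg.
apply: ae_ge0_le_integral => //.
- by move=> w _; rewrite lee_fin; have /andP[] := fa w.
- exact/measurable_EFinP.
- by move=> w _; rewrite lee_fin; have /andP[] := gb w.
- exact/measurable_EFinP.
- by apply: filterS fg => w fg _; rewrite lee_fin.
Qed.

Lemma meanD f g : bounded_mfun f -> bounded_mfun g ->
  mean (fun w => f w + g w) = mean f + mean g.
Proof.
move=> hf hg; apply: EFin_inj; rewrite EFinD !meanE//; last exact: bounded_mfunD.
have [mf [a fa]] := hf; have [mg [b gb]] := hg.
under eq_integral do rewrite EFinD.
rewrite ge0_integralD//.
- by move=> w _; rewrite lee_fin; have /andP[] := fa w.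
- exact/measurable_EFinP.
- by move=> w _; rewrite lee_fin; have /andP[] := gb w.
- exact/measurable_EFinP.
Qed.

Lemma meanZ c f : 0 <= c -> bounded_mfun f ->
  mean (fun w => c * f w) = c * mean f.
Proof.
move=> c0 hf; apply: EFin_inj; rewrite EFinM !meanE//; last exact: bounded_mfunZ.
have [mf [a fa]] := hf.
under eq_integral do rewrite EFinM.
rewrite ge0_integralZl_EFin//.
- by move=> w _; rewrite lee_fin; have /andP[] := fa w.
- exact/measurable_EFinP.
Qed.

Lemma mean_bool (b : Omega -> bool) : measurable [set w | b w] ->
  (mean (fun w => (b w)%:R))%:E = P [set w | b w].
Proof.
move=> mb; rewrite meanE; last exact: bounded_mfun_bool.
rewrite -[X in P X]setIT -integral_indic//; apply: eq_integral => w _.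
rewrite indicE; congr (_%:R%:E); congr nat_of_bool.
by apply/idP/idP; rewrite inE.
Qed.

Lemma mean_cst c : mean (cst c) = c.
Proof.
by rewrite /mean; have := expectation_cst P c; rewrite unlock => ->.
Qed.

End bounded_expectation.

Section tuple_measurability.
Context {R : realType} {d n : nat}.
Local Notation T := 'rV[R]_d.
Local Notation TT := (n.-tuple T).

Lemma measurable_fun_tnth_dist {disp : measure_display}
    {S : measurableType disp} (Y Z : S -> T) :
  measurable_fun setT Y -> measurable_fun setT Z ->
  measurable_fun setT (fun s => enorm (Y s - Z s)).
Proof.
move=> mY mZ; apply: (measurableT_comp measurable_fun_enorm).
apply: measurable_fun_rV => l; under eq_fun do rewrite !mxE.
by apply: measurable_funB; apply: (measurableT_comp (measurable_coor l)).
Qed.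

Lemma measurable_apart r I K :
  measurable [set p : TT * TT | apart r I K p.1 p.2].
Proof.
rewrite (_ : [set p | _] = \bigcap_(i in [set` I]) \bigcap_(j in [set` K])
    [set p : TT * TT | r < enorm (tnth p.1 i - tnth p.2 j)]); last first.
  apply/seteqP; split => p /=; first by move=> /apartP h i iI j jK; exact: h.
  by move=> h; apply/apartP => i j iI jK; exact: (h i iI j jK).
apply: fin_bigcap_measurable => // i _; apply: fin_bigcap_measurable => // j _.
have h : measurable_fun setT (fun p : TT * TT => enorm (tnth p.1 i - tnth p.2 j)).
  apply: measurable_fun_tnth_dist; apply: (measurableT_comp (measurable_tnth _)).
    exact: measurable_fst.
  exact: measurable_snd.
have := h measurableT `]r, +oo[%classic (measurable_itv _).
by rewrite setTI; congr measurable; apply/seteqP; split => y /=; rewrite in_itv/= ?andbT.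
Qed.

Lemma measurable_mass (nu : probability T R) r I :
  measurable_fun setT (fun z : TT => mass nu r I z).
Proof.
pose E := [set p : TT * T | ball_union r I p.1 p.2].
have mE : measurable E.
  rewrite (_ : E = \bigcup_(i in [set` I])
      [set p : TT * T | enorm (p.2 - tnth p.1 i) <= r]); last first.
    by apply/seteqP; split => p /= [i iI h]; exists i.
  apply: fin_bigcup_measurable => // i _.
  have h : measurable_fun setT (fun p : TT * T => enorm (p.2 - tnth p.1 i)).
    apply: measurable_fun_tnth_dist; first exact: measurable_snd.
    apply: (measurableT_comp (measurable_tnth _)); exact: measurable_fst.
  have := h measurableT `]-oo, r]%classic (measurable_itv _).
  by rewrite setTI; congr measurable; apply/seteqP; split => y /=; rewrite in_itv.
have := measurable_fun_xsection nu mE.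
move=> /(measurableT_comp (@fine_measurable R _ measurableT)); apply: eq_measurable_fun => z _ /=.
congr (fine (nu _)); apply/seteqP; split => t; rewrite /xsection /=.
  by rewrite inE.
by rewrite inE.
Qed.

End tuple_measurability.

(** * Freezing one block of sample points *)

Section sample_blocks.
Context {disp : measure_display} {Omega : measurableType disp} {R : realType}
  {P : probability Omega R} {d n : nat} (nu : probability 'rV[R]_d R)
  (X : nat -> {RV P >-> 'rV[R]_d}) (r : R).
Hypotheses (X_iid : iid X nu).
Local Notation T := 'rV[R]_d.
Local Notation TT := (n.-tuple T).
Implicit Types (I J K : {set 'I_n}) (h : TT -> bool).

Let Xb I := @block _ Omega R P d n X I.
Let Z := Xb [set: 'I_n]%SET.

Lemma tnth_block I i w : i \in I -> tnth (Xb I w) i = X i w.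
Proof. by move=> iI; rewrite tnth_mktuple iI. Qed.

Lemma block_full I w : {in I, tnth (Xb I w) =1 tnth (Z w)}.
Proof. by move=> i iI; rewrite !tnth_block// inE. Qed.

Lemma measurable_block_event I (S : set TT) : measurable S ->
  measurable (Xb I @^-1` S).
Proof. by move=> mS; rewrite -[X in measurable X]setTI; apply: measurable_block. Qed.

Lemma distribution_cylinder K (S : set T) (s : R) : measurable S ->
  nu S = s%:E -> P (cylinder X K (fun=> S)) = (s ^+ #|K|)%:E.
Proof.
move=> mS nuS; have [X_indep X_dist] := X_iid.
rewrite cylinder_prob// (eq_bigr (fun=> s%:E)).
  by rewrite prodEFin prodr_const.
by move=> i _; rewrite -nuS -(X_dist i S mS).
Qed.

Lemma distribution_cylinder_le K (S : set T) (s : R) : measurable S ->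
  (nu S <= s%:E)%E -> (P (cylinder X K (fun=> S)) <= (s ^+ #|K|)%:E)%E.
Proof.
move=> mS nuS; have nuSE : nu S = (fine (nu S))%:E by rewrite fineK// fin_num_measure.
rewrite (distribution_cylinder K mS nuSE) lee_fin lerXn2r ?nnegrE//.
- exact: fine_ge0.
- by rewrite -lee_fin; apply: le_trans nuS.
- by rewrite -lee_fin -nuSE.
Qed.

Lemma measurable_cylinder K (S : set T) : measurable S ->
  measurable (cylinder X K (fun=> S)).
Proof.
move=> mS; rewrite (_ : cylinder _ _ _ = \bigcap_(i in [set` K]) (X i @^-1` S)).
  apply: fin_bigcap_measurable => // i _.
  by rewrite -[X in measurable X]setTI; apply: measurable_funPT.
by apply/seteqP; split.
Qed.

Lemma mean_freezing I J (F : TT * TT -> R) : [disjoint I & J]%B ->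
  bounded_mfun F ->
  ((mean P (fun w => F (Xb I w, Xb J w)))%:E =
   \int[P]_w (mean P (fun w' => F (Xb I w, Xb J w')))%:E)%E.
Proof.
move=> IJ [mF [b Fb]]; have [X_indep X_dist] := X_iid.
have mI := measurable_block X I; have mJ := measurable_block X J.
rewrite meanE; last first.
  split; last by exists b => w.
  by apply: measurableT_comp => //; exact/measurable_fun_pairP.
rewrite (freezing (F := EFin \o F) mI mJ (block_independent X_indep IJ)).
- apply: eq_integral => w _; rewrite meanE//; split; last by exists b => w'.
  apply: (measurableT_comp mF); apply: (measurableT_comp _ mJ).
  exact: pair1_measurable.
- exact/measurable_EFinP.
- by move=> z; rewrite lee_fin; have /andP[] := Fb z.
Qed.

Lemma bounded_mfun_block I (f : TT -> R) : bounded_mfun f ->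
  bounded_mfun (fun w => f (Xb I w)).
Proof.
move=> [mf [b fb]]; split; last by exists b => w.
exact: (measurableT_comp mf (measurable_block X I)).
Qed.

Lemma bounded_mfun_fst (f : TT -> R) : bounded_mfun f ->
  bounded_mfun (fun p : TT * TT => f p.1).
Proof.
move=> [mf [b fb]]; split; last by exists b => w.
exact: (measurableT_comp mf measurable_fst).
Qed.

Lemma bounded_mfun_snd (f : TT -> R) : bounded_mfun f ->
  bounded_mfun (fun p : TT * TT => f p.2).
Proof.
move=> [mf [b fb]]; split; last by exists b => w.
exact: (measurableT_comp mf measurable_snd).
Qed.

Lemma mean_block_prod I J (f g : TT -> R) : [disjoint I & J]%B ->
  bounded_mfun f -> bounded_mfun g ->
  mean P (fun w => f (Xb I w) * g (Xb J w)) =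
  mean P (fun w => f (Xb I w)) * mean P (fun w => g (Xb J w)).
Proof.
move=> IJ hf hg; apply: EFin_inj.
have [_ [a fa]] := hf.
have gm0 : 0 <= mean P (fun w => g (Xb J w)).
  by apply: mean_ge0 => w; have [_ [b gb]] := hg; have /andP[] := gb (Xb J w).
rewrite (@mean_freezing I J (fun p => f p.1 * g p.2))//; last first.
  by apply: bounded_mfunM; [exact: bounded_mfun_fst|exact: bounded_mfun_snd].
rewrite mulrC -meanZ//; last exact: bounded_mfun_block.
rewrite meanE; last by apply: bounded_mfunZ => //; exact: bounded_mfun_block.
apply: eq_integral => w _ /=; rewrite meanZ; last exact: bounded_mfun_block.
  by rewrite mulrC.
by have /andP[] := fa (Xb I w).
Qed.

Lemma mean_freezing_le I J (f : TT -> R) (b : TT -> TT -> bool) (s : R) :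
  [disjoint I & J]%B -> bounded_mfun f ->
  measurable [set p : TT * TT | b p.1 p.2] -> 0 <= s ->
  (forall y, (P [set w | b y (Xb J w)] <= s%:E)%E) ->
  mean P (fun w => f (Xb I w) * (b (Xb I w) (Xb J w))%:R) <=
  s * mean P (fun w => f (Xb I w)).
Proof.
move=> IJ hf mb s0 hb; rewrite -lee_fin.
have [_ [a fa]] := hf.
have hF : bounded_mfun (fun p : TT * TT => f p.1 * (b p.1 p.2)%:R).
  apply: bounded_mfunM; first exact: bounded_mfun_fst.
  exact: (@bounded_mfun_bool _ _ R (fun p : TT * TT => b p.1 p.2)).
have mby y : measurable [set w | b y (Xb J w)].
  have : measurable_fun setT (fun w => (y, Xb J w)).
    apply: (measurableT_comp (pair1_measurable _)); exact: measurable_block.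
  by move=> /(_ measurableT _ mb); rewrite setTI.
rewrite (@mean_freezing I J (fun p => f p.1 * (b p.1 p.2)%:R))//.
rewrite -meanZ//; last exact: bounded_mfun_block.
rewrite meanE; last by apply: bounded_mfunZ => //; exact: bounded_mfun_block.
have hmean w : mean P (fun w' => f (Xb I w) * (b (Xb I w) (Xb J w'))%:R) =
    f (Xb I w) * fine (P [set w' | b (Xb I w) (Xb J w')]).
  rewrite meanZ; first by rewrite -mean_bool.
    by have /andP[] := fa (Xb I w).
  exact: bounded_mfun_bool.
apply: ge0_le_integral => //=.
- move=> w _; rewrite lee_fin hmean mulr_ge0//; last exact: fine_ge0.
  by have /andP[] := fa (Xb I w).
- have [mF [c Fc]] := hF.
  have F0 p : (0 <= (f p.1 * (b p.1 p.2)%:R)%:E)%E by rewrite lee_fin; have /andP[] := Fc p.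
  have := measurableT_comp (measurable_freezing P (measurable_block X J)
    ((measurable_EFinP _ _).2 mF) F0) (measurable_block X I).
  apply: eq_measurable_fun => w _ /=; rewrite meanE//.
  apply: bounded_mfunZ; first by have /andP[] := fa (Xb I w).
  exact: bounded_mfun_bool.
- apply/measurable_EFinP; have [] := bounded_mfunZ s0 (bounded_mfun_block I hf).
  by [].
- move=> w _; rewrite lee_fin hmean mulrC ler_wpM2r//.
    by have /andP[] := fa (Xb I w).
  by rewrite -lee_fin fineK ?fin_num_measure.
Qed.

(** With the block of [I] frozen, the points of [K] are independent and each avoids the union of
    balls with probability [1 - mass]. Component probabilities thus become means over a single
    block. *)
Lemma mean_avoid I K (h : TT -> bool) : [disjoint I & K]%B ->
  measurable [set z | h z] ->
  mean P (fun w => (h (Xb I w) && apart r I K (Xb I w) (Xb K w))%:R) =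
  mean P (fun w => (h (Xb I w))%:R * (1 - mass nu r I (Xb I w)) ^+ #|K|).
Proof.
move=> IK mh; apply: EFin_inj.
have mE : measurable [set p : TT * TT | h p.1 && apart r I K p.1 p.2].
  rewrite (_ : [set p | _] = (h \o fst) @^-1` [set true] `&`
      [set p | apart r I K p.1 p.2]); last first.
    by apply/seteqP; split => p /=; [move=> /andP[]|move=> [-> ->]].
  apply: measurableI; last exact: measurable_apart.
  rewrite -[X in measurable X]setTI; exact: (@measurable_fst _ _ TT TT measurableT _ mh).
rewrite (@mean_freezing I K (fun p => (h p.1 && apart r I K p.1 p.2)%:R))//; last first.
  exact: bounded_mfun_bool.
rewrite meanE; last first.
  apply: bounded_mfunM; first exact: (bounded_mfun_block I (bounded_mfun_bool mh)).
  apply: bounded_mfunX; apply: (bounded_mfun_block I (f := fun z => 1 - mass nu r I z)).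
  split.
    by apply: measurable_funB; [exact: measurable_cst|exact: measurable_mass].
  by exists 1 => w; rewrite subr_ge0 mass_le1 gerBl mass_ge0.
apply: eq_integral => w _; congr EFin; case: (h (Xb I w)) => /=; last first.
  by rewrite mul0r mean_cst.
rewrite mul1r; apply: EFin_inj.
have mb : measurable [set w' | apart r I K (Xb I w) (Xb K w')].
  have : measurable_fun setT (fun w' => (Xb I w, Xb K w')).
    apply: (measurableT_comp (pair1_measurable _)); exact: measurable_block.
  by move=> /(_ measurableT _ (measurable_apart r I K)); rewrite setTI.
rewrite mean_bool//.
have mC := measurableC (measurable_ball_union r I (Xb I w)).
rewrite -(distribution_cylinder K mC); last exact: mass_setC.
congr (P _); apply/seteqP; split => w' /=.
  by move=> /apart_ball_union hw j jK; have := hw j jK; rewrite tnth_block.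
by move=> hw; apply/apart_ball_union => j jK; rewrite tnth_block//; exact: hw.
Qed.

Context (M : R).
Hypotheses (r_ge0 : 0 <= r) (M_ge0 : 0 <= M)
  (nuM : forall x t, 0 <= t -> (nu (eball x t) <= (M * t ^+ d)%:E)%E).

(** If one point of the cluster is within [2 * r] of [tnth y i], all of them are within
    [(#|J| + 2) * r] of it. The factor [#|I|] is the union bound over [i]. *)
Lemma near_cluster_prob I J y :
  (P [set w | clustered (closer r (Xb J w)) J && ~~ apart (2 * r) I J y (Xb J w)]
   <= (#|I|%:R * (M * ((#|J| + 2)%:R * r) ^+ d) ^+ #|J|)%:E)%E.
Proof.
set s := (#|J| + 2)%:R * r; have s0 : 0 <= s by rewrite mulr_ge0.
pose F (i : 'I_n) := if i \in I then cylinder X J (fun=> eball (tnth y i) s) else set0.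
have mF i : measurable (F i).
  by rewrite /F; case: ifP => // _; apply: measurable_cylinder; exact: measurable_eball.
apply: (@le_trans _ _ (P (\bigcup_i F i))).
  apply: le_measure; rewrite ?inE.
  - apply: (measurable_block_event J (S := [set z | clustered (closer r z) J &&
      ~~ apart (2 * r) I J y z])).
    rewrite (_ : [set z | _] = [set z : TT | clustered (closer r z) J] `&`
        ~` [set z | apart (2 * r) I J y z]); last first.
      by apply/seteqP; split => z /=; [move=> /andP[? /negP]|move=> [-> /negP]].
    apply: measurableI.
      exact: (@measurable_closer_event _ _ _ r (fun e => clustered e J)).
    apply: measurableC.
    by have := pair1_measurable y measurableT (measurable_apart (2 * r) I J); rewrite setTI.
  - exact: fin_bigcup_measurable.
  move=> w /= /andP[cJ /forall_inPn[i iI /forall_inPn[j jJ]]]; rewrite -leNgt => ij.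
  exists i => //; rewrite /F iI => l lJ; rewrite /eball /=.
  have lj := cluster_diameter r_ge0 cJ lJ jJ.
  move: lj ij; rewrite !tnth_block// => lj ij.
  apply: le_trans (enorm_triangle (X j w) _ _) _.
  by rewrite /s natrD mulrDl lerD// enormB.
apply: le_trans (measure_bigcup_fin_le _ mF) _.
apply: (@le_trans _ _ (\sum_(i in I) ((M * s ^+ d) ^+ #|J|)%:E)%E).
  rewrite [leRHS]big_mkcond/=; apply: lee_sum => i _; rewrite /F.
  case: ifP => _; last by rewrite measure0.
  by apply: distribution_cylinder_le; [exact: measurable_eball|exact: nuM].
by rewrite sumEFin lee_fin sumr_const -[leLHS]mulr_natl.
Qed.

(** One point is free; the other [#|J|.-1] must fall within the diameter bound of it. *)
Lemma cluster_prob J : (0 < #|J|)%N ->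
  mean P (fun w => (clustered (closer r (Xb J w)) J)%:R) <=
  (M * (#|J|%:R * r) ^+ d) ^+ #|J|.-1.
Proof.
move=> /card_gt0P[j0 j0J]; set s := #|J|%:R * r.
have s0 : 0 <= s by rewrite mulr_ge0.
pose K := (J :\ j0)%SET; pose I := [set j0]%SET.
have IK : [disjoint I & K]%B by rewrite disjoints1 !inE eqxx.
have KE : #|K| = #|J|.-1 by rewrite [in RHS](cardsD1 j0) j0J.
pose b (y z : TT) := ~~ [exists j in K, s < enorm (tnth y j0 - tnth z j)].
have bE y z : b y z = [forall j in K, enorm (tnth y j0 - tnth z j) <= s].
  rewrite /b negb_exists; apply: eq_forallb => j; rewrite negb_and -leNgt.
  by case: (j \in K).
have mb : measurable [set p : TT * TT | b p.1 p.2].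
  rewrite (_ : [set p | _] = \bigcap_(j in [set` K])
      [set p : TT * TT | enorm (tnth p.1 j0 - tnth p.2 j) <= s]); last first.
    apply/seteqP; split => p /=; first by rewrite bE => /forall_inP h j jK; exact: h.
    by move=> h; rewrite bE; apply/forall_inP => j jK; exact: h.
  apply: fin_bigcap_measurable => // j _.
  have h : measurable_fun setT (fun p : TT * TT => enorm (tnth p.1 j0 - tnth p.2 j)).
    apply: measurable_fun_tnth_dist; apply: (measurableT_comp (measurable_tnth _)).
      exact: measurable_fst.
    exact: measurable_snd.
  have := h measurableT `]-oo, s]%classic (measurable_itv _).
  by rewrite setTI; congr measurable; apply/seteqP; split => y /=; rewrite in_itv.
have hJ : bounded_mfun (fun w => (clustered (closer r (Xb J w)) J)%:R : R).
  apply: bounded_mfun_bool.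
  apply: (measurable_block_event J (S := [set z | clustered (closer r z) J])).
  exact: (@measurable_closer_event _ _ _ r (fun e => clustered e J)).
have hb : bounded_mfun (fun w => 1 * (b (Xb I w) (Xb K w))%:R : R).
  apply: bounded_mfunZ => //; apply: bounded_mfun_bool.
  have : measurable_fun setT (fun w => (Xb I w, Xb K w)).
    by apply/measurable_fun_pairP; split; exact: measurable_block.
  by move=> /(_ measurableT _ mb); rewrite setTI.
(* The factor 1 is the function [f] of [mean_freezing_le]. *)
apply: (@le_trans _ _ (mean P (fun w => 1 * (b (Xb I w) (Xb K w))%:R))).
  apply: mean_le => //; apply: aeW => w /=; rewrite mul1r.
  case: (boolP (clustered _ _)) => // cJ; suff -> : b (Xb I w) (Xb K w) by [].
  rewrite bE; apply/forall_inP => j /[dup] jK; rewrite !inE => /andP[_ jJ].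
  by have := cluster_diameter r_ge0 cJ j0J jJ; rewrite !tnth_block ?finset.set11.
apply: le_trans (mean_freezing_le (f := fun=> 1) (s := (M * s ^+ d) ^+ #|K|) IK _ mb _ _) _.
- by split; [exact: measurable_cst|exists 1 => _; rewrite ler01 lexx].
- by rewrite exprn_ge0// mulr_ge0// exprn_ge0.
- move=> y; apply: le_trans (distribution_cylinder_le K (measurable_eball (tnth y j0) s) (nuM _ s0)).
  apply: le_measure; rewrite ?inE.
  - apply: (measurable_block_event K (S := [set z | b y z])).
    by have := pair1_measurable y measurableT mb; rewrite setTI.
  - by apply: measurable_cylinder; exact: measurable_eball.
  move=> w /=; rewrite bE => /forall_inP h j jK; rewrite /eball /= enormB.
  by have := h j jK; rewrite tnth_block.
by rewrite mean_cst mulr1 KE.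
Qed.

End sample_blocks.

(** * Comparison of avoidance probabilities *)

Section power_bounds.
Context {R : realType}.
Implicit Types (a b B g v : R).

Lemma bernoulli_le (t : R) k : 0 <= t <= 1 -> 1 - k%:R * t <= (1 - t) ^+ k.
Proof.
move=> /andP[t0 t1]; elim: k => [|k IH]; first by rewrite mul0r subr0 expr0.
rewrite exprS -natr1.
have h : 0 <= k%:R * t by rewrite mulr_ge0.
have : (1 - t) * (1 - k%:R * t) <= (1 - t) * (1 - t) ^+ k by rewrite ler_wpM2l// subr_ge0.
have : 0 <= t * (k%:R * t) by rewrite mulr_ge0.
lra.
Qed.

(** Here [m] is n - 2k and [m + k] is n - k. The [k] surplus factors multiply to at least
    [1 - 2 * k * B], and [(1 + 4 * k * B) * (1 - 2 * k * B) >= 1] because [4 * k * B <= 1]. *)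
Lemma far_power_le a b B k m : (0 < k)%N -> 0 <= a <= B -> 0 <= b <= B ->
  4 * k%:R * B <= 1 ->
  (1 - (a + b)) ^+ m <= (1 + 4 * k%:R * B) * ((1 - a) ^+ (m + k) * (1 - b) ^+ (m + k)).
Proof.
move=> k0 /andP[a0 aB] /andP[b0 bB] kB; rewrite -exprMn.
have k1 : 1 <= k%:R :> R by rewrite ler1n.
have B0 : 0 <= B by lra.
have B4 : 4 * B <= 1 by apply: le_trans kB; rewrite ler_wpM2r//; lra.
set x := (1 - a) * (1 - b).
have x0 : 1 - 2 * B <= x.
  have : 0 <= a * b by rewrite mulr_ge0.
  rewrite /x; lra.
have xk : 1 - k%:R * (2 * B) <= x ^+ k.
  apply: le_trans (bernoulli_le k (t := 2 * B) _) _; first by lra.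
  by rewrite lerXn2r ?nnegrE//; lra.
have ab0 : 0 <= a * b by rewrite mulr_ge0.
have h1 : (1 - (a + b)) ^+ m <= x ^+ m.
  by rewrite lerXn2r ?nnegrE//; rewrite /x; lra.
apply: le_trans h1 _.
rewrite exprD mulrCA -[leLHS]mulr1; apply: ler_wpM2l; first by rewrite exprn_ge0//; lra.
have kB0 : 0 <= k%:R * B by rewrite mulr_ge0.
apply: le_trans (_ : (1 + 4 * k%:R * B) * (1 - k%:R * (2 * B)) <= _); first by nra.
by rewrite ler_wpM2l//; lra.
Qed.

(** [1 - (a + b)] is the product [x] less [a * b], hence at least [x * (1 - 2 * B ^+ 2)] as
    [x >= 1 / 2]. Bernoulli's inequality turns the [N]-th power into a relative loss
    [2 * N * B ^+ 2], of order n r^(2d). *)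
Lemma far_power_ge a b B m N : (m <= N)%N -> 0 <= a <= B -> 0 <= b <= B ->
  4 * B <= 1 ->
  (1 - a) ^+ N * (1 - b) ^+ N <= (1 - (a + b)) ^+ m +
    2 * N%:R * B ^+ 2 * ((1 - a) ^+ N * (1 - b) ^+ N).
Proof.
move=> mN /andP[a0 aB] /andP[b0 bB] B4; rewrite -exprMn.
have B0 : 0 <= B by lra.
set x := (1 - a) * (1 - b).
have ab0 : 0 <= a * b by rewrite mulr_ge0.
have x0 : 1 / 2 <= x by rewrite /x; lra.
have abB : a * b <= B ^+ 2 by rewrite expr2 ler_pM.
have BB : B ^+ 2 <= 1 / 16.
  apply: (@le_trans _ _ ((1 / 4) ^+ 2)); last by rewrite expr2; lra.
  by rewrite lerXn2r ?nnegrE//; lra.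
have BB0 : 0 <= B ^+ 2 by rewrite exprn_ge0.
have h1 : x * (1 - 2 * B ^+ 2) <= 1 - (a + b).
  have : B ^+ 2 <= 2 * x * B ^+ 2 by rewrite ler_peMl//; lra.
  rewrite /x; lra.
have h2 : (1 - (a + b)) ^+ N <= (1 - (a + b)) ^+ m.
  by rewrite -(subnK mN) exprD ler_piMl ?exprn_ge0 ?exprn_ile1//; lra.
have h3 : (x * (1 - 2 * B ^+ 2)) ^+ N <= (1 - (a + b)) ^+ N.
  by rewrite lerXn2r ?nnegrE ?mulr_ge0//; lra.
have h4 := bernoulli_le N (t := 2 * B ^+ 2) _.
have h5 : x ^+ N * (1 - N%:R * (2 * B ^+ 2)) <= x ^+ N * (1 - 2 * B ^+ 2) ^+ N.
  by rewrite ler_wpM2l ?exprn_ge0//; [lra|apply: h4; lra].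
rewrite exprMn in h3.
move: h2 h3 h5; lra.
Qed.

Lemma one_sub_power_le g a N : 0 <= g -> g <= a -> a <= 1 -> (1 - a) ^+ N <= expR (- g) ^+ N.
Proof.
move=> g0 ga a1; rewrite lerXn2r ?nnegrE ?expR_ge0//; first by lra.
by apply: le_trans (expR_ge1Dx (- g)); lra.
Qed.

(** [1 - v <= (1 - a) * (1 - g)]: the second factor yields the exponential, and supplying the [k]
    missing factors [1 - a] costs at most 2. *)
Lemma near_power_le a v g B k m : (0 < k)%N -> 0 <= a <= B -> 4 * k%:R * B <= 1 ->
  0 <= g -> a + g <= v -> v <= 1 ->
  (1 - v) ^+ m <= 2 * expR (- g) ^+ m * (1 - a) ^+ (m + k).
Proof.
move=> k0 /andP[a0 aB] kB g0 av v1.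
have k1 : 1 <= k%:R :> R by rewrite ler1n.
have B0 : 0 <= B by lra.
have ag0 : 0 <= a * g by rewrite mulr_ge0.
have ak : 1 / 2 <= (1 - a) ^+ k.
  apply: le_trans (bernoulli_le k (t := a) _); last by lra.
  have : k%:R * a <= k%:R * B by rewrite ler_wpM2l.
  lra.
have h1 : (1 - v) ^+ m <= (1 - a) ^+ m * (1 - g) ^+ m.
  by rewrite -exprMn lerXn2r ?nnegrE ?mulr_ge0//; lra.
have h2 : (1 - g) ^+ m <= expR (- g) ^+ m by apply: one_sub_power_le => //; lra.
have a1 : 0 <= (1 - a) ^+ m by rewrite exprn_ge0//; lra.
apply: le_trans h1 (le_trans (ler_wpM2l a1 h2) _).
rewrite exprD.
have e0 : 0 <= expR (- g) ^+ m by rewrite exprn_ge0// expR_ge0.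
have e1 : 0 <= (1 - a) ^+ m * expR (- g) ^+ m by rewrite mulr_ge0.
have : (1 - a) ^+ m * expR (- g) ^+ m * (1 / 2) <=
  (1 - a) ^+ m * expR (- g) ^+ m * (1 - a) ^+ k by rewrite ler_wpM2l.
lra.
Qed.

End power_bounds.

(** * Pairs of components *)

Section tuple_dependence.
Context {R : realType} {d n : nat}.
Local Notation TT := (n.-tuple 'rV[R]_d).
Implicit Types (I J K : {set 'I_n}) (z y : TT) (r : R).

Lemma eq_clustered r I z y : {in I, tnth z =1 tnth y} ->
  clustered (closer r z) I = clustered (closer r y) I.
Proof.
move=> zy; rewrite /clustered.
suff -> : inner (closer r z) I = inner (closer r y) I by [].
apply/funext => i; apply/funext => j; rewrite /inner.
case: (boolP (i \in I)) => //= iI; case: (boolP (j \in I)) => //= jI.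
by rewrite /closer !zy.
Qed.

Lemma eq_apart r I K z y z' y' : {in I, tnth z =1 tnth z'} ->
  {in K, tnth y =1 tnth y'} -> apart r I K z y = apart r I K z' y'.
Proof.
move=> zz yy; apply/apartP/apartP => h i j iI jK.
  by rewrite -zz// -yy//; exact: h.
by rewrite zz// yy//; exact: h.
Qed.

Lemma detached_apart r I z : detached (closer r z) I = apart r I (~: I)%SET z z.
Proof.
apply/forall_inP/apartP => h.
  move=> i j iI jI; have /forall_inP/(_ j jI) := h i iI.
  by rewrite /closer -ltNge.
move=> i iI; apply/forall_inP => j jI; rewrite /closer -ltNge; exact: h.
Qed.

Lemma apart_setUl r I J K z y :
  apart r (I :|: J)%SET K z y = apart r I K z y && apart r J K z y.
Proof.
apply/apartP/andP => [h|[/apartP hI /apartP hJ] i j].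
  by split; apply/apartP => i j iI jK; apply: h; rewrite // inE iI ?orbT.
by rewrite inE => /orP[]; [exact: hI|exact: hJ].
Qed.

Lemma apart_sym r I J z : apart r I J z z = apart r J I z z.
Proof.
by apply/apartP/apartP => h i j iI jJ; rewrite enormB; exact: h.
Qed.

Lemma apart_le r r' I J z y : r <= r' -> apart r' I J z y -> apart r I J z y.
Proof.
move=> rr /apartP h; apply/apartP => i j iI jJ; exact: le_lt_trans rr (h _ _ iI jJ).
Qed.

(** All conditions on the points outside [I] and [J] are gathered into one avoidance event for the
    union, the form that [mean_avoid] evaluates. *)
Lemma two_components r I J z : [disjoint I & J]%B ->
  (clustered (closer r z) I && detached (closer r z) I) &&
  (clustered (closer r z) J && detached (closer r z) J) =
  [&& clustered (closer r z) I, clustered (closer r z) J & apart r I J z z] &&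
  apart r (I :|: J)%SET (~: (I :|: J))%SET z z.
Proof.
move=> IJ; rewrite !detached_apart apart_setUl.
case: (clustered _ I) => //=; case: (clustered _ J); rewrite ?andbF//=.
apply/andP/andP => [[/apartP hI /apartP hJ]|[/apartP hIJ /andP[/apartP hI /apartP hJ]]].
  split.
    by apply/apartP => i j iI jJ; apply: hI => //; rewrite inE (disjointFl IJ jJ).
  apply/andP; split; apply/apartP => i j iI; rewrite !inE negb_or => /andP[jI jJ].
    by apply: hI; rewrite // inE.
  by apply: hJ; rewrite // inE.
split; apply/apartP => i j iI; rewrite inE => jI.
  have [jJ|jJ] := boolP (j \in J); first exact: hIJ.
  by apply: hI; rewrite // !inE negb_or jI.
have [jJ|jJ] := boolP (j \in I); first by rewrite enormB; exact: hIJ.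
by apply: hJ; rewrite // !inE negb_or jI jJ.
Qed.

(** Components are classes of an equivalence relation, so two of them with a common index are
    equal. *)
Lemma overlapping_components r I J z : I != J -> ~~ [disjoint I & J]%B ->
  ~~ ((clustered (closer r z) I && detached (closer r z) I) &&
  (clustered (closer r z) J && detached (closer r z) J)).
Proof.
move=> IJ /pred0Pn[i0 /andP[/= i0I i0J]]; apply/negP.
rewrite -!componentsP; first last.
- by apply/set0Pn; exists i0.
- exact: closer_sym.
- by apply/set0Pn; exists i0.
- exact: closer_sym.
move=> /andP[/imsetP[x _ IE] /imsetP[y _ JE]]; move/eqP: IJ; apply.
have sc := sym_connect_sym (closer_sym r z).
move: i0I i0J; rewrite IE JE !inE => xi yi.
apply/setP => l; rewrite !inE; apply: (same_connect sc).
by apply: connect_trans xi _; rewrite sc.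
Qed.

End tuple_dependence.

Lemma subn_two_mul n k : (2 * k <= n -> n - k = n - 2 * k + k)%N.
Proof. lia. Qed.

Section pair_estimate.
Context {disp : measure_display} {Omega : measurableType disp} {R : realType}
  {P : probability Omega R} {d n : nat} (nu : probability 'rV[R]_d R)
  (X : nat -> {RV P >-> 'rV[R]_d}) (r : R) (A : set 'rV[R]_d)
  (M eps kappa : R) (k : nat).
Hypotheses (X_iid : iid X nu) (mA : measurable A) (nuA : nu (~` A) = 0%E)
  (r_gt0 : 0 < r) (M_ge0 : 0 <= M) (k_gt0 : (0 < k)%N)
  (nuM : forall x t, 0 <= t -> (nu (eball x t) <= (M * t ^+ d)%:E)%E)
  (eps_gt0 : 0 < eps) (eps_le : eps <= 1 / 5) (kappa_ge0 : 0 <= kappa)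
  (A_cone : forall x, A x -> cone_at A x eps)
  (nu_lower : forall x s, 0 <= s -> eball x s `<=` A ->
     ((kappa * s ^+ d)%:E <= nu (eball x s))%E)
  (r_eps : (2 * k + 2)%:R * r <= eps)
  (r_mass : 4 * k%:R * (k%:R * (M * r ^+ d)) <= 1).
Local Notation TT := (n.-tuple 'rV[R]_d).
Implicit Types (I J K : {set 'I_n}).

Let Z := @block _ Omega R P d n X [set: 'I_n]%SET.
Let Xb I := @block _ Omega R P d n X I.
Let g := @gap R d eps kappa r.
Let B := k%:R * (M * r ^+ d).
Let E := expR (- g).

Definition is_component I w : bool :=
  clustered (closer r (Z w)) I && detached (closer r (Z w)) I.

Definition prob_component I : R := mean P (fun w => (is_component I w)%:R).

Definition prob_components I J : R :=
  mean P (fun w => (is_component I w && is_component J w)%:R).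

Let hw I w := clustered (closer r (Z w)) I.
Let mw I w := mass nu r I (Z w).
(** Conditional probability, given the points of [I], that they form a component when [m] further
    points are present. *)
Let q I m w : R := (hw I w)%:R * (1 - mw I w) ^+ m.

Let r_ge0 : 0 <= r. Proof. exact: ltW. Qed.
Let r_le_eps : r <= eps.
Proof. by apply: le_trans r_eps; rewrite ler_peMl// ler1n addn2. Qed.
Let g_ge0 : 0 <= g.
Proof. by rewrite /g /gap !mulr_ge0// exprn_ge0// mulr_ge0 ?divr_ge0// ltW. Qed.
Let mw_ge0 I w : 0 <= mw I w. Proof. exact: mass_ge0. Qed.
Let mw_le1 I w : mw I w <= 1. Proof. exact: mass_le1. Qed.
Let mw_leB I w : #|I| = k -> 0 <= mw I w <= B.
Proof. by move=> Ik; rewrite mw_ge0/= /B -[in leRHS]Ik; exact: mass_upper. Qed.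

Let mcl I : measurable [set z : TT | clustered (closer r z) I].
Proof. exact: (@measurable_closer_event _ _ _ r (fun e => clustered e I)). Qed.

Let hq_tuple I m : bounded_mfun (fun z : TT =>
  (clustered (closer r z) I)%:R * (1 - mass nu r I z) ^+ m).
Proof.
apply: bounded_mfunM; first exact: bounded_mfun_bool.
apply: bounded_mfunX; split.
  by apply: measurable_funB; [exact: measurable_cst|exact: measurable_mass].
by exists 1 => w; rewrite subr_ge0 mass_le1 gerBl mass_ge0.
Qed.

Let hq I m : bounded_mfun (q I m).
Proof. exact: (bounded_mfun_block X [set: 'I_n]%SET (hq_tuple I m)). Qed.

Let qE I m : q I m = fun w => (clustered (closer r (Xb I w)) I)%:R *
  (1 - mass nu r I (Xb I w)) ^+ m.
Proof.
apply/funext => w; rewrite /q /hw /mw.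
by rewrite -(eq_clustered r (block_full X w)) -(eq_mass nu r (block_full X w)).
Qed.

Let q_ge0 I m w : 0 <= q I m w.
Proof. by rewrite /q mulr_ge0// exprn_ge0// subr_ge0. Qed.

Lemma prob_component_ge0 I : 0 <= prob_component I.
Proof. by apply: mean_ge0 => w; case: is_component. Qed.

Lemma prob_componentE I : prob_component I = mean P (q I (n - #|I|)).
Proof.
have dI : [disjoint I & ~: I]%B by rewrite -setI_eq0 finset.setICr.
rewrite qE (_ : (n - #|I|)%N = #|(~: I)%SET|); last first.
  by rewrite [in RHS]cardsCs finset.setCK card_ord.
rewrite -(mean_avoid r X_iid dI (mcl I)); congr mean; apply/funext => w.
rewrite /is_component detached_apart (eq_clustered r (block_full X w)).
by rewrite (eq_apart r (block_full X w) (block_full X w)).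
Qed.

Let mapart_self I J s : measurable [set z : TT | apart s I J z z].
Proof.
have : measurable_fun setT (fun z : TT => (z, z)).
  by apply/measurable_fun_pairP; split; exact: measurable_id.
by move=> /(_ measurableT _ (measurable_apart s I J)); rewrite setTI.
Qed.

Let qq I J m w : R := [&& hw I w, hw J w & apart r I J (Z w) (Z w)]%:R *
  (1 - mw (I :|: J)%SET w) ^+ m.

Let m_and3 (b1 b2 b3 : TT -> bool) : measurable [set z | b1 z] ->
  measurable [set z | b2 z] -> measurable [set z | b3 z] ->
  measurable [set z | [&& b1 z, b2 z & b3 z]].
Proof.
move=> m1 m2 m3.
rewrite (_ : [set z | _] = [set z | b1 z] `&` ([set z | b2 z] `&` [set z | b3 z])).
  by apply: measurableI => //; exact: measurableI.
by apply/seteqP; split => z /=; [move=> /and3P[]|move=> [-> [-> ->]]].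
Qed.

Lemma prob_componentsE I J : [disjoint I & J]%B ->
  prob_components I J = mean P (qq I J (n - #|(I :|: J)%SET|)).
Proof.
move=> IJ; set U := (I :|: J)%SET.
have dU : [disjoint U & ~: U]%B by rewrite -setI_eq0 finset.setICr.
rewrite (_ : (n - #|U|)%N = #|(~: U)%SET|); last by rewrite [in RHS]cardsCs finset.setCK card_ord.
have mh := m_and3 (mcl I) (mcl J) (mapart_self I J r).
have UI w : {in I, tnth (Xb U w) =1 tnth (Z w)}.
  by move=> i iI; apply: block_full; rewrite inE iI.
have UJ w : {in J, tnth (Xb U w) =1 tnth (Z w)}.
  by move=> i iI; apply: block_full; rewrite inE iI orbT.
transitivity (mean P (fun w => ([&& clustered (closer r (Xb U w)) I,
    clustered (closer r (Xb U w)) J & apart r I J (Xb U w) (Xb U w)] &&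
    apart r U (~: U)%SET (Xb U w) (Xb (~: U)%SET w))%:R)).
  rewrite /prob_components; congr mean; apply/funext => w.
  rewrite /is_component (two_components r (Z w) IJ).
  rewrite (eq_clustered r (UI w)) (eq_clustered r (UJ w)) (eq_apart r (UI w) (UJ w)).
  by rewrite (eq_apart r (block_full X w) (block_full X w)).
rewrite (mean_avoid r X_iid dU mh); congr mean; apply/funext => w.
rewrite /qq (eq_clustered r (UI w)) (eq_clustered r (UJ w)) (eq_apart r (UI w) (UJ w)).
by rewrite (eq_mass nu r (block_full X w)).
Qed.

Let all_in : {ae P, forall w, forall i : 'I_n, A (X i w)}.
Proof.
have [_ X_dist] := X_iid.
pose N (i : 'I_n) := X i @^-1` (~` A).
have mN i : measurable (N i).
  rewrite -[X in measurable X]setTI; apply: measurable_funPT => //.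
  exact: measurableC.
exists (\bigcup_i N i); split.
- exact: fin_bigcup_measurable.
- apply/eqP; rewrite eq_le measure_ge0 andbT.
  apply: le_trans (measure_bigcup_fin_le P mN) _.
  rewrite big1// => i _; have := X_dist i (~` A) (measurableC mA).
  by rewrite nuA.
- by move=> w /= /existsNP[i iA]; exists i.
Qed.

Let Z_in w : (forall i : 'I_n, A (X i w)) -> forall i, A (tnth (Z w) i).
Proof. by move=> h i; rewrite tnth_block ?inE. Qed.

Let mw_lower I w i : (forall i : 'I_n, A (X i w)) -> i \in I -> g <= mw I w.
Proof.
move=> /Z_in h iI.
exact: (mass_lower eps_gt0 eps_le A_cone nu_lower r_gt0 r_le_eps iI).
Qed.

Let E_ge0 : 0 <= E. Proof. exact: expR_ge0. Qed.

(** The mass to be avoided is at least the gap, which gives the exponential; the other factor is the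
    probability of a cluster. *)
Lemma prob_component_le I : #|I| = k ->
  prob_component I <= E ^+ (n - k) * (M * (k%:R * r) ^+ d) ^+ k.-1.
Proof.
move=> Ik; rewrite prob_componentE Ik.
have hc : bounded_mfun (fun w => (clustered (closer r (Xb I w)) I)%:R : R).
  by apply: bounded_mfun_bool; exact: (measurable_block_event X I (mcl I)).
apply: (@le_trans _ _ (mean P (fun w => E ^+ (n - k) * (clustered (closer r (Xb I w)) I)%:R))).
  apply: mean_le => //; first by apply: bounded_mfunZ; rewrite ?exprn_ge0.
  apply: filterS all_in => w hA.
  have [i iI] : exists i, i \in I by apply/card_gt0P; rewrite Ik.
  rewrite /q /hw (eq_clustered r (block_full X w)) mulrC.
  by rewrite ler_wpM2r//; apply: one_sub_power_le => //; exact: mw_lower iI.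
rewrite meanZ ?exprn_ge0// ler_wpM2l ?exprn_ge0// -Ik.
by apply: (cluster_prob X_iid r_ge0 M_ge0 nuM); rewrite Ik.
Qed.

(** Clustering is demanded of [J] only: with the block of [I] frozen, it forces every point of [J]
    to lie near [I]. *)
Let near I J w : bool := clustered (closer r (Z w)) J && ~~ apart (2 * r) I J (Z w) (Z w).

Let bnear I J (y z : TT) := clustered (closer r z) J && ~~ apart (2 * r) I J y z.

Let nearE I J w : near I J w = bnear I J (Xb I w) (Xb J w).
Proof.
rewrite /near /bnear (eq_clustered r (block_full X w)).
by rewrite (eq_apart (2 * r) (block_full X w) (block_full X w)).
Qed.

Let mbnear I J : measurable [set p : TT * TT | bnear I J p.1 p.2].
Proof.
rewrite (_ : [set p | _] = ((fun z => clustered (closer r z) J) \o snd) @^-1` [set true] `&`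
      ~` [set p : TT * TT | apart (2 * r) I J p.1 p.2]); last first.
  by apply/seteqP; split => p /=; [move=> /andP[-> /negP]|move=> [h1 /negP h2]; apply/andP].
apply: measurableI; last by apply: measurableC; exact: measurable_apart.
rewrite -[X in measurable X]setTI; exact: (@measurable_snd _ _ TT TT measurableT _ (mcl J)).
Qed.

Let nustar := k%:R * (M * ((k + 2)%:R * r) ^+ d) ^+ k.

Let nustar_ge0 : 0 <= nustar.
Proof. by rewrite /nustar mulr_ge0// exprn_ge0// mulr_ge0// exprn_ge0// mulr_ge0. Qed.

Let hnear I J : bounded_mfun (fun w => (near I J w)%:R : R).
Proof.
apply: bounded_mfun_bool.
have : measurable_fun setT (fun w => (Z w, Z w)).
  by apply/measurable_fun_pairP; split; exact: measurable_block.
by move=> /(_ measurableT _ (mbnear I J)); rewrite setTI.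
Qed.

Let near_le I J m : [disjoint I & J]%B -> #|I| = k -> #|J| = k ->
  mean P (fun w => q I m w * (near I J w)%:R) <= nustar * mean P (q I m).
Proof.
move=> IJ Ik Jk; under [X in mean P X]eq_fun do rewrite nearE qE.
rewrite qE; apply: (mean_freezing_le X_iid (b := bnear I J) IJ (hq_tuple I m)
  (mbnear I J) nustar_ge0).
move=> y; have := near_cluster_prob X_iid r_ge0 nuM I J y.
by rewrite Ik Jk.
Qed.

(** The product of two component probabilities becomes one mean over both blocks, to be compared
    pointwise with [qq]. *)
Let mean_qq I J m : [disjoint I & J]%B ->
  mean P (fun w => q I m w * q J m w) = mean P (q I m) * mean P (q J m).
Proof.
move=> IJ; rewrite !qE.
exact: (mean_block_prod X_iid IJ (hq_tuple I m) (hq_tuple J m)).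
Qed.

Let hqq I J m : bounded_mfun (qq I J m).
Proof.
have := bounded_mfun_block X [set: 'I_n]%SET
  (bounded_mfunM (bounded_mfun_bool (m_and3 (mcl I) (mcl J) (mapart_self I J r)))
   (bounded_mfunX m (_ : bounded_mfun (fun z : TT => 1 - mass nu r (I :|: J)%SET z)))).
apply; split.
  by apply: measurable_funB; [exact: measurable_cst|exact: measurable_mass].
by exists 1 => w; rewrite subr_ge0 mass_le1 gerBl mass_ge0.
Qed.

(** Two close clusters fit into a ball of radius [eps], so that one cone direction serves all their
    points in [mass_gap]. *)
Let near_points I J w : #|I| = k -> #|J| = k -> hw I w -> hw J w ->
  ~~ apart (2 * r) I J (Z w) (Z w) ->
  exists2 i0, i0 \in I & forall l, l \in (I :|: J)%SET ->
    enorm (tnth (Z w) l - tnth (Z w) i0) <= eps.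
Proof.
move=> Ik Jk hI hJ /forall_inPn[i iI /forall_inPn[j jJ]]; rewrite -leNgt => ij.
exists i => // l; have h0 : 0 <= k%:R * r by rewrite mulr_ge0.
have e2 : 2 * (k%:R * r) + 2 * r <= eps.
  by apply: le_trans r_eps; rewrite natrD natrM; lra.
rewrite inE => /orP[lI|lJ].
  have := cluster_diameter r_ge0 hI lI iI; rewrite Ik => h.
  by move: r_gt0; lra.
have := cluster_diameter r_ge0 hJ lJ jJ; rewrite Jk => h.
apply: le_trans (enorm_triangle (tnth (Z w) j) _ _) _.
by move: ij; rewrite enormB => ij; move: r_gt0; lra.
Qed.

(* The mass of the union is the sum of the masses when I and J are more than 2r
   apart; otherwise it exceeds one of the two masses by the gap. *)
Lemma prob_components_upper I J : [disjoint I & J]%B -> #|I| = k -> #|J| = k ->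
  (2 * k <= n)%N ->
  prob_components I J <= (1 + 4 * k%:R * B) * (prob_component I * prob_component J) +
    2 * E ^+ (n - 2 * k) * nustar * (prob_component I + prob_component J).
Proof.
move=> IJ Ik Jk kn; rewrite prob_componentsE// !prob_componentE Ik Jk.
have UK : #|(I :|: J)%SET| = (2 * k)%N.
  by rewrite cardsU (disjoint_setI0 IJ) cards0 Ik Jk subn0 mul2n addnn.
rewrite UK; set m := (n - 2 * k)%N.
have mkE : (n - k)%N = (m + k)%N by exact: subn_two_mul.
rewrite mkE -mean_qq//.
have JI : [disjoint J & I]%B by rewrite disjoint_sym.
have B0 : 0 <= B by rewrite /B !mulr_ge0// exprn_ge0.
have c1 : 0 <= 1 + 4 * k%:R * B by rewrite addr_ge0// mulr_ge0.
have c2 : 0 <= 2 * E ^+ m by rewrite mulr_ge0// exprn_ge0.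
(* [mass_gap] does not tell which of the two masses is exceeded, so the majorant carries a near term
   for each block. *)
set F := (fun w => (1 + 4 * k%:R * B) * (q I (m + k) w * q J (m + k) w) +
   2 * E ^+ m * (q I (m + k) w * (near I J w)%:R + q J (m + k) w * (near J I w)%:R)).
have b1 : bounded_mfun (fun w => q I (m + k) w * q J (m + k) w) by exact: bounded_mfunM.
have b2 : bounded_mfun (fun w => q I (m + k) w * (near I J w)%:R) by exact: bounded_mfunM.
have b3 : bounded_mfun (fun w => q J (m + k) w * (near J I w)%:R) by exact: bounded_mfunM.
have b4 := bounded_mfunD b2 b3.
apply: (@le_trans _ _ (mean P F)); last first.
  rewrite /F meanD; [|exact: bounded_mfunZ|exact: bounded_mfunZ].
  rewrite !meanZ// meanD// lerD2l -mulrA ler_wpM2l// mulrDr.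
  by apply: lerD; exact: near_le.
apply: mean_le => //.
  by apply: bounded_mfunD; exact: bounded_mfunZ.
apply: filterS all_in => w hA; rewrite /qq.
have nn K K' : 0 <= q K (m + k) w * (near K K' w)%:R by exact: mulr_ge0.
have F0 : 0 <= F w.
  apply: addr_ge0; apply: mulr_ge0 => //; first exact: mulr_ge0.
  by apply: addr_ge0; exact: nn.
case: (boolP (hw I w)) => [hI|]; last by rewrite mul0r.
case: (boolP (hw J w)) => [hJ|]; last by rewrite mul0r.
case: (boolP (apart r I J (Z w) (Z w))) => [sep|]; last by rewrite mul0r.
rewrite mul1r.
have aB := mw_leB w Ik; have bB := mw_leB w Jk.
have kB : 4 * k%:R * B <= 1 by [].
have qI : q I (m + k) w = (1 - mw I w) ^+ (m + k) by rewrite /q hI mul1r.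
have qJ : q J (m + k) w = (1 - mw J w) ^+ (m + k) by rewrite /q hJ mul1r.
case: (boolP (apart (2 * r) I J (Z w) (Z w))) => [far|close].
  rewrite {1}/mw (mass_setU nu far).
  apply: le_trans (far_power_le m k_gt0 aB bB kB) _.
  by rewrite /F qI qJ lerDl mulr_ge0// -qI -qJ addr_ge0.
have nIJ : near I J w by rewrite /near close andbT; exact: hJ.
have nJI : near J I w by rewrite /near apart_sym close andbT; exact: hI.
have [i0 i0I dist] := near_points Ik Jk hI hJ close.
have conf l : l \in (I :|: J)%SET -> A (tnth (Z w) l) /\
    enorm (tnth (Z w) l - tnth (Z w) i0) <= eps.
  by move=> lIJ; split; [exact: Z_in|exact: dist].
have q0 : 0 <= (1 + 4 * k%:R * B) * (q I (m + k) w * q J (m + k) w).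
  by rewrite mulr_ge0// mulr_ge0.
rewrite /F nIJ nJI !mulr1 mulrDr.
have [h|h] := mass_gap eps_gt0 eps_le A_cone nu_lower r_gt0 r_le_eps
    (Z_in hA i0) i0I conf sep.
- have := near_power_le m k_gt0 aB kB g_ge0 h (mw_le1 _ _).
  rewrite -/E -qI => {}h; apply: le_trans h _.
  have : 0 <= 2 * E ^+ m * q J (m + k) w by rewrite mulr_ge0.
  by move: q0; lra.
- have := near_power_le m k_gt0 bB kB g_ge0 h (mw_le1 _ _).
  rewrite -/E -qJ => {}h; apply: le_trans h _.
  have : 0 <= 2 * E ^+ m * q I (m + k) w by rewrite mulr_ge0.
  by move: q0; lra.
Qed.

(** Far pairs are covered by [far_power_ge]. For close pairs [qq] may vanish, but the product is
    itself small: [q J] is at most [E ^+ (n - k)] since the mass of [J] is at least the gap, and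
    nearness contributes [nustar]. *)
Lemma prob_components_lower I J : [disjoint I & J]%B -> #|I| = k -> #|J| = k ->
  (2 * k <= n)%N ->
  prob_component I * prob_component J <= prob_components I J +
    2 * (n - k)%:R * B ^+ 2 * (prob_component I * prob_component J) +
    E ^+ (n - k) * nustar * prob_component I.
Proof.
move=> IJ Ik Jk kn; rewrite prob_componentsE// !prob_componentE Ik Jk.
have UK : #|(I :|: J)%SET| = (2 * k)%N.
  by rewrite cardsU (disjoint_setI0 IJ) cards0 Ik Jk subn0 mul2n addnn.
rewrite UK -mean_qq//; set m := (n - 2 * k)%N; set N := (n - k)%N.
have mN : (m <= N)%N by rewrite /N subn_two_mul// leq_addr.
have B0 : 0 <= B by rewrite /B !mulr_ge0// exprn_ge0.
have c1 : 0 <= 2 * N%:R * B ^+ 2 by rewrite !mulr_ge0// exprn_ge0.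
have c2 : 0 <= E ^+ N by rewrite exprn_ge0.
have b1 : bounded_mfun (fun w => q I N w * q J N w) by exact: bounded_mfunM.
have b2 : bounded_mfun (fun w => q I N w * (near I J w)%:R) by exact: bounded_mfunM.
have b3 := bounded_mfunZ c1 b1.
have b4 := bounded_mfunZ c2 b2.
have b5 := bounded_mfunD (hqq I J m) b3.
set F := (fun w => qq I J m w + 2 * N%:R * B ^+ 2 * (q I N w * q J N w) +
   E ^+ N * (q I N w * (near I J w)%:R)).
apply: (@le_trans _ _ (mean P F)); last first.
  rewrite /F meanD// meanD// !meanZ// lerD2l -mulrA ler_wpM2l//.
  exact: near_le.
apply: mean_le => //; first exact: bounded_mfunD.
apply: filterS all_in => w hA; rewrite /F.
have qq0 : 0 <= qq I J m w by rewrite /qq mulr_ge0// exprn_ge0// subr_ge0.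
have t1 : 0 <= 2 * N%:R * B ^+ 2 * (q I N w * q J N w) by rewrite mulr_ge0// mulr_ge0.
have t2 : 0 <= E ^+ N * (q I N w * (near I J w)%:R) by rewrite mulr_ge0// mulr_ge0.
case: (boolP (hw I w)) => [hI|hI]; last by rewrite {1}/q (negbTE hI) !mul0r !addr_ge0.
case: (boolP (hw J w)) => [hJ|hJ].
  have qI : q I N w = (1 - mw I w) ^+ N by rewrite /q hI mul1r.
  have qJ : q J N w = (1 - mw J w) ^+ N by rewrite /q hJ mul1r.
  case: (boolP (apart (2 * r) I J (Z w) (Z w))) => [far|close].
    have sep : apart r I J (Z w) (Z w) by apply: apart_le far; move: r_gt0; lra.
    have B4 : 4 * B <= 1.
      apply: le_trans r_mass; rewrite -/B ler_wpM2r// ler_peMr// ler1n//.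
    have := far_power_ge mN (mw_leB w Ik) (mw_leB w Jk) B4.
    rewrite -qI -qJ => h; apply: le_trans h _.
    have -> : qq I J m w = (1 - (mw I w + mw J w)) ^+ m.
      by rewrite /qq hI hJ sep mul1r /mw (mass_setU nu far).
    by rewrite lerDl.
  have nIJ : near I J w by rewrite /near close andbT; exact: hJ.
  rewrite nIJ mulr1.
  have [j jJ] : exists j, j \in J by apply/card_gt0P; rewrite Jk.
  have := one_sub_power_le N g_ge0 (mw_lower hA jJ) (mw_le1 J w).
  rewrite -qJ -/E => h.
  have : q I N w * q J N w <= E ^+ N * q I N w by rewrite mulrC ler_wpM2r.
  by move: qq0 t1; lra.
by rewrite {1}[q J N w]/q (negbTE hJ) mul0r mulr0 !addr_ge0.
Qed.

End pair_estimate.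

(** * Moments of the number of components *)

Section bounded_moments.
Context {disp : measure_display} {Omega : measurableType disp} {R : realType}
  (P : probability Omega R).
Implicit Types f g : Omega -> R.

Lemma mean_ae_eq f g : bounded_mfun f -> bounded_mfun g ->
  {ae P, forall w, f w = g w} -> mean P f = mean P g.
Proof.
move=> hf hg fg; apply/eqP; rewrite eq_le; apply/andP; split; apply: mean_le => //.
  by apply: filterS fg => w ->.
by apply: filterS fg => w ->.
Qed.

Lemma bounded_mfun0 : bounded_mfun (cst 0 : Omega -> R).
Proof. by split; [exact: measurable_cst|exists 0 => w; rewrite lexx]. Qed.

Lemma bounded_mfun_sum (J : finType) (Q : pred J) (F : J -> Omega -> R) :
  (forall i, Q i -> bounded_mfun (F i)) ->
  bounded_mfun (fun w => \sum_(i | Q i) F i w).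
Proof.
move=> hF; suff : forall s, bounded_mfun (fun w => \sum_(i <- s | Q i) F i w) by [].
elim=> [|i s IH]; first by under eq_fun do rewrite big_nil; exact: bounded_mfun0.
under eq_fun do rewrite big_cons.
by case: (boolP (Q i)) => // Qi; apply: bounded_mfunD => //; exact: hF.
Qed.

Lemma mean_sum (J : finType) (Q : pred J) (F : J -> Omega -> R) :
  (forall i, Q i -> bounded_mfun (F i)) ->
  mean P (fun w => \sum_(i | Q i) F i w) = \sum_(i | Q i) mean P (F i).
Proof.
move=> hF; rewrite -[RHS]big_filter.
under eq_fun do rewrite -big_filter.
have : forall i, i \in [seq i <- index_enum J | Q i] -> Q i.
  by move=> i; rewrite mem_filter => /andP[].
elim: [seq _ <- _ | _] => [|i s IH] sQ.
  by under eq_fun do rewrite big_nil; rewrite big_nil; exact: mean_cst.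
have hs : bounded_mfun (fun w => \sum_(i <- s) F i w).
  have {IH} : forall i, i \in s -> Q i by move=> j js; apply: sQ; rewrite inE js orbT.
  elim: s {sQ} => [_|j s IH sQ]; first by under eq_fun do rewrite big_nil; exact: bounded_mfun0.
  under eq_fun do rewrite big_cons; apply: bounded_mfunD.
    by apply: hF; apply: sQ; rewrite mem_head.
  by apply: IH => l ls; apply: sQ; rewrite inE ls orbT.
under eq_fun do rewrite big_cons; rewrite big_cons meanD//; last first.
  by apply: hF; apply: sQ; rewrite mem_head.
by rewrite IH// => l ls; apply: sQ; rewrite inE ls orbT.
Qed.

Lemma expectation_mean f : bounded_mfun f -> ('E_P[f] = (mean P f)%:E)%E.
Proof. by move=> hf; rewrite unlock meanE. Qed.

Lemma variance_mean f : bounded_mfun f ->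
  ('V_P[f] = (mean P (fun w => f w ^+ 2) - mean P f ^+ 2)%:E)%E.
Proof.
move=> hf; have [mf [b fb]] := hf; set m := mean P f.
have m0 : 0 <= m by apply: mean_ge0 => w; have /andP[] := fb w.
have hsq : bounded_mfun (fun w => (f w - m) ^+ 2).
  split; first by apply: measurable_funX; apply: measurable_funB => //; exact: measurable_cst.
  exists ((b + m) ^+ 2) => w; rewrite sqr_ge0/= -[_ ^+ 2]real_normK ?num_real//.
  rewrite ler_sqr ?nnegrE ?normr_ge0//.
    by have /andP[f0 fle] := fb w; rewrite ler_norml; apply/andP; split; lra.
  by have /andP[f0 fle] := fb w; lra.
have -> : ('V_P[f] = (mean P (fun w => (f w - m) ^+ 2))%:E)%E.
  rewrite -(expectation_mean hsq) /variance unlock (expectation_mean hf)/= -/m.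
  by congr expectation; apply/funext => w /=; rewrite expr2.
congr EFin; have hm2 : bounded_mfun (cst (m ^+ 2) : Omega -> R).
  by split; [exact: measurable_cst|exists (m ^+ 2) => w; rewrite /= sqr_ge0 lexx].
have h2m : 0 <= 2 * m by rewrite mulr_ge0.
(* [meanD] adds nonnegative functions only, so the square is expanded without subtraction. *)
have : mean P (fun w => (f w - m) ^+ 2 + 2 * m * f w) =
       mean P (fun w => f w ^+ 2 + m ^+ 2).
  by congr mean; apply/funext => w; ring.
rewrite meanD//; last exact: bounded_mfunZ.
rewrite meanZ// meanD//; last exact: bounded_mfunX.
have -> : mean P (cst (m ^+ 2)) = m ^+ 2 by exact: mean_cst.
by rewrite -/m => h; lra.
Qed.

End bounded_moments.

Section counting.
Context {n : nat}.
Implicit Types I J : {set 'I_n}.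

Lemma ffact_le_exp m j : (m ^_ j <= m ^ j)%N.
Proof.
by elim: j => [|j IH]; rewrite ?ffactn0// ffactnSr expnSr leq_mul// leq_subr.
Qed.

Lemma bin_le_exp m j : ('C(m, j) <= m ^ j)%N.
Proof. by apply: leq_trans (ffact_le_exp m j); rewrite -bin_ffact leq_pmulr// fact_gt0. Qed.

Lemma card_sets_le k : (#|[set I : {set 'I_n} | #|I| == k]%SET| <= n ^ k)%N.
Proof. by rewrite card_draws card_ord; exact: bin_le_exp. Qed.

(** Such a [J] contains one of the [k] elements of [I]; removing it leaves a set of [k.-1]
    elements. *)
Lemma card_meeting_sets_le k I : (0 < k)%N -> #|I| = k ->
  (#|[set J : {set 'I_n} | (#|J| == k) && ~~ [disjoint I & J]%B]%SET| <=
   k * n ^ k.-1)%N.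
Proof.
move=> k0 Ik; pose S i := [set J : {set 'I_n} | (#|J| == k) && (i \in J)]%SET.
have Sle i : (#|S i| <= n ^ k.-1)%N.
  rewrite -(@card_in_imset _ _ (fun J : {set 'I_n} => (J :\ i)%SET)); last first.
    move=> J J'; rewrite !inE => /andP[_ iJ] /andP[_ iJ'] JJ.
    by rewrite -(finset.setD1K iJ) JJ finset.setD1K.
  apply: leq_trans (card_sets_le k.-1); apply: subset_leq_card.
  apply/fintype.subsetP => _ /imsetP[J + ->]; rewrite !inE => /andP[/eqP Jk iJ].
  by rewrite -Jk (cardsD1 i J) iJ.
apply: (@leq_trans #|(\bigcup_(i in I) S i)%SET|).
  apply: subset_leq_card; apply/fintype.subsetP => J; rewrite inE => /andP[Jk].
  move=> /pred0Pn[i /andP[/= iI iJ]]; apply/bigcupP; exists i => //.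
  by rewrite inE Jk.
apply: leq_trans (_ : (\sum_(i in I) #|S i| <= _)%N).
  apply: (big_ind2 (fun (A : {set {set 'I_n}}) m => (#|A| <= m)%N)) => //.
    by rewrite cards0.
  by move=> A a B b Aa Bb; apply: leq_trans (leq_card_setU A B) (leq_add Aa Bb).
apply: leq_trans (_ : (\sum_(i in I) n ^ k.-1 <= _)%N); first exact: leq_sum.
by rewrite sum_nat_const Ik.
Qed.

End counting.

Section second_moment.
Context {R : realFieldType} {n : nat} (k : nat) (k_gt0 : (0 < k)%N).
Implicit Types I J : {set 'I_n}.
Variables (p : {set 'I_n} -> R) (p2 : {set 'I_n} -> {set 'I_n} -> R) (a b rho : R).
Hypotheses (a_ge0 : 0 <= a) (b_ge0 : 0 <= b) (rho_ge0 : 0 <= rho)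
  (p_ge0 : forall I, 0 <= p I)
  (p_le : forall I, #|I| = k -> p I <= rho)
  (p2_diag : forall I, p2 I I = p I)
  (p2_meet : forall I J, I != J -> ~~ [disjoint I & J]%B -> p2 I J = 0)
  (p2_disjoint : forall I J, [disjoint I & J]%B -> #|I| = k -> #|J| = k ->
     `|p2 I J - p I * p J| <= a * (p I * p J) + b * (p I + p J)).

(** For fixed [I], the disjoint [J] contribute at most n^k terms and the intersecting ones at most k
    n^(k-1). The bound [rho] replaces only one factor of each product, so the sum of the [p I]
    survives outside. *)
Lemma second_moment_bound :
  `|\sum_(I : {set 'I_n} | #|I| == k) \sum_(J : {set 'I_n} | #|J| == k) p2 I J -
    (\sum_(I : {set 'I_n} | #|I| == k) p I) ^+ 2 -
    \sum_(I : {set 'I_n} | #|I| == k) p I| <=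
  (\sum_(I : {set 'I_n} | #|I| == k) p I) *
  (n%:R ^+ k * (a * rho + 2 * b) + k%:R * n%:R ^+ k.-1 * rho).
Proof.
set ES := \sum_(I | _) p I.
have Emul : ES ^+ 2 =
    \sum_(I : {set 'I_n} | #|I| == k) \sum_(J : {set 'I_n} | #|J| == k) p I * p J.
  by rewrite expr2 mulr_suml; apply: eq_bigr => I _; rewrite mulr_sumr.
have cs : #|[set I : {set 'I_n} | #|I| == k]%SET|%:R <= n%:R ^+ k :> R.
  by rewrite -natrX ler_nat; exact: card_sets_le.
(* On the diagonal, [p2 I I - p I ^+ 2 - p I = - p I ^+ 2]: subtracting the expectation makes
   [J = I] look like any other intersecting pair. *)
have term I : #|I| == k ->
   \sum_(J : {set 'I_n} | #|J| == k) (p2 I J - p I * p J) - p I =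
   \sum_(J : {set 'I_n} | #|J| == k)
     (if [disjoint I & J]%B then p2 I J - p I * p J else - (p I * p J)).
  move=> Ik; rewrite (bigD1 I)//= [RHS](bigD1 I)//= p2_diag.
  have -> : [disjoint I & I]%B = false.
    apply/negbTE/pred0Pn; have /card_gt0P[i iI] : (0 < #|I|)%N by rewrite (eqP Ik).
    by exists i; rewrite /= iI.
  rewrite addrAC [p I - _]addrC addrK; congr (_ + _); apply: eq_bigr => J /andP[_ JI].
  by case: ifPn => // IJ; rewrite p2_meet 1?eq_sym// sub0r.
have -> : \sum_(I : {set 'I_n} | #|I| == k) \sum_(J : {set 'I_n} | #|J| == k)
    p2 I J - ES ^+ 2 - ES =
  \sum_(I : {set 'I_n} | #|I| == k) \sum_(J : {set 'I_n} | #|J| == k)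
    (if [disjoint I & J]%B then p2 I J - p I * p J else - (p I * p J)).
  rewrite Emul -sumrB -sumrB; apply: eq_bigr => I Ik; rewrite -term//.
  by rewrite sumrB.
apply: le_trans (ler_norm_sum _ _ _) _.
apply: (@le_trans _ _ (\sum_(I : {set 'I_n} | #|I| == k)
   (p I * (n%:R ^+ k * (a * rho + b) + k%:R * n%:R ^+ k.-1 * rho) + b * ES))); last first.
  rewrite big_split/= -mulr_suml sumr_const -[X in _ + X]mulr_natr.
  have -> : #|[pred I : {set 'I_n} | #|I| == k]| = #|[set I : {set 'I_n} | #|I| == k]%SET|.
    by rewrite cardsE.
  have ES0 : 0 <= ES by exact: sumr_ge0.
  have : b * ES * #|[set I : {set 'I_n} | #|I| == k]%SET|%:R <= b * ES * n%:R ^+ k.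
    by rewrite ler_wpM2l// mulr_ge0.
  by rewrite -/ES; lra.
apply: ler_sum => I /eqP Ik.
apply: le_trans (ler_norm_sum _ _ _) _.
apply: (@le_trans _ _ (\sum_(J : {set 'I_n} | #|J| == k)
   ((p I * (a * rho + b) + b * p J) + if [disjoint I & J]%B then 0 else p I * rho))).
  apply: ler_sum => J /eqP Jk; have pJ := p_le Jk; have pI := p_ge0 I.
  have h1 : p I * p J <= p I * rho by rewrite ler_wpM2l.
  have h2 : a * (p I * p J) <= a * (p I * rho) by rewrite ler_wpM2l.
  have h3 : 0 <= p I * (a * rho + b) + b * p J.
    by rewrite addr_ge0// mulr_ge0// addr_ge0// mulr_ge0.
  case: ifPn => IJ; first by apply: le_trans (p2_disjoint IJ Ik Jk) _; lra.
  by rewrite normrN ger0_norm ?mulr_ge0//; lra.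
rewrite !big_split/= -[X in _ + X + _]mulr_sumr -/ES sumr_const -[X in X + _ + _]mulr_natl.
have -> : #|[pred I : {set 'I_n} | #|I| == k]| = #|[set I : {set 'I_n} | #|I| == k]%SET|.
  by rewrite cardsE.
have h1 : #|[set I : {set 'I_n} | #|I| == k]%SET|%:R * (p I * (a * rho + b)) <=
    n%:R ^+ k * (p I * (a * rho + b)).
  by rewrite ler_wpM2r// mulr_ge0// addr_ge0// mulr_ge0.
have h2 : \sum_(J : {set 'I_n} | #|J| == k) (if [disjoint I & J]%B then 0 else p I * rho) <=
    k%:R * n%:R ^+ k.-1 * (p I * rho).
  rewrite (eq_bigr (fun J => if ~~ [disjoint I & J]%B then p I * rho else 0)); last first.
    by move=> J _; case: ifP.
  rewrite -big_mkcondr/= sumr_const -[leLHS]mulr_natl ler_wpM2r ?mulr_ge0//.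
  rewrite -natrX -natrM ler_nat; apply: leq_trans (card_meeting_sets_le k_gt0 Ik).
  by rewrite cardsE.
lra.
Qed.

End second_moment.

Section component_count_moments.
Context {disp : measure_display} {Omega : measurableType disp} {R : realType}
  {P : probability Omega R} {d n : nat} (nu : probability 'rV[R]_d R)
  (X : nat -> {RV P >-> 'rV[R]_d}) (r : nat -> R) (M : R) (k : nat).
Hypotheses (X_iid : iid X nu) (d_gt0 : (0 < d)%N) (r_ge0 : 0 <= r n)
  (M_ge0 : 0 <= M) (k_gt0 : (0 < k)%N)
  (nuM : forall x t, 0 <= t -> (nu (eball x t) <= (M * t ^+ d)%:E)%E).
Implicit Types (I J : {set 'I_n}).
Local Notation TT := (n.-tuple 'rV[R]_d).

Let Z := @block _ Omega R P d n X [set: 'I_n]%SET.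

Let mnear (i j : 'I_n) s : measurable [set w | enorm (X i w - X j w) <= s].
Proof.
have : measurable_fun setT (fun w => enorm (X i w - X j w)).
  apply: (measurableT_comp measurable_fun_enorm).
  apply: measurable_fun_rV => l; under eq_fun do rewrite !mxE.
  by apply: measurable_funB; apply: (measurableT_comp (measurable_coor l)); exact: measurable_funPT.
have -> : [set w | enorm (X i w - X j w) <= s] =
    (fun w => enorm (X i w - X j w)) @^-1` `]-oo, s]%classic.
  by apply/seteqP; split => w /=; rewrite in_itv.
by move=> /(_ measurableT _ (measurable_itv `]-oo, s])); rewrite setTI.
Qed.

(** Two points within [s] form a cluster at radius [s]. *)
Let near_pair_prob (i j : 'I_n) s : i != j -> 0 <= s ->
  (P [set w | (enorm (X i w - X j w) <= s)%R] <= (M * (2 * s) ^+ d)%:E)%E.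
Proof.
move=> ij s0; set J := [set i; j]%SET.
have J2 : #|J| = 2%N by rewrite cards2 ij.
have mc : measurable [set w | clustered (closer s (block X J w)) J].
  exact: (measurable_block_event X J (@measurable_closer_event _ _ _ s (fun e => clustered e J))).
have := cluster_prob X_iid s0 M_ge0 nuM (J := J).
rewrite J2 expr1 -lee_fin mean_bool// => /(_ isT); apply: le_trans.
apply: le_measure; rewrite ?inE//.
move=> w /= h; apply/forall_inP => a aJ; apply/forall_inP => b bJ.
have [->|ab] := eqVneq a b; first exact: connect0.
apply: connect1; rewrite /inner aJ bJ /closer !tnth_mktuple aJ bJ.
move: aJ bJ ab; rewrite !inE => /orP[] /eqP -> /orP[] /eqP ->; rewrite ?eqxx//.
by rewrite enormB.
Qed.

Lemma ae_distinct : {ae P, forall w, injective (tnth (Z w))}.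
Proof.
suff h : forall i j : 'I_n, i != j -> {ae P, forall w, X i w != X j w}.
  have : {ae P, forall w, forall i j : 'I_n, i != j -> X i w != X j w}.
    apply: filter_forall => i; apply: filter_forall => j.
    have [->|ij] := eqVneq i j; first by apply: aeW => w; rewrite eqxx.
    by apply: filterS (h i j ij) => w.
  apply: filterS => w hw i j; rewrite !tnth_block ?inE// => E.
  by apply/eqP; apply: contraPT E => /hw/eqP.
move=> i j ij; exists [set w | enorm (X i w - X j w) <= 0]; split => //.
- apply/eqP; rewrite eq_le measure_ge0 andbT; apply/lee_addgt0Pr => e e0.
  (* [2 * s <= 1] allows replacing the power [d] by 1, and then [M * (2 * s) <= e]. *)
  rewrite add0e; pose s := Num.min (1 / 2) (e / (2 * (M + 1))).
  have M1 : 0 < M + 1 by rewrite ltr_wpDl.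
  have s0 : 0 <= s by rewrite le_min divr_ge0//= divr_ge0 ?mulr_ge0// ltW.
  have s1 : 2 * s <= 1 by have : s <= 1 / 2 by [rewrite ge_min lexx]; lra.
  have se : M * (2 * s) <= e.
    have : s <= e / (2 * (M + 1)) by rewrite ge_min lexx orbT.
    rewrite ler_pdivlMr ?mulr_gt0// => h; nra.
  apply: le_trans (_ : (P [set w | (enorm (X i w - X j w) <= s)%R] <= _)%E).
    apply: le_measure; rewrite ?inE; [exact: mnear|exact: mnear|].
    by move=> w /= /le_trans; exact.
  apply: le_trans (near_pair_prob ij s0) _; rewrite lee_fin.
  apply: le_trans se; rewrite ler_wpM2l// -(prednK d_gt0) exprS ler_piMr ?mulr_ge0//.
  by rewrite exprn_ile1// mulr_ge0.
- by move=> w /= /negP; rewrite negbK => /eqP ->; rewrite subrr enorm0.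
Qed.

Let pI I := prob_component X (r n) I (P := P).
Let pIJ I J := prob_components X (r n) I J (P := P).

Let hc I : bounded_mfun (fun w => (is_component X (r n) I w)%:R : R).
Proof.
apply: bounded_mfun_bool.
exact: (measurable_block_event X [set: 'I_n]%SET (@measurable_closer_event _ _ _ (r n)
  (fun e => clustered e I && detached e I))).
Qed.

Let sampleE w : sample X n w = [fset tnth (Z w) i | i : 'I_n]%fset.
Proof.
by apply/fsetP => x; apply/imfsetP/imfsetP => -[i _ ->]; exists i => //; rewrite tnth_block ?inE.
Qed.

Let component_countE : {ae P, forall w, component_count X r k n w =
  \sum_(I : {set 'I_n} | #|I| == k) (is_component X (r n) I w)%:R}.
Proof.
apply: filterS ae_distinct => w inj; rewrite /component_count sampleE.
by rewrite (num_components_inj k_gt0 r_ge0 inj) natr_sum.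
Qed.

Let bounded_count : bounded_mfun (component_count X r k n).
Proof.
rewrite /component_count; split.
  under eq_fun do rewrite sampleE.
  exact: (measurableT_comp (measurable_num_components k r_ge0) (measurable_block X _)).
exists #|{set 'I_n}|%:R => w; rewrite ler0n ler_nat sampleE num_components_tuple//.
exact: max_card.
Qed.

Lemma component_count_expectation :
  ('E_P[component_count X r k n] = (\sum_(I : {set 'I_n} | #|I| == k) pI I)%:E)%E.
Proof.
rewrite expectation_mean//; congr EFin.
have hs := bounded_mfun_sum (fun I (_ : #|I| == k) => hc I).
by rewrite (mean_ae_eq bounded_count hs component_countE) mean_sum.
Qed.

Lemma component_count_variance :
  ('V_P[component_count X r k n] =
   (\sum_(I : {set 'I_n} | #|I| == k) \sum_(J : {set 'I_n} | #|J| == k) pIJ I J -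
    (\sum_(I : {set 'I_n} | #|I| == k) pI I) ^+ 2)%:E)%E.
Proof.
rewrite variance_mean//; congr EFin.
have hs := bounded_mfun_sum (fun I (_ : #|I| == k) => hc I).
rewrite (mean_ae_eq bounded_count hs component_countE) mean_sum//; congr (_ - _).
have hcc I J : bounded_mfun (fun w =>
    (is_component X (r n) I w && is_component X (r n) J w)%:R : R).
  under eq_fun do rewrite -mulnb natrM; exact: bounded_mfunM.
rewrite (@mean_ae_eq _ _ _ _ _ (fun w => \sum_(I : {set 'I_n} | #|I| == k)
   \sum_(J : {set 'I_n} | #|J| == k) (is_component X (r n) I w && is_component X (r n) J w)%:R)); first last.
- apply: filterS component_countE => w ->; rewrite expr2 mulr_suml.
  by apply: eq_bigr => I _; rewrite mulr_sumr; apply: eq_bigr => J _; rewrite -mulnb natrM.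
- by apply: bounded_mfun_sum => I _; exact: bounded_mfun_sum.
- exact: bounded_mfunX.
rewrite mean_sum => [|I _]; last exact: bounded_mfun_sum.
by apply: eq_bigr => I _; rewrite mean_sum.
Qed.

End component_count_moments.

(** * Decay of the error *)

Lemma half_le_sub n k : (4 * k <= n -> n <= 2 * (n - 2 * k))%N.
Proof. lia. Qed.

Lemma half_le_sub1 n k : (4 * k <= n -> n <= 2 * (n - k))%N.
Proof. lia. Qed.

Lemma two_mul_le n k : (4 * k <= n -> 2 * k <= n)%N.
Proof. lia. Qed.

Section decay.
Context {R : realType}.
Implicit Types (n k m : nat) (s a u : R).

Lemma expRN_exp_le n m g : (n <= 2 * m)%N -> 0 <= g ->
  expR (- g) ^+ m <= expR (- (g / 2 * n%:R)) :> R.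
Proof.
move=> nm g0; rewrite -expRM_natl ler_expR mulrN lerN2.
have : n%:R <= 2 * m%:R :> R by rewrite -natrM ler_nat.
by move: g0 => /[swap]; nra.
Qed.

(** Raise [a * (1 + s) <= expR (a * (1 + s))] to the power [k]: a polynomial costs an exponential of
    as small a rate as desired. *)
Lemma exp_le_expR k s a : 0 < a -> 0 <= s ->
  (1 + s) ^+ k <= a^-1 ^+ k * expR (a * k%:R) * expR (a * k%:R * s).
Proof.
move=> a0 s0; rewrite -mulrA -expRD.
have -> : a * k%:R + a * k%:R * s = k%:R * (a * (1 + s)) by ring.
rewrite expRM_natl -exprMn lerXn2r ?nnegrE ?addr_ge0 ?mulr_ge0 ?expR_ge0 ?invr_ge0 ?(ltW a0)//.
by rewrite mulrC ler_pdivlMr// mulrC (le_trans _ (expR_ge1Dx _))// lerDr.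
Qed.

(** Powers of [n] and of [u] combine into powers of [n * u]. The largest, [k.+1], comes from the
    relative loss [2 * (n - k) * (K0 * u) ^+ 2], which carries an extra factor [n * u]. *)
Lemma poly_decay n k (K0 K1 K2 u g E : R) : (0 < k)%N -> (4 * k <= n)%N ->
  0 <= K0 -> 0 <= K1 -> 0 <= K2 -> 0 <= u -> 0 <= g -> E = expR (- g) ->
  n%:R ^+ k * ((4 * k%:R * (K0 * u) + 2 * (n - k)%:R * (K0 * u) ^+ 2) *
      (E ^+ (n - k) * (K1 * u) ^+ k.-1) +
    2 * (2 * E ^+ (n - 2 * k) * (k%:R * (K2 * u) ^+ k))) +
  k%:R * n%:R ^+ k.-1 * (E ^+ (n - k) * (K1 * u) ^+ k.-1) <=
  (4 * k%:R * K0 * K1 ^+ k.-1 + 2 * K0 ^+ 2 * K1 ^+ k.-1 + 4 * k%:R * K2 ^+ k +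
     k%:R * K1 ^+ k.-1) * (1 + n%:R * u) ^+ k.+1 * expR (- (g / 2 * n%:R)).
Proof.
case: k => // k _ kn K00 K10 K20 u0 g0 EE /=; set s := n%:R * u.
set e := expR _; have e0 : 0 <= e by exact: expR_ge0.
have s0 : 0 <= s by exact: mulr_ge0.
have E1 : 0 <= E ^+ (n - k.+1) <= e.
  by rewrite EE exprn_ge0 ?expR_ge0//=; exact: expRN_exp_le (half_le_sub1 kn) g0.
have E2 : 0 <= E ^+ (n - 2 * k.+1) <= e.
  by rewrite EE exprn_ge0 ?expR_ge0//=; exact: expRN_exp_le (half_le_sub kn) g0.
have nn : (n - k.+1)%:R <= n%:R :> R by rewrite ler_nat leq_subr.
move: E1 E2; set x := E ^+ _; set y := E ^+ _ => /andP[x0 xe] /andP[y0 ye].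
have sT j : (j <= k.+2)%N -> s ^+ j <= (1 + s) ^+ k.+2.
  move=> jk; apply: (@le_trans _ _ ((1 + s) ^+ j)).
    by rewrite lerXn2r ?nnegrE ?addr_ge0// lerDr.
  by rewrite ler_weXn2l// lerDl.
have T0 : 0 <= (1 + s) ^+ k.+2 by rewrite exprn_ge0// addr_ge0.
have P1 : 0 <= K1 ^+ k by rewrite exprn_ge0.
have P2 : 0 <= K2 ^+ k.+1 by rewrite exprn_ge0.
have key (c z : R) j : 0 <= c -> 0 <= z -> z <= e -> (j <= k.+2)%N ->
    c * s ^+ j * z <= c * (1 + s) ^+ k.+2 * e.
  move=> c0 z0 ze jk; apply: ler_pM => //; first by rewrite mulr_ge0// exprn_ge0.
  by rewrite ler_wpM2l// sT.
have c1 : 0 <= 4 * k.+1%:R * K0 * K1 ^+ k by rewrite !mulr_ge0.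
have c2 : 0 <= 2 * K0 ^+ 2 * K1 ^+ k by rewrite !mulr_ge0// exprn_ge0.
have c3 : 0 <= 4 * k.+1%:R * K2 ^+ k.+1 by rewrite !mulr_ge0.
have c4 : 0 <= k.+1%:R * K1 ^+ k by rewrite !mulr_ge0.
have t1 := key _ x k.+1 c1 x0 xe (leqnSn _).
have t2 := key _ x k.+2 c2 x0 xe (leqnn _).
have t3 := key _ y k.+1 c3 y0 ye (leqnSn _).
have t4 := key _ x k c4 x0 xe (leqW (leqnSn _)).
have F0 : 0 <= 2 * n%:R ^+ k.+1 * (K0 * u) ^+ 2 * (x * (K1 * u) ^+ k).
  have Q1 : 0 <= (K0 * u) ^+ 2 by rewrite sqr_ge0.
  have Q2 : 0 <= (K1 * u) ^+ k by rewrite exprn_ge0// mulr_ge0.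
  by rewrite !mulr_ge0// exprn_ge0.
have t5 : (n - k.+1)%:R * (2 * n%:R ^+ k.+1 * (K0 * u) ^+ 2 * (x * (K1 * u) ^+ k)) <=
    n%:R * (2 * n%:R ^+ k.+1 * (K0 * u) ^+ 2 * (x * (K1 * u) ^+ k)).
  by rewrite ler_wpM2r.
apply: (@le_trans _ _ (4 * k.+1%:R * K0 * K1 ^+ k * s ^+ k.+1 * x +
  2 * K0 ^+ 2 * K1 ^+ k * s ^+ k.+2 * x + 4 * k.+1%:R * K2 ^+ k.+1 * s ^+ k.+1 * y +
  k.+1%:R * K1 ^+ k * s ^+ k * x)); last by lra.
have -> : 2 * K0 ^+ 2 * K1 ^+ k * s ^+ k.+2 * x =
    n%:R * (2 * n%:R ^+ k.+1 * (K0 * u) ^+ 2 * (x * (K1 * u) ^+ k)).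
  by rewrite /s !exprMn !exprS; ring.
have -> : 4 * k.+1%:R * K0 * K1 ^+ k * s ^+ k.+1 * x =
   n%:R ^+ k.+1 * (4 * k.+1%:R * (K0 * u) * (x * (K1 * u) ^+ k)).
  by rewrite /s !exprMn !exprS; ring.
have -> : 4 * k.+1%:R * K2 ^+ k.+1 * s ^+ k.+1 * y =
   n%:R ^+ k.+1 * (2 * (2 * y * (k.+1%:R * (K2 * u) ^+ k.+1))).
  by rewrite /s !exprMn; ring.
have -> : k.+1%:R * K1 ^+ k * s ^+ k * x = k.+1%:R * n%:R ^+ k * (x * (K1 * u) ^+ k).
  by rewrite /s !exprMn; ring.
by move: t5; lra.
Qed.

End decay.

Lemma sub_mul_norm_le {R : realDomainType} (q x y a b c c' : R) :
  0 <= x -> 0 <= y -> 0 <= a -> 0 <= b -> 0 <= c -> c' <= c ->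
  q <= (1 + a) * (x * y) + c * (x + y) ->
  x * y <= q + b * (x * y) + c' * x ->
  `|q - x * y| <= (a + b) * (x * y) + c * (x + y).
Proof.
move=> x0 y0 a0 b0 c0 cc up lo; have xy : 0 <= x * y by exact: mulr_ge0.
have := mulr_ge0 a0 xy; have := mulr_ge0 b0 xy; have := mulr_ge0 c0 y0.
have := ler_wpM2r x0 cc => h1 h2 h3 h4.
by rewrite ler_norml; apply/andP; split; lra.
Qed.

Section variance_bound.
Context {disp : measure_display} {Omega : measurableType disp} {R : realType}
  {P : probability Omega R} {d : nat} (nu : probability 'rV[R]_d R)
  (X : nat -> {RV P >-> 'rV[R]_d}) (A : set 'rV[R]_d) (M eps kappa : R) (k : nat).
Hypotheses (X_iid : iid X nu) (mA : measurable A) (nuA : nu (~` A) = 0%E)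
  (d_gt0 : (0 < d)%N) (M_ge0 : 0 <= M) (k_gt0 : (0 < k)%N)
  (nuM : forall x t, 0 <= t -> (nu (eball x t) <= (M * t ^+ d)%:E)%E)
  (eps_gt0 : 0 < eps) (eps_le : eps <= 1 / 5) (kappa_gt0 : 0 < kappa)
  (A_cone : forall x, A x -> cone_at A x eps)
  (nu_lower : forall x s, 0 <= s -> eball x s `<=` A ->
     ((kappa * s ^+ d)%:E <= nu (eball x s))%E).

Let kappa_ge0 : 0 <= kappa. Proof. exact: ltW. Qed.

Lemma variance_expectation_le : exists C c : R, [/\ 0 < C, 0 < c &
  forall (r : nat -> R) n, (4 * k <= n)%N -> 0 < r n ->
    (2 * k + 2)%:R * r n <= eps -> 4 * k%:R * (k%:R * (M * r n ^+ d)) <= 1 ->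
  exists v e : R, [/\ ('V_P[component_count X r k n] = v%:E)%E,
    ('E_P[component_count X r k n] = e%:E)%E, 0 <= e &
    `|v - e| <= e * (C * expR (- (c * n%:R * r n ^+ d)))]].
Proof.
(* The gap equals [c1 * r n ^+ d]. *)
pose c1 := kappa * (eps / 2) ^+ d.
have c1_gt0 : 0 < c1 by rewrite mulr_gt0// exprn_gt0// divr_gt0.
pose K0 := k%:R * M; pose K1 := M * k%:R ^+ d; pose K2 := M * (k + 2)%:R ^+ d.
have K00 : 0 <= K0 by exact: mulr_ge0.
have K10 : 0 <= K1 by rewrite mulr_ge0// exprn_ge0.
have K20 : 0 <= K2 by rewrite mulr_ge0// exprn_ge0.
pose C0 := 4 * k%:R * K0 * K1 ^+ k.-1 + 2 * K0 ^+ 2 * K1 ^+ k.-1 +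
  4 * k%:R * K2 ^+ k + k%:R * K1 ^+ k.-1.
have C00 : 0 <= C0 by rewrite /C0 !addr_ge0 ?mulr_ge0// exprn_ge0.
(* Chosen so that [a * k.+1 = c1 / 4]: of the decay rate [c1 / 2] left by [poly_decay], half absorbs
   the polynomial and [c1 / 4] remains. *)
pose a := c1 / (4 * k.+1%:R).
have a_gt0 : 0 < a by rewrite divr_gt0// mulr_gt0.
pose C1 := a^-1 ^+ k.+1 * expR (a * k.+1%:R).
have C1_gt0 : 0 < C1 by rewrite mulr_gt0 ?expR_gt0// exprn_gt0// invr_gt0.
exists ((C0 + 1) * C1), (c1 / 4); split.
- by rewrite mulr_gt0// ltr_wpDl.
- by rewrite divr_gt0.
move=> r n kn r0 r_eps r_mass; have r_ge0 := ltW r0.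
set u := r n ^+ d; have u0 : 0 <= u by rewrite exprn_ge0.
pose p (I : {set 'I_n}) := prob_component X (r n) I (P := P).
pose p2 (I J : {set 'I_n}) := prob_components X (r n) I J (P := P).
exists (\sum_(I : {set 'I_n} | #|I| == k) \sum_(J : {set 'I_n} | #|J| == k) p2 I J -
    (\sum_(I : {set 'I_n} | #|I| == k) p I) ^+ 2), (\sum_(I : {set 'I_n} | #|I| == k) p I).
have p_ge0 (I : {set 'I_n}) : 0 <= p I by exact: prob_component_ge0.
have e_ge0 : 0 <= \sum_(I : {set 'I_n} | #|I| == k) p I by exact: sumr_ge0.
split => //.
- exact: (component_count_variance X_iid d_gt0 r_ge0 M_ge0 k_gt0 nuM).
- exact: (component_count_expectation X_iid d_gt0 r_ge0 M_ge0 k_gt0 nuM).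
pose E := expR (- (c1 * u)).
have gE : gap eps kappa (r n) (d := d) = c1 * u.
  by rewrite /gap /c1 /u !exprMn; ring.
pose rho := E ^+ (n - k) * (K1 * u) ^+ k.-1.
pose al := 4 * k%:R * (K0 * u) + 2 * (n - k)%:R * (K0 * u) ^+ 2.
pose be := 2 * E ^+ (n - 2 * k) * (k%:R * (K2 * u) ^+ k).
have E0 : 0 <= E by exact: expR_ge0.
have al0 : 0 <= al by rewrite addr_ge0// mulr_ge0 ?mulr_ge0// sqr_ge0.
have be0 : 0 <= be by rewrite !mulr_ge0 ?exprn_ge0 ?mulr_ge0.
have rho0 : 0 <= rho by rewrite !mulr_ge0 ?exprn_ge0 ?mulr_ge0.
have K0E : k%:R * (M * r n ^+ d) = K0 * u by rewrite mulrA.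
have K1E : M * (k%:R * r n) ^+ d = K1 * u by rewrite exprMn mulrA.
have K2E : M * ((k + 2)%:R * r n) ^+ d = K2 * u by rewrite exprMn mulrA.
have p_le (I : {set 'I_n}) : #|I| = k -> p I <= rho.
  move=> Ik.
  have := prob_component_le X_iid mA nuA r0 M_ge0 k_gt0 nuM eps_gt0 eps_le kappa_ge0
    A_cone nu_lower r_eps Ik.
  by rewrite gE K1E.
have p2_disj (I J : {set 'I_n}) : [disjoint I & J]%B -> #|I| = k -> #|J| = k ->
    `|p2 I J - p I * p J| <= al * (p I * p J) + be * (p I + p J).
  move=> IJ Ik Jk.
  have up := prob_components_upper X_iid mA nuA r0 M_ge0 k_gt0 nuM eps_gt0 eps_le kappa_ge0
    A_cone nu_lower r_eps r_mass IJ Ik Jk (two_mul_le kn).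
  have lo := prob_components_lower X_iid mA nuA r0 M_ge0 k_gt0 nuM eps_gt0 eps_le kappa_ge0
    A_cone nu_lower r_eps r_mass IJ Ik Jk (two_mul_le kn).
  move: up lo; rewrite gE K0E K2E -/E -/(p I) -/(p J) -/(p2 I J) => up lo.
  set ns := k%:R * (K2 * u) ^+ k in up lo be be0 *.
  have ns0 : 0 <= ns by rewrite mulr_ge0// exprn_ge0// mulr_ge0.
  have EN : E ^+ (n - k) <= E ^+ (n - 2 * k).
    by rewrite ler_wiXn2l ?leq_sub2l ?leq_pmull// expR_le1 oppr_le0 mulr_ge0// ltW.
  apply: (sub_mul_norm_le _ _ _ _ _ _ up lo) => //.
  - by rewrite !mulr_ge0.
  - by rewrite !mulr_ge0// sqr_ge0.
  - have : E ^+ (n - k) * ns <= E ^+ (n - 2 * k) * ns by rewrite ler_wpM2r.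
    by move=> /le_trans; apply; rewrite /be -[leRHS]mulrA ler_peMl ?ler1n// mulr_ge0// exprn_ge0.
have p2_diag (I : {set 'I_n}) : p2 I I = p I.
  by rewrite /p2 /p /prob_components; under eq_fun do rewrite andbb.
have p2_meet (I J : {set 'I_n}) : I != J -> ~~ [disjoint I & J]%B -> p2 I J = 0.
  move=> IJ nIJ; rewrite /p2 /prob_components -(mean_cst P 0); congr mean.
  by apply/funext => w; rewrite /is_component (negbTE (overlapping_components _ _ IJ nIJ)).
have := second_moment_bound k_gt0 al0 be0 rho0 p_ge0 p_le p2_diag p2_meet p2_disj.
move/le_trans; apply; rewrite ler_wpM2l//.
have cu : 0 <= c1 * u by rewrite mulr_ge0// ltW.
have := poly_decay k_gt0 kn K00 K10 K20 u0 cu (erefl E).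
move/le_trans; apply; rewrite -/C0.
have nu0 : 0 <= n%:R * u by exact: mulr_ge0.
have T := exp_le_expR k.+1 a_gt0 nu0.
rewrite -/C1 in T.
have aE : a * k.+1%:R = c1 / 4 by rewrite /a invfM mulrA -mulrA mulVf ?mulr1// pnatr_eq0.
have -> : expR (- (c1 / 4 * n%:R * u)) = expR (c1 / 4 * (n%:R * u)) * expR (- (c1 * u / 2 * n%:R)).
  by rewrite -expRD; congr expR; lra.
have D1 : C0 * (1 + n%:R * u) ^+ k.+1 <= (C0 + 1) * C1 * expR (c1 / 4 * (n%:R * u)).
  rewrite -mulrA; apply: ler_pM => //.
  - by rewrite exprn_ge0// addr_ge0.
  - by rewrite lerDl.
  - by rewrite -aE.
by rewrite mulrA ler_wpM2r// expR_ge0.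
Qed.

End variance_bound.

(** * Smallness of the radius *)

Section small_radius.
Context {R : realType} {d : nat} (d_gt0 : (0 < d)%N).

Lemma unit_ball_volume_gt0 : 0 < unit_ball_volume d :> R.
Proof.
have -> : unit_ball_volume d = fine (lebesgue_rV d (eball (0 : 'rV[R]_d) 1)).
  by congr (fine (lebesgue_rV d _)); apply/seteqP; split => x; rewrite /eball /= subr0.
have ge := lebesgue_rV_ball_ge (0 : 'rV[R]_d) d_gt0 ler01.
have le := lebesgue_rV_ball_le (0 : 'rV[R]_d) ler01.
apply: fine_gt0; apply/andP; split.
  by apply: lt_le_trans ge; rewrite lte_fin exprn_gt0// mulr_gt0// divr_gt0// ltr0n.
by apply: le_lt_trans le _; exact: ltry.
Qed.

Lemma ln_le_sqrt (x : R) : 0 < x -> ln x <= 2 * Num.sqrt x.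
Proof.
move=> x0; have s0 : 0 < Num.sqrt x by rewrite sqrtr_gt0.
rewrite -{1}(sqr_sqrtr (ltW x0)) lnXn// -[leLHS]mulr_natl ler_wpM2l//.
exact/ltW/ln_sublinear.
Qed.

(** A finite limit superior gives n r^d = O(log n), and [ln n <= 2 * sqrt n] then bounds r^d by a
    multiple of n^(-1/2). *)
Lemma radius_pow_small (r : nat -> R) (L : \bar R) (delta : R) :
  (forall n, (0 < n)%N -> 0 < r n) -> (L < +oo)%E ->
  (limn_esup (fun n => (unit_ball_volume d * n%:R * r n ^+ d / ln n%:R)%:E) < L)%E ->
  0 < delta -> \forall n \near \oo, r n ^+ d <= delta.
Proof.
move=> r0 Loo; rewrite /limn_esup /limf_esup.
have th := unit_ball_volume_gt0; set theta := unit_ball_volume d in th *.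
move=> /ereal_inf_lt[_ [V Vn <-]] supL dl0.
(* Some tail supremum is below [+oo]; its maximum with 1, or 1 if it is [-oo], is a positive
   bound. *)
have [l l0 ul] : exists2 l : R, 0 < l & forall n, V n -> theta * n%:R * r n ^+ d / ln n%:R <= l.
  move: supL; set S := ereal_sup _ => supL.
  have uS n : V n -> ((theta * n%:R * r n ^+ d / ln n%:R)%:E <= S)%E.
    by move=> Vm; apply: ereal_sup_ubound; exists n.
  have {supL} : (S < +oo)%E by exact: lt_trans Loo.
  case: S uS => [s uS _|//|uS _].
    exists (Num.max 1 s) => [|m Vm]; first by rewrite lt_max ltr01.
    by rewrite le_max; apply/orP; right; rewrite -lee_fin; exact: uS.
  by exists 1 => // m /uS; rewrite leeNy_eq.
near=> n.
have Vnn : V n by near: n.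
have n2 : (2 <= n)%N by near: n; exists 2%N.
have n0 : 0 < n%:R :> R by rewrite ltr0n (ltn_trans _ n2).
have lnn : 0 < ln n%:R :> R by rewrite ln_gt0// ltr1n.
have sn : 0 < Num.sqrt n%:R :> R by rewrite sqrtr_gt0.
have large : 2 * l / (theta * delta) <= Num.sqrt n%:R.
  apply: le_trans (ler_norm _) _; rewrite -sqrtr_sqr ler_wsqrtr//.
  by near: n; exact: nbhs_infty_ger.
have := ul n Vnn; rewrite ler_pdivrMr// => h.
have h2 := ln_le_sqrt n0.
have snn := sqr_sqrtr (ltW n0).
rewrite ler_pdivrMr ?mulr_gt0// in large.
rewrite -(ler_pM2l (mulr_gt0 th n0)); apply: le_trans h _.
apply: (@le_trans _ _ (l * (2 * Num.sqrt n%:R))); first by rewrite ler_wpM2l// ltW.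
rewrite -[in leRHS]snn expr2.
rewrite mulrCA mulrA mulrA -[leRHS]mulrA; nra.
Unshelve. all: by end_near.
Qed.

End small_radius.

Theorem proposition4p3 (R : realType) (d : nat) (hd : (0 < d)%N)
    (A : set 'rV[R]_d)
    (A_compact : compact A)
    (A_volume : (0 < lebesgue_rV d A)%E)
    (A_C11 : (2 <= d)%N -> C11_boundary A)
    (A_interval : d = 1%N -> forall i : 'I_d, is_interval [set x ord0 i | x in A])
    (disp : measure_display) (Omega : measurableType disp)
    (P : probability Omega R)
    (nu : probability 'rV[R]_d R) (f : 'rV[R]_d -> R)
    (X : nat -> {RV P >-> 'rV[R]_d})
    (X_iid : iid X nu)
    (nu_density : has_density nu f)
    (nu_support : support_of nu = A)
    (f_continuous : {within A, continuous f})
    (f_inf_gt0 : 0 < inf (f @` A))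
    (r : nat -> R)
    (r_gt0 : forall n, (0 < n)%N -> 0 < r n)
    (r_lower : n%:R * r n ^+ d @[n --> \oo] --> +oo)
    (r_upper :
      (limn_esup (fun n =>
         (unit_ball_volume d * n%:R * r n ^+ d / ln n%:R)%:E) <
       (1 / Num.max (inf (f @` A))
              (d%:R * (inf (f @` A) - inf (f @` boundary A) / 2)))%:E)%E)
    (k : nat) (hk : (0 < k)%N) :
  exists2 c : R, 0 < c &
    exists2 g : nat -> R,
      g =O_\oo (fun n => expR (- (c * n%:R * r n ^+ d))) &
      \forall n \near \oo,
        ('V_P[component_count X r k n] =
         'E_P[component_count X r k n] * (1 + g n)%:E)%E.
Proof.
have mA := measurable_compact_rV A_compact.
have nuI B : measurable B -> nu B = nu (B `&` A).
  by move=> mB; apply: density_setIA.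
have nuA : nu (~` A) = 0%E.
  by rewrite nuI ?setICl ?measure0//; exact: measurableC.
have [M M0 nuM] := density_upper A_compact nu_density nu_support f_continuous.
have [eps0 eps0_gt0 cone0] := cone_condition hd A_compact A_volume A_C11 A_interval
  nu_support nuI (ltW M0) nuM.
(* Half of [eps0] is what [cone_at_shrink] grants; [1 / 5] is required by [separated_gap]. *)
pose eps := Num.min (eps0 / 2) (1 / 5).
have eps_gt0 : 0 < eps by rewrite lt_min !divr_gt0.
have eps_le : eps <= 1 / 5 by rewrite ge_min lexx orbT.
have A_cone x : A x -> cone_at A x eps.
  move=> Ax; apply: (cone_at_shrink (cone0 x Ax)); last exact: ltW.
    by rewrite ge_min lexx.
  by rewrite subrr enorm0 divr_ge0// ltW.
pose kappa := inf (f @` A) * (2 / d%:R) ^+ d.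
have kappa_gt0 : 0 < kappa by rewrite mulr_gt0// exprn_gt0// divr_gt0// ltr0n.
have nu_lower x s : 0 <= s -> eball x s `<=` A ->
    ((kappa * s ^+ d)%:E <= nu (eball x s))%E.
  move=> s0 sA.
  have -> : kappa * s ^+ d = inf (f @` A) * (2 * (s / d%:R)) ^+ d.
    by rewrite /kappa -mulrA -exprMn; congr (_ * _ ^+ _); rewrite mulrAC mulrA.
  exact (density_lower nu_density f_inf_gt0 hd s0 sA).
have [C [c [C0 c0 bound]]] := variance_expectation_le X_iid mA nuA hd (ltW M0) hk nuM
  eps_gt0 eps_le kappa_gt0 A_cone nu_lower.
(* The two bounds encode the two smallness conditions on [r n] in [variance_expectation_le]. *)
pose delta := Num.min ((eps / (2 * k + 2)%:R) ^+ d) (4 * k%:R * k%:R * M)^-1.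
have delta_gt0 : 0 < delta.
  by rewrite lt_min exprn_gt0 ?divr_gt0// invr_gt0 !mulr_gt0// ltr0n.
have small := radius_pow_small hd r_gt0 (ltry _) r_upper delta_gt0.
pose Vn n := fine 'V_P[component_count X r k n]; pose En n := fine 'E_P[component_count X r k n].
(* If the expectation is 0, the bound forces the variance to be 0 as well, so the value 0 satisfies
   both requirements. *)
pose g n := if En n == 0 then 0 else Vn n / En n - 1.
have main : \forall n \near \oo, `|g n| <= C * expR (- (c * n%:R * r n ^+ d)) /\
    ('V_P[component_count X r k n] = 'E_P[component_count X r k n] * (1 + g n)%:E)%E.
  near=> n.
  have kn : (4 * k <= n)%N by near: n; exists (4 * k)%N.
  have n0 : (0 < n)%N by apply: leq_trans kn; rewrite muln_gt0.
  have rn := r_gt0 n n0.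
  have : r n ^+ d <= delta by near: n.
  rewrite le_min => /andP[r1 r2].
  have r_eps : (2 * k + 2)%:R * r n <= eps.
    have K0 : 0 < (2 * k + 2)%:R :> R by rewrite ltr0n addn2.
    rewrite mulrC -ler_pdivlMr// -(ler_pXn2r hd)// nnegrE; first exact: ltW.
    by rewrite divr_ge0// ltW.
  have r_mass : 4 * k%:R * (k%:R * (M * r n ^+ d)) <= 1.
    by rewrite !mulrA -ler_pdivlMl ?mulr1// !mulr_gt0// ltr0n.
  have [v [e [vE eE e0 ve]]] := bound r n kn rn r_eps r_mass.
  rewrite /g /Vn /En vE eE/=.
  have [e00|e_neq0] := eqVneq e 0.
    rewrite normr0 mulr_ge0 ?expR_ge0 ?(ltW C0)//; split => //.
    by move: ve; rewrite e00 mul0r subr0 normr_le0 => /eqP ->; rewrite mul0e.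
  have e_gt0 : 0 < e by rewrite lt_neqAle eq_sym e_neq0.
  split; last by rewrite -EFinM addrC subrK mulrC divfK.
  have -> : v / e - 1 = (v - e) / e by rewrite mulrBl divff.
  by rewrite normrM normfV (gtr0_norm e_gt0) ler_pdivrMr// mulrC.
exists c => //; exists g; last by apply: filterS main => n [].
apply/eqO_exP; exists C => //; apply: filterS main => n [h _].
by rewrite [X in _ <= _ * X]ger0_norm ?expR_ge0.
Unshelve. all: by end_near.
Qed.
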